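(* Let $\mathfrak g$ be of type $A_{n-1}$ ($n\ge2$) and let $I$ be any subset of $\Pi$ of cardinality $r\ge1$. Then $\chi(\mathtt{Shi}(I),t)$ depends only on $r$ (not on which $r$ simple roots $I$ contains), and the multiset of its roots is $$\exp(\mathtt{Shi}(I))=\{(n-r)^{n-r},(n-r+1)^1,(n-r+2)^1,\dots,(n-1)^1\}.$$ In particular, the number of regions of $\mathtt{Shi}(I)$ is $(n-r+1)^{n-r-1}n!/(n-r)!$ and the number of bounded regions is $(n-r-1)^{n-r-1}(n-2)!/(n-r-2)!$. Moreover, $\mathtt{Shi}(I)$ is inductively free in the sense of Athanasiadis, hence free in the sense of Terao.
   Context: $V=\{x\in\mathbb R^n\mid x_1+\dots+x_n=0\}$ with the standard inner product $(\,,\,)$; positive roots $\Delta^+=\{e_i-e_j\mid1\le i<j\le n\}$, simple roots $\Pi=\{e_i-e_{i+1}\mid 1\le i\le n-1\}$. $H_{\alpha,k}=\{v\in V\mid(v,\alpha)=k\}$, $\mathtt{Cox}=\{H_{\alpha,0}\mid\alpha\in\Delta^+\}$. $\Delta_I$ is the subroot system spanned by $I$, $\Delta_I^+=\Delta_I\cap\Delta^+$, $C_I=\{\beta\in\Delta^+\setminus\Delta_I\mid\beta-\alpha\notin\Delta\ \forall\alpha\in\Delta_I^+\}$, and $\mathtt{Shi}(I)=\mathtt{Cox}\cup\{H_{\alpha,1}\mid\alpha\in C_I\}$, an arrangement in $V$. For an arrangement $\mathcal A$ in $V$, $L(\mathcal A)$ is the poset of nonempty intersections of subsets of $\mathcal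 A$ (including $V$) ordered by reverse inclusion, $\chi(\mathcal A,t)=\sum_{x\in L(\mathcal A)}\mu(V,x)t^{\dim x}$, and $\exp(\mathcal A)$ is the multiset of roots of $\chi(\mathcal A,t)$, written $\{a_1^{m_1},\dots\}$ with multiplicities $m_i$. Regions are connected components of the complement in $V$ of the union of the hyperplanes. Inductive freeness in the sense of Athanasiadis is the notion of C. A. Athanasiadis, ''On free deformations of the braid arrangement'' (European J. Combin. 1998) for deformations of the braid arrangement; freeness in the sense of Terao means the cone of the arrangement is free (its module of logarithmic derivations is a free module). *)

(* Defs.v *)
From HB Require Import structures.
From mathcomp Require Import all_boot all_order all_algebra all_field.
From mathcomp Require Import finmap multiset.
From mathcomp Require Import all_classical all_reals all_analysis.
(* The notations of mpoly clash with those of MathComp-Analysis. *)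
From mathcomp Require mpoly.
Import (canonicals) mpoly.

Set Implicit Arguments.
Unset Strict Implicit.
Unset Printing Implicit Defensive.

Import Order.TTheory GRing.Theory Num.Theory.
Import numFieldNormedType.Exports.

Local Open Scope fset_scope.
Local Open Scope classical_set_scope.
Local Open Scope ring_scope.

Section Mobius.
Context {d : Order.disp_t} {T : porderType d}.
Implicit Types (P : {fset T}) (a b c : T).

(* The fuel [k] bounds the number of elements of a chain from [a] to [b];
   see [mobiusE] for the fuel-free recursion. *)
Fixpoint mobius_rec (k : nat) P a b : int :=
  if k is k'.+1 then
    if a == b then 1
    else if (a < b)%O then
      - \sum_(c <- P | (a <= c)%O && (c < b)%O) mobius_rec k' P a c
    else 0
  else 0.

Definition mobius P a b : int := mobius_rec #|` P| P a b.

Lemma mobius_rec_stable P a b k : b \in P ->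
  (#|` [fset c in P | (c <= b)%O]| <= k)%N ->
  mobius_rec k P a b = mobius_rec #|` [fset c in P | (c <= b)%O]| P a b.
Proof.
have [m] := ubnP #|` [fset c in P | (c <= b)%O]|.
elim: m b k => // m IH b k lm bP lk.
have pos : (0 < #|` [fset c in P | (c <= b)%O]|)%N.
  by rewrite cardfs_gt0; apply/fset0Pn; exists b; rewrite !inE bP /=.
case: k lk => [|k] lk; first by move: lk; rewrite leqNgt pos.
case def_j: #|` [fset c in P | (c <= b)%O]| pos => [//|j] _ /=.
case: (a == b) => //; case: (a < b)%O => //; congr (- _).
rewrite big_seq_cond [RHS]big_seq_cond.
apply: eq_bigr => c /and3P[cP _ cb].
have lt_c : (#|` [fset x in P | (x <= c)%O]| <
             #|` [fset x in P | (x <= b)%O]|)%N.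
  apply: fproper_ltn_card; rewrite fproperE; apply/andP; split.
    apply/fsubsetP => x; rewrite !inE => /andP[-> xc] /=.
    exact: le_trans xc (ltW cb).
  apply/negP => /fsubsetP/(_ b).
  by rewrite !inE bP lexx /= => /(_ isT); rewrite lt_geF.
have cm : (#|` [fset x in P | (x <= c)%O]| < m)%N.
  exact: leq_trans lt_c _.
rewrite (IH c k) //; last by rewrite -ltnS; exact: leq_trans lt_c lk.
by rewrite (IH c j) // -ltnS -def_j.
Qed.

Lemma mobiusE P a b : b \in P ->
  mobius P a b =
    if a == b then 1
    else if (a < b)%O then
      - \sum_(c <- P | (a <= c)%O && (c < b)%O) mobius P a c
    else 0.
Proof.
move=> bP; have lec c : (#|` [fset x in P | (x <= c)%O]| <= #|` P|)%N.
  by apply: fsubset_leq_card; apply/fsubsetP => x; rewrite !inE => /andP[].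
have eqS k : (#|` [fset x in P | (x <= b)%O]| <= k)%N ->
    mobius_rec k P a b = mobius P a b.
  by move=> lek; rewrite /mobius (mobius_rec_stable a bP lek)
    -(mobius_rec_stable a bP (lec b)).
rewrite -(eqS #|` P|.+1) /=; last exact: leqW (lec b).
by case: (a == b).
Qed.

End Mobius.

Section Arrangements.
Context {F : fieldType}.
Implicit Types (E : vectType F).

(* Throughout, an arrangement is a finite set [A] of hyperplanes of an affine
   subspace [X] of a vector space [E]; the ambient space [X] is explicit, so
   that the restriction of [A] to one of its members [H] is an arrangement
   in [H]. *)

Definition direction E (X : set E) (U : {vspace E}) : Prop :=
  exists x0 : E, X = [set x0 + u | u in [set` U]].

Definition is_affine E (X : set E) : Prop := exists U, direction X U.

Definition adim E (X : set E) : nat := \dim (xget 0%VS (direction X)).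

Definition flat E (X : set E) (B : {fset set E}) : set E :=
  X `&` \bigcap_(H in [set` B]) H.

(* [(set E)^d] is ordered by reverse inclusion. *)
Definition flats E (X : set E) (A : {fset set E}) : {fset (set E)^d} :=
  [fset flat X B | B in fpowerset A & flat X B != set0].

Definition char_poly_arr E (X : set E) (A : {fset set E}) : {poly int} :=
  \sum_(Y <- flats X A)
    @mobius _ (set E)^d (flats X A) X Y *: 'X^(adim Y).

Definition root_mset (p : {poly algC}) : {mset algC}%mset :=
  seq_mset (sval (closed_field_poly_normal p)).

Definition exps E (X : set E) (A : {fset set E}) : {mset algC}%mset :=
  root_mset (map_poly intr (char_poly_arr X A)).

Definition restriction E (A : {fset set E}) (H : set E) : {fset set E} :=
  [fset H `&` K | K in (A `\ H)%fset & H `&` K != set0].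

(* Orlik-Terao, Arrangements of Hyperplanes, Definition 4.53, for arrangements
   that need not be central: the exponents of the members of this class are
   the roots of their characteristic polynomials. *)
Inductive inductively_free E : set E -> {fset set E} -> Prop :=
| IF_empty X : is_affine X -> inductively_free X fset0
| IF_add X A H :
    H \in A ->
    inductively_free X (A `\ H)%fset ->
    inductively_free H (restriction A H) ->
    (exps H (restriction A H) `<=` exps X (A `\ H)%fset)%mset ->
    inductively_free X A.

Definition lin_hull E (S : set E) : set E :=
  \bigcap_(U in [set U : {vspace E} | S `<=` [set` U]]) [set` U].

(* The homogenization of the affine subspace [a v = k] of [X] is the linear
   subspace [a v = k * t] of the pairs [(v, t)]. *)
Definition homogenize E (X : set E) : set (E * F^o)%type :=
  lin_hull (X `*` [set 1]).

Definition cone E (X : set E) (A : {fset set E}) : {fset set (E * F^o)%type} :=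
  ((homogenize X `&` [set w | w.2 = 0])%classic
     |` [fset homogenize H | H in A])%fset.

(* Polynomial functions on [W], in the coordinates given by [vbasis W]. *)
Definition poly_on E (W : {vspace E}) := mpoly.mpoly (\dim W) F.

Definition lin_poly E (W : {vspace E}) (f : 'Hom(E, F^o)) : poly_on W :=
  \sum_(i < \dim W)
    f (vbasis W)`_i *: mpoly.mpolyX F (mpoly.mnm1 i).

Definition is_derivation (n : nat)
    (theta : {linear mpoly.mpoly n F -> mpoly.mpoly n F}) : Prop :=
  forall p q, theta (p * q) = theta p * q + p * theta q.

Definition log_derivation E (W : {vspace E}) (A : {fset set E})
    (theta : {linear poly_on W -> poly_on W}) : Prop :=
  is_derivation theta /\
  forall (H : set E) (f : 'Hom(E, F^o)),
    H \in A -> H = [set w | w \in W /\ f w = 0] ->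
    exists q : poly_on W, theta (lin_poly W f) = lin_poly W f * q.

(* The module of logarithmic derivations of a central arrangement [A] in the
   linear subspace [X] has a (finite) basis. *)
Definition is_free E (X : set E) (A : {fset set E}) : Prop :=
  exists2 W : {vspace E}, X = [set` W] &
  exists (l : nat) (theta : 'I_l -> {linear poly_on W -> poly_on W}),
    (forall i, log_derivation A (theta i)) /\
    forall eta : {linear poly_on W -> poly_on W}, log_derivation A eta ->
      exists! c : {ffun 'I_l -> poly_on W},
        forall p, eta p = \sum_(i < l) c i * theta i p.

End Arrangements.

Section Regions.
Context {R : realType} {n : nat}.

Definition regions (X : set 'rV[R]_n) (A : {fset set 'rV[R]_n}) :
    set (set 'rV[R]_n) :=
  let M := X `\` \bigcup_(H in [set` A]) H in
  [set connected_component M x | x in M].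

Definition bounded_regions (X : set 'rV[R]_n) (A : {fset set 'rV[R]_n}) :
    set (set 'rV[R]_n) :=
  regions X A `&` [set C | bounded_set C].

End Regions.

Section TypeA.
Context {R : realType} {n : nat}.
Local Notation vec := 'rV[R]_n.
Implicit Types (I : {fset vec}).

Definition inner (x y : vec) : R := \sum_i x 0 i * y 0 i.

Definition eroot (p : 'I_n * 'I_n) : vec := delta_mx 0 p.1 - delta_mx 0 p.2.

Definition Delta : {fset vec} :=
  [fset eroot p | p in {: 'I_n * 'I_n} & p.1 != p.2].

Definition Delta_pos : {fset vec} :=
  [fset eroot p | p in {: 'I_n * 'I_n} & (p.1 < p.2)%N].

Definition simple_roots : {fset vec} :=
  [fset eroot p | p in {: 'I_n * 'I_n} & p.1.+1 == p.2 :> nat].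

(* For I made of simple roots, the roots in the real span of I are those in
   its integral span. *)
Definition Delta_sub I : {fset vec} := [fset a in Delta | a \in <<I>>%VS].

Definition Delta_sub_pos I : {fset vec} := (Delta_sub I `&` Delta_pos)%fset.

Definition C_sub I : {fset vec} :=
  [fset b in (Delta_pos `\` Delta_sub I)%fset
  | all (fun a => b - a \notin Delta) (Delta_sub_pos I)].

End TypeA.

Definition Vsp (R : realType) (n : nat) : set 'rV[R]_n :=
  [set x | \sum_i x 0 i = 0].

Definition hyp (R : realType) (n : nat) (a : 'rV[R]_n) (k : R) :
    set 'rV[R]_n :=
  [set v | @Vsp R n v /\ inner v a = k].

Definition Cox (R : realType) (n : nat) : {fset set 'rV[R]_n} :=
  [fset hyp a 0 | a in Delta_pos].

Definition Shi (R : realType) (n : nat) (I : {fset 'rV[R]_n}) :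
    {fset set 'rV[R]_n} :=
  (Cox R n `|` [fset hyp b 1 | b in C_sub I])%fset.
Arguments Vsp : clear implicits.
Arguments Cox : clear implicits.

(* Main.v *)
(** All parts of the theorem follow from one fact: Shi(I) can be built from the
    empty arrangement by adding hyperplanes so that, whenever the restriction to
    the new hyperplane has exponents [bs], the exponents before and after the
    addition are [b :: bs] and [b + 1 :: bs]. By induction on such a chain one
    gets the factorization of the characteristic polynomial (Whitney's sum
    satisfies deletion-restriction), inductive freeness, the same kind of chain
    for the cone with one exponent 1 more, the freeness of the cone (Terao's
    addition theorem), and the numbers of regions and of bounded regions, which
    are the values at -1 and 1 of Whitney's sum (Zaslavsky).

    The set I cuts the vertices 1, ..., n into intervals (blocks), and C_I
    consists of the e_i - e_j with i < j, i last and j first in its block. List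
    the r vertices which are not first in their block before the other ones, in
    increasing order, and subtract the first listed coordinate from the others,
    y_k. Then Shi(I) consists of the hyperplanes y_k = 0, y_k = -1 for k >= v,
    y_i = y_j, and y_i = y_j + 1 for i < j with j >= t_i, for some thresholds
    v and t_i > i. Allowing y_k = 0, ..., w - 1 as well, this class is stable
    under deletion of y_v = -1 and under restriction to it. If no hyperplane
    y_k = -1 is left, a translation or the choice of another origin produces
    one. *)
From HB Require Import structures.
Require Import Defs.
From mathcomp Require Import all_boot all_order all_algebra all_field.
From mathcomp Require Import finmap multiset.
From mathcomp Require Import all_classical all_reals all_analysis.
From mathcomp Require Import zify ring lra.
From mathcomp Require mpoly.
Import (canonicals) mpoly.
Set Implicit Arguments.
Unset Strict Implicit.
Unset Printing Implicit Defensive.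
Import Order.TTheory GRing.Theory Num.Theory.
Import numFieldNormedType.Exports.
Local Open Scope fset_scope.
Local Open Scope classical_set_scope.
Local Open Scope ring_scope.

(** * Polynomial vector fields and the addition theorem *)

(** The order of the vertices is chosen so that C_I is described by thresholds: an edge goes from
    the last vertex of a block to the first vertex of a later block. When the first vertices stand
    at the end of the list in their natural order, the edges leaving a given vertex end in a final
    segment of it.

    The shape of the class comes from restriction to y_v = -1. In the coordinates y_k + 1, the
    hyperplane y_v = y_k becomes a value 0, each old value moves up by one, and y_v = y_j + 1
    becomes a value -1 for all j from t_v on: so w grows and v becomes t_v, renumbered. The delicate
    trace is that of y_i = y_v + 1, the value 1, which lies in the class only if w > 0. This
    obstacle decides, when no hyperplane y_k = -1 is left, between translating and moving the
    origin.

    For the cone, the addition theorem is proved by counting degrees: if no basis field of degree b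
    can serve to correct the others on the new hyperplane, then the basis fields of degree at most b
    restrict to logarithmic fields there, and they outnumber the basis fields of these degrees on
    the restriction. *)

Section Polynomials.
Variable F : fieldType.
Local Notation S n := (mpoly.mpoly n F).
Local Notation mX i := (mpoly.mpolyX F (mpoly.mnm1 i)).
Local Notation mC := (mpoly.mpolyC _ (R:=F)).

Lemma mpoly_alg_ind n (P : S n -> Prop) :
  (forall c, P (mC c)) -> (forall i, P (mX i)) ->
  (forall p q, P p -> P q -> P (p + q)) ->
  (forall p q, P p -> P q -> P (p * q)) -> forall p, P p.
Proof.
move=> PC PX PD PM; elim/mpoly.mpolyind => [|c m p _ _ Pp].
  by rewrite -(mpoly.mpolyC0 n F).
apply: (PD) Pp; rewrite -mpoly.mul_mpolyC; apply: (PM) => //.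
rewrite mpoly.mpolyXE_id; apply: big_ind => [|x y|i _].
- by rewrite -(mpoly.mpolyC1 n F).
- exact: PM.
elim: (mpoly.fun_of_multinom m i) => [|k IH].
  by rewrite expr0 -(mpoly.mpolyC1 n F).
by rewrite exprS; exact: PM.
Qed.

Definition lin n (a : 'rV[F]_n) : S n := \sum_i a 0 i *: mX i.

Lemma linD n (a b : 'rV[F]_n) : lin (a + b) = lin a + lin b.
Proof. by rewrite -big_split; apply: eq_bigr => i _; rewrite mxE scalerDl. Qed.

Lemma linZ n k (a : 'rV[F]_n) : lin (k *: a) = k *: lin a.
Proof.
by rewrite scaler_sumr; apply: eq_bigr => i _; rewrite mxE scalerA.
Qed.

Lemma lin_delta n (i : 'I_n) : lin (delta_mx 0 i) = mX i.
Proof.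
rewrite /lin (bigD1 i) //= mxE !eqxx scale1r big1 ?addr0 // => j ji.
by rewrite mxE eqxx (negPf ji) scale0r.
Qed.

Lemma mcoeff_lin n (a : 'rV[F]_n) i :
  mpoly.mcoeff (mpoly.mnm1 i) (lin a) = a 0 i.
Proof.
rewrite /lin raddf_sum (bigD1 i) //= mpoly.mcoeffZ mpoly.mcoeffX eqxx mulr1.
rewrite big1 ?addr0 // => j ji.
rewrite mpoly.mcoeffZ mpoly.mcoeffX -[_ == _]/(mpoly.mnm1 j == mpoly.mnm1 i).
case: eqP => [/(congr1 (fun m => mpoly.fun_of_multinom m j))|_]; last by rewrite mulr0.
by rewrite !mpoly.mnm1E eqxx eq_sym (negPf ji).
Qed.

Lemma lin_eq0 n (a : 'rV[F]_n) : (lin a == 0) = (a == 0).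
Proof.
apply/eqP/eqP => [a0|->].
  by apply/rowP => i; rewrite -mcoeff_lin a0 mpoly.mcoeff0 mxE.
by rewrite /lin big1 // => i _; rewrite mxE scale0r.
Qed.

(* The pullback of polynomial functions along [x |-> x *m M]. *)
Definition sub n k (M : 'M[F]_(k, n)) : S n -> S k :=
  mpoly.comp_mpoly [tuple lin (row j M^T) | j < n].

Lemma subX n k (M : 'M[F]_(k, n)) i : sub M (mX i) = lin (row i M^T).
Proof. by rewrite /sub mpoly.comp_mpolyXU -tnth_nth tnth_mktuple. Qed.

Lemma subC n k (M : 'M[F]_(k, n)) c : sub M (mC c) = mC c.
Proof. exact: mpoly.comp_mpolyC. Qed.

HB.instance Definition _ n k (M : 'M[F]_(k, n)) :=
  GRing.RMorphism.copy (sub M) (mpoly.comp_mpoly [tuple lin (row j M^T) | j < n]).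
HB.instance Definition _ n k (M : 'M[F]_(k, n)) :=
  GRing.Linear.copy (sub M) (mpoly.comp_mpoly [tuple lin (row j M^T) | j < n]).

Lemma sub_lin n k (M : 'M[F]_(k, n)) a : sub M (lin a) = lin (a *m M^T).
Proof.
rewrite /lin linear_sum /=.
under eq_bigr => i _ do rewrite linearZ /= subX /lin scaler_sumr.
rewrite exchange_big /=; apply: eq_bigr => j _.
rewrite mxE scaler_suml; apply: eq_bigr => i _.
by rewrite !mxE scalerA.
Qed.

Lemma sub_comp n k l (M : 'M[F]_(k, n)) (N : 'M[F]_(n, l)) p :
  sub M (sub N p) = sub (M *m N) p.
Proof.
elim/mpoly_alg_ind: p => [c|i|p q Hp Hq|p q Hp Hq].
- by rewrite !subC.
- by rewrite !subX sub_lin -row_mul trmx_mul.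
- by rewrite !rmorphD /= Hp Hq.
- by rewrite !rmorphM /= Hp Hq.
Qed.

Lemma sub1 n p : sub (1%:M : 'M[F]_n) p = p.
Proof.
elim/mpoly_alg_ind: p => [c|i|p q Hp Hq|p q Hp Hq].
- by rewrite subC.
- by rewrite subX trmx1 row1 lin_delta.
- by rewrite rmorphD /= Hp Hq.
- by rewrite rmorphM /= Hp Hq.
Qed.

Definition dv n (p q : S n) := exists r, q = p * r.

Lemma dvD n (p q r : S n) : dv p q -> dv p r -> dv p (q + r).
Proof. by move=> [x ->] [y ->]; exists (x + y); rewrite mulrDr. Qed.

Lemma dvMl n (p q r : S n) : dv p q -> dv p (r * q).
Proof. by move=> [x ->]; exists (r * x); rewrite mulrCA. Qed.

Lemma dvZ n (p q : S n) c : dv p q -> dv p (c *: q).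
Proof. by move=> pq; rewrite -mpoly.mul_mpolyC; exact: dvMl. Qed.

Lemma dv0 n (p : S n) : dv p 0.
Proof. by exists 0; rewrite mulr0. Qed.

(* [io] parametrizes the hyperplane [a = 0] and [pr] projects onto it along
   [u]. *)
Definition hyp_param n l (a u : 'rV[F]_n) (io : 'M[F]_(l, n)) (pr : 'M[F]_(n, l)) :=
  io *m pr = 1%:M /\ pr *m io = 1%:M - a^T *m u.

Section Hyperplane.
Variables (n l : nat) (a u : 'rV[F]_n) (io : 'M[F]_(l, n)) (pr : 'M[F]_(n, l)).
Hypothesis par : hyp_param a u io pr.

Lemma param_killsr (b : 'rV[F]_n) : b *m io^T = 0 -> exists k, b = k *: a.
Proof.
move=> b0; have [_ E] := par.
(* Applying the transpose of [pr *m io = 1 - a^T *m u] to [b] gives [b - b *m u^T *m a = 0]. *)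
exists ((b *m u^T) 0 0).
have := congr1 (fun M => b *m M^T) E.
rewrite trmx_mul mulmxA b0 mul0mx linearB /= trmx1 mulmxBr mulmx1.
rewrite trmx_mul trmxK mulmxA => /esym/eqP; rewrite subr_eq0 => /eqP {1}->.
by rewrite {1}[b *m u^T]mx11_scalar mul_scalar_mx.
Qed.

(** Factor theorem for a linear form: the substitution of [x - a(x) u] for [x] changes each variable
    by a multiple of [lin a], hence, by induction, each polynomial. *)
Lemma dv_lin_sub0 p : sub io p = 0 -> dv (lin a) p.
Proof.
move=> p0; have [_ E] := par.
suff: dv (lin a) (p - sub (pr *m io) p).
  by rewrite -sub_comp p0 raddf0 subr0.
rewrite E {p0}; elim/mpoly_alg_ind: p => [c|i|p q Hp Hq|p q Hp Hq].
- by rewrite subC subrr; exact: dv0.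
- exists (mC (u 0 i)).
  rewrite subX -[mX i]lin_delta linearB /= linearB /= trmx1 row1.
  rewrite linD -[- row _ _]scaleN1r linZ scaleN1r opprD addNKr opprK.
  rewrite mulrC mpoly.mul_mpolyC -linZ; congr lin.
  apply/rowP => j; rewrite !mxE big_ord1 !mxE; exact: mulrC.
- by rewrite raddfD /= opprD addrACA; exact: dvD.
- rewrite rmorphM /=.
  set p' := sub _ p; set q' := sub _ q.
  have -> : p * q - p' * q' = q * (p - p') + p' * (q - q').
    by rewrite mulrBr mulrBr [q * p]mulrC [q * p']mulrC addrA subrK.
  by apply: dvD; apply: dvMl.
Qed.

Hypothesis a_io : a *m io^T = 0.

Lemma sub_lin0 : sub io (lin a) = 0.
Proof. by rewrite sub_lin a_io; apply/eqP; rewrite lin_eq0. Qed.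

Lemma dv_sub0 p : dv (lin a) p -> sub io p = 0.
Proof. by move=> [q ->]; rewrite rmorphM /= sub_lin0 mul0r. Qed.

(** [lin a] generates the kernel of the morphism [sub io] into an integral domain, so it is
    prime. *)
Lemma lin_gauss q p : sub io q != 0 -> dv (lin a) (q * p) -> dv (lin a) p.
Proof.
move=> q0 /dv_sub0; rewrite rmorphM => /eqP; rewrite mulf_eq0 (negPf q0) /=.
by move=> /eqP/dv_lin_sub0.
Qed.

End Hyperplane.

Lemma hyp_param_ex l (a : 'rV[F]_l.+1) : a != 0 ->
  exists u (io : 'M[F]_(l, l.+1)) pr, hyp_param a u io pr /\ a *m io^T = 0.
Proof.
move=> a0.
(* In the basis given by [g] the form [a] is a multiple of the first coordinate; [io] and [pr] are
   then the inclusion and the projection that omit this coordinate. *)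
pose g := row_ebase a; have gU : g \in unitmx := row_ebase_unit a.
have rk : \rank a = 1%N by apply/eqP; rewrite rank_rV a0.
pose c := (col_ebase a) 0 0.
have aE : a = c *: (delta_mx 0 0 *m g).
  rewrite -{1}(mulmx_ebase a) rk {1}[col_ebase a]mx11_scalar -mulmxA.
  rewrite mul_scalar_mx; congr (_ *: (_ *m _)).
  by apply/matrixP => i j; rewrite !mxE !ord1; case: j => [[|j] lj].
have c0 : c != 0.
  by apply: contraNneq a0 => c0; rewrite aE c0 scale0r.
pose E : 'M[F]_(l, 1 + l) := row_mx 0 1%:M.
pose E0 : 'M[F]_(1, 1 + l) := row_mx 1%:M 0.
pose h : 'M[F]_(1 + l) := (invmx g)^T.
have gh : (g^T : 'M[F]_(1 + l)) *m h = 1%:M.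
  by rewrite /h -trmx_mul mulVmx // trmx1.
have hg : h *m (g^T : 'M[F]_(1 + l)) = 1%:M.
  by rewrite /h -trmx_mul mulmxV // trmx1.
have EE : E^T *m E = 1%:M - E0^T *m E0.
  rewrite /E /E0 !tr_row_mx !mul_col_row !trmx0 !trmx1 !mulmx1 !mul0mx !mulmx0.
  apply/eqP; rewrite eq_sym subr_eq add_block_mx !addr0 add0r.
  by rewrite -scalar_mx_block.
exists (c^-1 *: (E0 *m h)), (E *m h), ((g^T : 'M[F]_(1 + l)) *m E^T); split; first split.
- rewrite mulmxA -[E *m h *m _]mulmxA hg mulmx1 /E tr_row_mx mul_row_col.
  by rewrite trmx0 trmx1 mulmx1 mul0mx add0r.
- rewrite mulmxA -[_ *m E^T *m E]mulmxA EE mulmxBr mulmx1 mulmxBl gh; congr (_ - _).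
  have aE0 : a = c *: (E0 *m (g : 'M[F]_(1 + l))).
    rewrite aE; congr (_ *: (_ *m _)).
    apply/rowP => j; rewrite /E0 mxE [RHS]mxE; case: split_ordP => k ->.
      by rewrite !ord1 mxE !eqxx.
    by rewrite mxE.
  rewrite {1}aE0 -scalemxAr [(c *: _)^T]linearZ /= -scalemxAl scalerA mulVf // scale1r.
  by rewrite trmx_mul !mulmxA.
- rewrite aE trmx_mul trmxK -scalemxAl mulmxA -[delta_mx _ _ *m g *m _]mulmxA.
  rewrite mulmxV // mulmx1 /E tr_row_mx.
  have -> : delta_mx 0 0 = row_mx 1%:M 0 :> 'M[F]_(1, 1 + l).
    apply/rowP => j; rewrite mxE [RHS]mxE; case: split_ordP => k ->.
      by rewrite !ord1 mxE !eqxx.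
    by rewrite mxE.
  by rewrite mul_row_col trmx0 mulmx0 mul0mx addr0 scaler0.
Qed.

End Polynomials.

(** * Homogeneous parts, coprimality and linear relations over a domain *)

Section Homogeneity.
Variable F : fieldType.
Local Notation S n := (mpoly.mpoly n F).
Local Notation mC := (mpoly.mpolyC _ (R:=F)).

Definition hpart n d : S n -> S n :=
  mpoly.pihomog (mpoly.mpoly_mdeg__canonical__mpoly_Measure n) d.

HB.instance Definition _ n d := GRing.Linear.copy (@hpart n d)
  (mpoly.pihomog (mpoly.mpoly_mdeg__canonical__mpoly_Measure n) d).

(** In this form 0 is homogeneous of every degree. *)
Definition homog n d (p : S n) := hpart d p = p.

Lemma hpart_mX n d (m : mpoly.multinom n) :
  hpart d (mpoly.mpolyX F m) = (mpoly.mdeg m == d)%:R * mpoly.mpolyX F m.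
Proof.
by rewrite /hpart mpoly.pihomogX; case: eqP; rewrite ?mul1r ?mul0r.
Qed.

Lemma homog_hpart n d (p : S n) : homog d (hpart d p).
Proof. exact: mpoly.pihomog_id. Qed.

(** This allows the coefficients in an expansion of a homogeneous element in homogeneous ones to be
    replaced by their homogeneous parts of the right degree. *)
Lemma hpartM n d e (p q : S n) : homog d p ->
  hpart e (q * p) = (if (d <= e)%N then hpart (e - d) q else 0) * p.
Proof.
move=> hp.
elim/mpoly.mpolyind: q => [|c m q _ _ IH].
  by rewrite mul0r raddf0; case: ifP => _; rewrite ?raddf0 mul0r.
rewrite mulrDl raddfD /= IH -scalerAl linearZ /=.
have -> : hpart e (mpoly.mpolyX F m * p) =
    ((mpoly.mdeg m + d)%N == e)%:R * (mpoly.mpolyX F m * p).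
  elim/mpoly.mpolyind: p hp {IH} => [|c' m' p' m'p' c'0 IHp] hp.
    by rewrite mulr0 raddf0 mulr0.
  have dm' : mpoly.mdeg m' = d.
    apply/eqP; apply: contraTT c'0 => dm'.
    have := congr1 (mpoly.mcoeff m') hp.
    rewrite mpoly.mcoeffD mpoly.mcoeffZ mpoly.mcoeffX eqxx mulr1.
    rewrite (mpoly.memN_msupp_eq0 m'p') addr0 => <-; rewrite negbK.
    apply/eqP; apply: (@mpoly.dhomog_nemf_coeff n _ _ d) dm'.
    exact: mpoly.pihomogP.
  have hp' : homog d p'.
    move: hp; rewrite /homog linearP /= hpart_mX dm' eqxx mul1r => /addrI.
    exact.
  rewrite mulrDr raddfD /= IHp // -!scalerAr linearZ /= -mpoly.mpolyXD hpart_mX.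
  by rewrite mpoly.mdegD dm' mulrDr scalerAr.
case: leqP => de.
  rewrite linearP /= hpart_mX mulrDl -scalerAl mulrA.
  by rewrite -[in RHS](eqn_add2r d) subnK.
by rewrite !mul0r addr0 gtn_eqF ?mul0r ?scaler0 // (leq_trans de) // leq_addl.
Qed.

Lemma homogM n d e (p q : S n) : homog d p -> homog e q -> homog (d + e) (p * q).
Proof.
by move=> hp hq; rewrite /homog (hpartM _ _ hq) leq_addl addnK hp.
Qed.

Lemma homog0 n d : homog d (0 : S n). Proof. exact: raddf0. Qed.

Lemma homogD n d (p q : S n) : homog d p -> homog d q -> homog d (p + q).
Proof. by rewrite /homog raddfD /= => -> ->. Qed.

Lemma homogZ n d c (p : S n) : homog d p -> homog d (c *: p).
Proof. by rewrite /homog linearZ /= => ->. Qed.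

Lemma homog_sum n d I (r : seq I) (P : pred I) (f : I -> S n) :
  (forall i, P i -> homog d (f i)) -> homog d (\sum_(i <- r | P i) f i).
Proof.
move=> hf; apply: (big_ind (@homog n d)) => //; [exact: homog0|exact: homogD].
Qed.

Lemma homogC n c : homog 0 (mC c : S n).
Proof.
rewrite -(mulr1 (mC c)) mpoly.mul_mpolyC; apply: homogZ.
by rewrite /homog -(mpoly.mpolyX0 n F) hpart_mX mpoly.mdeg0 eqxx mul1r.
Qed.

Lemma homog_const n (p : S n) : homog 0 p -> exists c, p = mC c.
Proof.
move=> hp; exists (mpoly.mcoeff (mpoly.mnm0) p); apply/mpoly.mpolyP => m.
rewrite mpoly.mcoeffC; case: eqVneq => [<-|m0]; first by rewrite mulr1.
rewrite mulr0; apply: (@mpoly.dhomog_nemf_coeff n _ _ 0).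
  by rewrite -hp; exact: mpoly.pihomogP.
by rewrite mpoly.mdeg_eq0.
Qed.

Lemma homog_prod n I (r : seq I) (f : I -> S n) (d : I -> nat) :
  (forall i, homog (d i) (f i)) -> homog (\sum_(i <- r) d i) (\prod_(i <- r) f i).
Proof.
move=> hf; elim: r => [|i r IH].
  by rewrite !big_nil -(mpoly.mpolyC1 n F); exact: homogC.
by rewrite !big_cons; exact: homogM.
Qed.

Lemma homogX n d (p : S n) k : homog d p -> homog (d * k) (p ^+ k).
Proof.
move=> hp; elim: k => [|k IH].
  by rewrite muln0 expr0 -(mpoly.mpolyC1 n F); exact: homogC.
by rewrite exprS mulnS; exact: homogM.
Qed.

Lemma homog_lin n a : homog 1 (@lin F n a).
Proof.
apply: homog_sum => i _; apply: homogZ.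
by rewrite /homog hpart_mX mpoly.mdeg1 eqxx mul1r.
Qed.

Lemma homog_sub n k (M : 'M[F]_(k, n)) d p : homog d p -> homog d (sub M p).
Proof.
move=> <-; rewrite /hpart mpoly.pihomogE linear_sum /=.
rewrite (eq_bigr (fun m => mpoly.mcoeff m p *: sub M (mpoly.mpolyX F m))); last first.
  by move=> m _; rewrite linearZ.
apply: homog_sum => m /eqP <-; apply: homogZ.
rewrite /= mpoly.mpolyXE_id rmorph_prod /= mpoly.mdegE.
apply: homog_prod => i; rewrite rmorphXn /= subX.
rewrite -[X in homog X _]mul1n; apply: homogX; exact: homog_lin.
Qed.

(** Coprimality in the form of Euclid's lemma, which is how products of divisors and quotients by a
    linear form use it. *)
Definition cop n (p q : S n) := forall h, dv p (q * h) -> dv p h.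

Lemma copX n (p q : S n) e f : p != 0 -> cop p q -> cop (p ^+ e) (q ^+ f).
Proof.
move=> p0 pq; have {pq} : cop p (q ^+ f).
  elim: f => [|f IH] h; first by rewrite expr0 mul1r.
  by rewrite exprS -mulrA => /pq/IH.
elim: e => [|e IH] pq h; first by move=> _; exists h; rewrite expr0 mul1r.
move=> [r E]; have /pq[h' hE] : dv p (q ^+ f * h).
  by exists (p ^+ e * r); rewrite E exprS mulrA.
have /(IH pq)[r' hE'] : dv (p ^+ e) (q ^+ f * h').
  by exists r; apply: (mulfI p0); rewrite mulrCA -hE E exprS mulrA.
by exists r'; rewrite hE hE' exprS mulrA.
Qed.

Lemma dv_prod n (I : eqType) (r : seq I) (f : I -> S n) g : uniq r ->
  {in r &, forall i j, i != j -> cop (f i) (f j)} ->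
  {in r, forall i, dv (f i) g} -> dv (\prod_(i <- r) f i) g.
Proof.
elim: r => [|i r IH] /=.
  by move=> _ _ _; exists g; rewrite big_nil mul1r.
move=> /andP[ir ur] fc fg; have /IH : {in r &, forall i j, i != j -> cop (f i) (f j)}.
  by move=> j k jr kr; apply: fc; rewrite inE ?jr ?kr orbT.
move=> /(_ ur)[|h gE]; first by move=> j jr; apply: fg; rewrite inE jr orbT.
suff [h' hE] : dv (f i) h.
  by exists h'; rewrite gE hE big_cons mulrCA mulrA.
have : dv (f i) (\prod_(j <- r) f j * h) by rewrite -gE; apply: fg; rewrite mem_head.
have {fc} : {in r, forall j, cop (f i) (f j)}.
  move=> j jr; apply: fc; rewrite ?mem_head ?inE ?jr ?orbT //.
  by apply: contraNneq ir => ->.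
elim: (r) h {IH ur fg ir gE} => [|j s IH] h fc.
  by rewrite big_nil mul1r.
rewrite big_cons -mulrA => /(fc _ (mem_head _ _)); apply: IH => k ks.
by apply: fc; rewrite inE ks orbT.
Qed.

Lemma exists_kernel (R : idomainType) (I J : finType) (P : {set I}) (Q : {set J})
    (c : I -> J -> R) : (#|Q| < #|P|)%N ->
  exists g : I -> R, [/\ exists2 i, i \in P & g i != 0,
    (forall i, i \notin P -> g i = 0) &
    forall j, j \in Q -> \sum_i g i * c i j = 0].
Proof.
move=> QP; have [i0 i0P] : exists i, i \in P.
  by apply/set0Pn; rewrite -card_gt0; exact: leq_ltn_trans QP.
(* A square matrix padded with zero columns: its determinant vanishes since [#|Q| < #|P|], and
   [det0P] gives a kernel vector with entries in the domain itself. *)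
pose C : 'M[R]_#|P| := \matrix_(s, t)
  oapp (c (enum_val s)) 0 (nth None [seq Some j | j <- enum Q] t).
have detC : \det C == 0.
  rewrite (expand_det_col _ (Ordinal QP)) big1 // => s _.
  by rewrite mxE /= nth_default ?mul0r // size_map -cardE.
have /det0P[v v0 vC] := detC.
exists (fun i => if i \in P then v 0 (enum_rank_in i0P i) else 0); split.
- have [s vs] : exists s, v 0 s != 0.
    by apply/existsP; apply: contraNT v0 => /existsPn v0; apply/eqP/rowP => s;
      rewrite mxE; apply/eqP; rewrite -[_ == _]negbK.
  exists (enum_val s); first exact: enum_valP.
  by rewrite enum_valP enum_valK_in.
- by move=> i /negPf ->.
- move=> j jQ; have jr : (index j (enum Q) < #|P|)%N.
    by apply: leq_trans QP; rewrite ltnS cardE index_size.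
  have := congr1 (fun M : 'rV_ _ => M 0 (Ordinal jr)) vC; rewrite !mxE => E.
  rewrite -[RHS]E (bigID (mem P)) /= [X in _ + X]big1 ?addr0; last first.
    by move=> i /negPf ->; rewrite mul0r.
  rewrite (reindex_omap (enum_val (A := mem P)) (fun i => Some (enum_rank_in i0P i))) /=; last first.
    by move=> i iP; rewrite enum_rankK_in.
  apply: eq_big => [s|s _].
    by rewrite enum_valP enum_valK_in eqxx.
  rewrite enum_valP enum_valK_in !mxE /= (nth_map j) ?index_mem ?mem_enum //=.
  by rewrite nth_index ?mem_enum.
Qed.

End Homogeneity.

(** * Logarithmic vector fields and Terao's addition theorem *)

Section Addition.
Variable F : fieldType.
Local Notation S n := (mpoly.mpoly n F).
Local Notation mC := (mpoly.mpolyC _ (R:=F)).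

Lemma dv_expr n (I : eqType) (r : seq I) (p : S n) (f : I -> S n) :
  {in r, forall i, dv p (f i)} -> dv (p ^+ size r) (\prod_(i <- r) f i).
Proof.
elim: r => [|i r IH] fr; first by exists 1; rewrite big_nil mulr1.
have [x xE] := fr i (mem_head _ _).
have [|y yE] := IH; first by move=> j jr; apply: fr; rewrite inE jr orbT.
by exists (x * y); rewrite big_cons xE yE exprS mulrACA.
Qed.

Lemma lin_cop n (a b : 'rV[F]_n) : a != 0 -> (forall k, b != k *: a) ->
  cop (lin a) (lin b).
Proof.
case: n a b => [a b a0|n a b a0 ab]; first by rewrite thinmx0 eqxx in a0.
have [u [io [pr [par aio]]]] := hyp_param_ex a0.
move=> h; apply: (lin_gauss par aio).
rewrite sub_lin lin_eq0; apply/eqP => /(param_killsr par)[k bE].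
by have := ab k; rewrite bE eqxx.
Qed.

(* [v] is the polynomial vector field with components [v 0 i], here evaluated at
   the linear form [a]. *)
Definition ap k n (v : 'rV[S k]_n) (a : 'rV[F]_n) : S k := \sum_i a 0 i *: v 0 i.

Lemma apD k n (v w : 'rV[S k]_n) a : ap (v + w) a = ap v a + ap w a.
Proof. by rewrite -big_split; apply: eq_bigr => i _; rewrite mxE scalerDr. Qed.

Lemma apZ k n c (v : 'rV[S k]_n) a : ap (c *: v) a = c * ap v a.
Proof. by rewrite mulr_sumr; apply: eq_bigr => i _; rewrite mxE scalerAr. Qed.

Lemma ap_mul k n m (c : 'rV[S k]_m) (M : 'M[S k]_(m, n)) a :
  ap (c *m M) a = \sum_i c 0 i * ap (row i M) a.
Proof.
rewrite /ap; under eq_bigr do rewrite mxE scaler_sumr.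
rewrite exchange_big /=; apply: eq_bigr => i _; rewrite mulr_sumr.
by apply: eq_bigr => j _; rewrite mxE scalerAr.
Qed.

Lemma ap_addr k n (v : 'rV[S k]_n) a b : ap v (a + b) = ap v a + ap v b.
Proof. by rewrite -big_split; apply: eq_bigr => i _; rewrite mxE scalerDl. Qed.

Lemma ap_scaler k n (v : 'rV[S k]_n) c a : ap v (c *: a) = c *: ap v a.
Proof. by rewrite scaler_sumr; apply: eq_bigr => i _; rewrite mxE scalerA. Qed.

Lemma ap_sub k l n (M : 'M[F]_(l, k)) (v : 'rV[S k]_n) a :
  ap (map_mx (sub M) v) a = sub M (ap v a).
Proof. by rewrite linear_sum; apply: eq_bigr => i _; rewrite mxE linearZ. Qed.

Lemma ap_mulC k n l (v : 'rV[S k]_n) (M : 'M[F]_(n, l)) c :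
  ap (v *m map_mx (mpoly.mpolyC k (R:=F)) M) c = ap v (c *m M^T).
Proof.
rewrite ap_mul; apply: eq_bigr => i _; rewrite mulrC -mpoly.mul_mpolyC.
congr (_ * _); rewrite mxE raddf_sum; apply: eq_bigr => j _.
by rewrite !mxE -mpoly.mul_mpolyC -rmorphM.
Qed.

Definition lderiv n (T : eqType) (s : seq T) (a : T -> 'rV[F]_n) (v : 'rV[S n]_n) :=
  {in s, forall K, dv (lin (a K)) (ap v (a K))}.

Definition free_basis n (T : eqType) (s : seq T) (a : T -> 'rV[F]_n)
    (th : 'M[S n]_n) (d : 'I_n -> nat) :=
  [/\ forall i, lderiv s a (row i th),
      forall v, lderiv s a v -> exists c, v = c *m th,
      forall c : 'rV_n, c *m th = 0 -> c = 0 &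
      forall i j, homog (d i) (th i j)].

(** The exponents are the degrees of the components of the basis fields, so constant fields count as
    0. *)
Definition free_exp n (T : eqType) (s : seq T) (a : T -> 'rV[F]_n) (ds : seq nat) :=
  exists th d, free_basis s a th d /\ perm_eq ds [seq d i | i <- enum 'I_n].

(** * Adding a hyperplane [h] to [s], where [s'] lists the traces on [h] *)

Section AdditionTheorem.
Variables (n l : nat) (T T' : eqType) (s : seq T) (h : T) (s' : seq T').
Variables (a : T -> 'rV[F]_n) (c : T' -> 'rV[F]_l) (tr : T -> T').
Variables (u : 'rV[F]_n) (io : 'M[F]_(l, n)) (pr : 'M[F]_(n, l)).
Hypotheses (par : hyp_param (a h) u io pr) (a_io : a h *m io^T = 0).
Hypotheses (us : uniq s) (us' : uniq s').
Hypothesis trs : {in s, forall K, tr K \in s'}.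
Hypothesis trP : {in s', forall z, exists2 K, K \in s & tr K = z}.
Hypothesis tr_io : {in s, forall K, exists2 k, k != 0 & a K *m io^T = k *: c (tr K)}.
Hypothesis c0 : {in s', forall z, c z != 0}.
Hypothesis c_inj : {in s' &, forall z z', z != z' -> forall k, c z' != k *: c z}.
Hypothesis a0 : {in s, forall K, a K != 0}.
Hypothesis a_inj : {in s &, forall K K', K != K' -> forall k, a K' != k *: a K}.
Hypothesis ah0 : a h != 0.
Hypothesis ah_inj : {in s, forall K, forall k, a h != k *: a K}.

Let mult z := count (fun K => tr K == z) s.
(** Terao's polynomial, living on the hyperplane [h]: it measures how far the fields tangent to [s]
    can be from being tangent to [h]. *)
Let B : S l := \prod_(z <- s') lin (c z) ^+ (mult z).-1.

Lemma trace_decomp K : K \in s ->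
  exists k d, k != 0 /\ a K = k *: (c (tr K) *m pr^T) + d *: a h.
Proof.
move=> Ks; have [k k0 aK] := tr_io Ks.
have [|d dE] := param_killsr par (b := a K - k *: (c (tr K) *m pr^T)).
  rewrite mulmxBl aK -scalemxAl -mulmxA -trmx_mul; have [-> _] := par.
  by rewrite trmx1 mulmx1 subrr.
by exists k, d; rewrite k0 -dE addrC subrK.
Qed.

(** Powers of the distinct forms [c z] are coprime, so one trace [z] at a time suffices. A
    polynomial divisible by the [mult z] forms with trace [z] restricts to a multiple of [c z] to
    the power [mult z]; one factor [c z] is spent on the coefficient of the defect, whence the
    exponent [mult z - 1]. *)
Lemma defect_dvd v : lderiv s a v -> dv B (sub io (ap v (a h))).
Proof.
move=> hv; apply: dv_prod => //.
  move=> z z' zs zs' zz'; apply: copX; first by rewrite lin_eq0 c0.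
  by apply: lin_cop; [exact: c0 | exact: c_inj].
move=> z zs; set X := lin (c z); set g := sub io _.
have X0 : X != 0 by rewrite lin_eq0 c0.
pose hc := c z *m pr^T.
have hc_io : hc *m io^T = c z.
  by rewrite -mulmxA -trmx_mul; have [-> _] := par; rewrite trmx1 mulmx1.
(* The bilinear combination [f] vanishes on every hyperplane of the pencil
   of members of [s] with the same trace [z]. *)
pose f := lin hc * ap v (a h) - lin (a h) * ap v hc.
pose G := [seq K <- s | tr K == z].
have fG : dv (\prod_(K <- G) lin (a K)) f.
  apply: dv_prod; first exact: filter_uniq.
    move=> K K'; rewrite !mem_filter => /andP[_ Ks] /andP[_ Ks'] KK'.
    by apply: lin_cop; [exact: a0 | exact: a_inj].
  move=> K; rewrite mem_filter => /andP[/eqP Kz Ks].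
  have [k [d [k0 dE]]] := trace_decomp Ks; rewrite Kz in dE.
  suff: dv (lin (a K)) (k *: f) by move/(dvZ k^-1); rewrite scalerA mulVf // scale1r.
  have -> : k *: f = lin (a K) * ap v (a h) - lin (a h) * ap v (a K).
    rewrite /f dE linD !linZ ap_addr !ap_scaler -!mpoly.mul_mpolyC; ring.
  apply: dvD; first by exists (ap v (a h)).
  by rewrite -mulrN mulrC -[- ap _ _]scaleN1r mulrC; apply/dvMl/dvZ/hv.
have sf : sub io f = X * g.
  rewrite rmorphB !rmorphM /= !sub_lin hc_io a_io.
  suff /eqP -> : @lin F l 0 == 0 by rewrite mul0r subr0.
  by rewrite lin_eq0.
have : dv (X ^+ mult z) (X * g).
  rewrite -sf; case: fG => r ->; rewrite rmorphM rmorph_prod /= mulrC.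
  rewrite /mult -size_filter; apply: dvMl; apply: dv_expr => K.
  rewrite mem_filter => /andP[/eqP Kz Ks]; have [k _ aK] := tr_io Ks.
  by rewrite sub_lin aK Kz linZ; apply: dvZ; exists 1; rewrite mulr1.
have : (0 < mult z)%N.
  have [K Ks Kz] := trP zs; rewrite -has_count; apply/hasP; exists K => //.
  exact/eqP.
case: (mult z) => // m _ [r rE]; exists r; apply: (mulfI X0).
by rewrite rE exprS mulrA.
Qed.

(** Every member of [s] has exactly one trace, so the multiplicities add up to [size s]. *)
Lemma defect_homog b : size s = (b + size s')%N -> homog b B.
Proof.
move=> szs; suff -> : b = (\sum_(z <- s') (mult z).-1)%N.
  apply: homog_prod => z; rewrite -[X in homog X _]mul1n.
  by apply: homogX; exact: homog_lin.
apply/eqP; rewrite -(eqn_add2r (size s')) -szs -[size s']sum1_size -big_split /=.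
rewrite (eq_big_seq mult) => [|z zs]; last first.
  have [K Ks Kz] := trP zs; rewrite addn1 prednK //.
  by rewrite -has_count; apply/hasP; exists K => //; exact/eqP.
rewrite (_ : size s = \sum_(K <- s) \sum_(z <- s') (tr K == z))%N.
  rewrite exchange_big /=; apply/eqP; apply: eq_bigr => z _.
  by rewrite /mult -sum1_count [RHS]big_mkcond; apply: eq_bigr => K _; case: eqP.
rewrite -sum1_size; apply: eq_big_seq => K /trs Ks.
rewrite (bigD1_seq (tr K)) //= eqxx big1 ?addn0 //.
by move=> z /negPf; rewrite eq_sym => ->.
Qed.

Lemma defect_neq0 : B != 0.
Proof.
rewrite prodf_seq_neq0; apply/allP => z zs; apply/implyP => _.
by rewrite expf_neq0 // lin_eq0 c0.
Qed.

Section Cases.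
Variables (b : nat) (ds : seq nat) (th : 'M[S n]_n) (d : 'I_n -> nat).
Variables (r : 'I_n -> S l).
Hypotheses (thB : free_basis s a th d) (dE : perm_eq (b :: ds) [seq d i | i <- enum 'I_n]).
Hypothesis rE : forall i, sub io (ap (row i th) (a h)) = r i * B.
Hypothesis rH : forall i, if (b <= d i)%N then homog (d i - b) (r i) else r i = 0.

(** By degree, [r i0] is a nonzero constant, so the defect of the field [i0] is [B] up to a scalar.
    Subtracting multiples of this field makes the other basis fields tangent to [h]; it becomes
    tangent itself, and of degree one more, after multiplication by [lin (a h)]. *)
Lemma addition_nonzero i0 : d i0 = b -> r i0 != 0 -> free_exp (h :: s) a (b.+1 :: ds).
Proof.
move=> di0 ri0; have [thD thS thI thH] := thB.
have [k kE] : exists k, r i0 = mC k.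
  by apply: homog_const; have := rH i0; rewrite di0 leqnn subnn.
have k0 : k != 0 by apply: contraNneq ri0 => k0; rewrite kE k0 mpoly.mpolyC0.
have [iopr _] := par.
(* A lift of [r i / r i0] to the ambient polynomial ring, along the projection [pr]. *)
pose rho i : S n := k^-1 *: sub pr (r i).
have rhoE i : sub io (rho i) = k^-1 *: r i.
  by rewrite linearZ /= sub_comp iopr sub1.
pose th' : 'M[S n]_n := \matrix_i
  (if i == i0 then lin (a h) *: row i0 th else row i th - rho i *: row i0 th).
have th'M (x : 'rV_n) : x *m th' = (\row_i (if i == i0 then
    x 0 i0 * lin (a h) - \sum_(j | j != i0) x 0 j * rho j else x 0 i)) *m th.
  rewrite !mulmx_sum_row (bigD1 i0) //= [RHS](bigD1 i0) //= rowK mxE eqxx.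
  rewrite scalerBl scalerA -addrA; congr (_ + _).
  rewrite scaler_suml addrC -sumrB; apply: eq_bigr => i ii0.
  by rewrite rowK mxE (negPf ii0) scalerBr scalerA.
pose d' i := if i == i0 then b.+1 else d i.
exists th', d'; split; first split.
- move=> i K; rewrite inE rowK => /predU1P[->|Ks]; case: eqP => [ii0|/eqP ii0].
  + by rewrite apZ; exists (ap (row i0 th) (a h)).
  + apply: (dv_lin_sub0 par); rewrite -scaleNr apD apZ raddfD /= rmorphM raddfN /=.
    rewrite !rE rhoE kE -mpoly.mul_mpolyC mulNr mulrACA.
    by rewrite -rmorphM mulVf // rmorph1 mul1r subrr.
  + by rewrite apZ; apply/dvMl/thD.
  + by rewrite -scaleNr apD apZ; apply: dvD; [|apply: dvMl]; apply: thD.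
- move=> v hv.
  have [|x vE] := thS v; first by move=> K Ks; apply: hv; rewrite inE Ks orbT.
  (* On [h] the field [v] has defect [B] times the combination of the [r j] with coefficients from
     [x]. It vanishes and [B] does not, so the coefficient of the field [i0] in the new basis is a
     multiple of [lin (a h)]. *)
  have [y yE] : dv (lin (a h)) (x 0 i0 + \sum_(j | j != i0) x 0 j * rho j).
    apply: (dv_lin_sub0 par).
    have /(dv_sub0 a_io) : dv (lin (a h)) (ap v (a h)) by apply: hv; rewrite mem_head.
    rewrite vE ap_mul raddf_sum /=; under eq_bigr do rewrite rmorphM /= rE mulrA.
    rewrite -mulr_suml => /eqP; rewrite mulf_eq0 (negPf defect_neq0) orbF.
    rewrite (bigD1 i0) //= kE => /eqP E.
    rewrite raddfD /= raddf_sum /=; under eq_bigr do rewrite rmorphM /= rhoE -scalerAr.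
    rewrite -scaler_sumr; apply: (scalerI k0); rewrite scaler0 scalerDr scalerA.
    rewrite divff // scale1r -mpoly.mul_mpolyC [mC k * _]mulrC; exact: E.
  exists (\row_i if i == i0 then y else x 0 i); rewrite th'M vE; congr (_ *m _).
  apply/rowP => i; rewrite !mxE eqxx mulrC -yE; case: eqP => [->|//].
  rewrite -addrA [X in _ + X](_ : _ = 0) ?addr0 //; apply/eqP; rewrite subr_eq0; apply/eqP.
  by apply: eq_bigr => j ji0; rewrite mxE (negPf ji0).
- move=> x; rewrite th'M => /thI /rowP xE.
  have x0 i : i != i0 -> x 0 i = 0 by move=> ii0; have := xE i; rewrite !mxE (negPf ii0).
  apply/rowP => i; rewrite [RHS]mxE; case: (eqVneq i i0) => [->|]; last exact: x0.
  have := xE i0; rewrite !mxE eqxx big1 => [|j ji0]; last by rewrite x0 // mul0r.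
  by rewrite subr0 => /eqP; rewrite mulf_eq0 lin_eq0 (negPf ah0) orbF => /eqP.
- move=> i j; rewrite mxE /d'; case: eqP => [_|_].
    by rewrite !mxE -add1n -di0; apply: homogM; [exact: homog_lin|exact: thH].
  rewrite !mxE -mulNr; apply: homogD; first exact: thH.
  have := rH i; case: leqP => bd ri; last by rewrite /rho ri raddf0 scaler0 oppr0 mul0r; exact: homog0.
  rewrite -(subnK bd) -{2}di0; apply: homogM; last exact: thH.
  by rewrite -scaleN1r; apply/homogZ/homogZ/homog_sub.
- have eI := perm_to_rem (mem_enum 'I_n i0).
  have := perm_trans dE (perm_map d eI); rewrite /= di0 perm_cons => dsE.
  rewrite perm_sym (perm_trans (perm_map d' eI)) //= /d' eqxx perm_cons perm_sym.
  congr (perm_eq _ _): dsE; apply/eq_in_map => i.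
  by rewrite mem_rem_uniq ?enum_uniq // inE => /andP[/negPf ->].
Qed.

(** All basis fields of degree at most [b] then restrict to fields on [h] that are logarithmic for
    the traces. By degree they only involve the basis fields of degree at most [b] there, which are
    fewer by one. The resulting linear relation lifts to a combination divisible by [lin (a h)], and
    independence of the original basis makes the relation trivial. *)
Lemma addition_zero : free_exp s' c ds ->
  (forall i, d i = b -> r i = 0) -> False.
Proof.
move=> [ph [e [[phD phS phI phH] eE]]] rb; have [thD thS thI thH] := thB.
have [iopr prio] := par.
pose P := [set i | (d i <= b)%N]%SET; pose Q := [set j | (e j <= b)%N]%SET.
(* The two lists of degrees differ exactly by the entry [b]. *)
have QP : (#|Q| < #|P|)%N.
  have cnt m (f : 'I_m -> nat) : #|[set i | (f i <= b)%N]%SET| =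
      count (fun x => x <= b)%N [seq f i | i <- enum 'I_m].
    rewrite -sum1dep_card -sum1_count big_map big_enum_cond /=.
  by [].
  by rewrite /P /Q !cnt -(permP dE) -(permP eE) /= leqnn.
have rP i : i \in P -> r i = 0.
  rewrite inE leq_eqVlt => /predU1P[/rb //|db].
  by have := rH i; rewrite leqNgt db.
pose res i : 'rV[S l]_l := map_mx (sub io) (row i th) *m map_mx mC pr.
have res_io i : i \in P -> res i *m map_mx mC io = map_mx (sub io) (row i th).
  move=> iP; rewrite -mulmxA -map_mxM prio map_mxB map_mxM /= mulmxBr map_mx1 mulmx1.
  rewrite mulmxA -[RHS]subr0; congr (_ - _); set w := map_mx _ _.
  suff -> : w *m map_mx mC (a h)^T = 0 by rewrite mul0mx.
  apply/matrixP => x y; rewrite !ord1 [RHS]mxE mxE.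
  transitivity (ap w (a h)); last by rewrite ap_sub rE rP // mul0r.
  by apply: eq_bigr => j _; rewrite !mxE mulrC -mpoly.mul_mpolyC.
have resH i j : homog (d i) (res i 0 j).
  rewrite mxE; apply: homog_sum => k _; rewrite !mxE mulrC mpoly.mul_mpolyC.
  exact/homogZ/homog_sub/thH.
have resD i : i \in P -> lderiv s' c (res i).
  move=> iP z zs; have [K Ks Kz] := trP zs.
  have [k [k' [k0 aK]]] := trace_decomp Ks; rewrite Kz in aK.
  rewrite ap_mulC ap_sub.
  have [q qE] := thD i K Ks; have := congr1 (sub io) qE.
  rewrite {1}aK ap_addr !ap_scaler raddfD /= !linearZ /= rE rP // mul0r scaler0 addr0.
  rewrite rmorphM /= sub_lin; have [k'' _ ->] := tr_io Ks.
  rewrite Kz linZ => E; have /(dvZ k^-1) : dv (lin (c z)) (k *: sub io (ap (row i th) (c z *m pr^T))).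
    by rewrite E -scalerAl; apply: dvZ; exists (sub io q).
  by rewrite scalerA mulVf // scale1r.
have /choice[y yE] : forall i, exists yi : 'I_l -> S l, i \in P ->
    res i = (\row_j yi j) *m ph /\ forall j, (d i < e j)%N -> yi j = 0.
  move=> i; case: (boolP (i \in P)) => [iP|]; last by exists (fun=> 0).
  have [x xE] := phS _ (resD _ iP).
  exists (fun j => if (e j <= d i)%N then hpart (d i - e j) (x 0 j) else 0) => _.
  split=> [|j]; last by rewrite ltnNge => /negPf ->.
  apply/rowP => k; rewrite -(resH i k) xE !mxE raddf_sum /=.
  by apply: eq_bigr => j _; rewrite mxE (hpartM _ _ (phH j k)).
have [G [[i1 i1P Gi1] G0 GQ]] := exists_kernel y QP.
pose Gr : 'rV[S n]_n := \row_i sub pr (G i).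
have subG i : sub io (Gr 0 i) = G i by rewrite mxE sub_comp iopr sub1.
have v0E : map_mx (sub io) (Gr *m th) = 0.
  transitivity (\sum_i G i *: map_mx (sub io) (row i th)).
    by rewrite map_mxM mulmx_sum_row; apply: eq_bigr => i _; rewrite mxE /= subG map_row.
  transitivity ((\sum_i G i *: res i) *m map_mx mC io).
    rewrite mulmx_suml; apply: eq_bigr => i _; rewrite -scalemxAl.
    by case: (boolP (i \in P)) => [/res_io ->//|/G0 ->]; rewrite !scale0r.
  suff -> : \sum_i G i *: res i = 0 by rewrite mul0mx.
  transitivity ((\row_j \sum_i G i * y i j) *m ph).
    rewrite [RHS](_ : _ = (\sum_i G i *: (\row_j y i j)) *m ph).
      rewrite mulmx_suml; apply: eq_bigr => i _; rewrite -scalemxAl.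
      by case: (boolP (i \in P)) => [/yE[-> _]//|/G0 ->]; rewrite !scale0r.
    congr (_ *m _); apply/rowP => j; rewrite mxE summxE.
    by apply: eq_bigr => i _; rewrite !mxE.
  rewrite (_ : \row__ _ = 0) ?mul0mx //; apply/rowP => j; rewrite !mxE.
  case: (boolP (j \in Q)) => [/GQ//|]; rewrite inE -ltnNge => bj.
  rewrite big1 // => i _; case: (boolP (i \in P)) => [iP|/G0 ->]; last by rewrite mul0r.
  have [_ ->] := yE i iP; first by rewrite mulr0.
  by apply: leq_ltn_trans bj; rewrite inE in iP.
have /choice[f fE] : forall j, exists q, (Gr *m th) 0 j = lin (a h) * q.
  move=> j; apply: (dv_lin_sub0 par).
  by have := congr1 (fun M : 'rV_n => M 0 j) v0E; rewrite [RHS]mxE mxE.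
have {}fE : Gr *m th = lin (a h) *: \row_j f j.
  by apply/rowP => j; rewrite fE !mxE.
have [w wE] : exists w, \row_j f j = w *m th.
  (* Division by [lin (a h)] keeps the field logarithmic, because this form is coprime to those of
     [s]. *)
  apply: thS => K Ks; apply: (lin_cop (a0 Ks) (ah_inj Ks)).
  rewrite -apZ -fE ap_mul; elim/big_rec: _ => [|i x _ hx]; first exact: dv0.
  by apply: dvD => //; apply/dvMl/thD.
have : (lin (a h) *: w - Gr) *m th = 0.
  by rewrite mulmxBl -scalemxAl -wE fE subrr.
move=> /thI /eqP; rewrite subr_eq0 => /eqP /rowP/(_ i1) wE1.
move: Gi1; rewrite -subG -wE1 mxE rmorphM /= sub_lin0 // mul0r eqxx.
by [].
Qed.
End Cases.

Theorem addition b ds : size s = (b + size s')%N ->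
  free_exp s a (b :: ds) -> free_exp s' c ds -> free_exp (h :: s) a (b.+1 :: ds).
Proof.
move=> szs [th [d [thB dE]]] fs'.
have /choice[r rP] : forall i, exists q, sub io (ap (row i th) (a h)) = q * B /\
    if (b <= d i)%N then homog (d i - b) q else q = 0.
  have [thD _ _ thH] := thB.
  move=> i; have [q qE] := defect_dvd (thD i).
  (* The defect and [B] are homogeneous, so the quotient may be replaced by its part of degree
     [d i - b]. *)
  exists (if (b <= d i)%N then hpart (d i - b) q else 0).
  rewrite -(hpartM _ _ (defect_homog szs)) mulrC -qE; split.
    apply/esym/homog_sub/homog_sum => j _; rewrite mxE; exact/homogZ/thH.
  by case: ifP => -> //; exact: homog_hpart.
case: (pselect (exists2 i, d i = b & r i != 0)) => [[i dib ri]|nex].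
  apply: (addition_nonzero thB dE _ _ dib ri) => j; first exact: (proj1 (rP j)).
  exact: (proj2 (rP j)).
exfalso; apply: (addition_zero thB dE _ _ fs').
- by move=> j; exact: (proj1 (rP j)).
- by move=> j; exact: (proj2 (rP j)).
- by move=> i dib; apply/eqP; apply: contra_notT nex => ri; exists i.
Qed.

End AdditionTheorem.

Lemma free_exp_nil n (T : eqType) (a : T -> 'rV[F]_n) :
  free_exp [::] a (nseq n 0%N).
Proof.
exists 1%:M, (fun=> 0%N); split; first split=> //.
- by move=> v _; exists v; rewrite mulmx1.
- by move=> c; rewrite mulmx1.
- move=> i j; rewrite mxE -(mpoly.mpolyC_nat n F); exact: homogC.
- have -> : [seq 0%N | _ <- enum 'I_n] = nseq n 0%N; last exact: perm_refl.
  by rewrite -[X in nseq X]size_enum_ord; elim: (enum 'I_n) => //= _ e ->.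
Qed.

End Addition.

(** * Affine arrangements and deletion-restriction *)

Section AffineGeometry.
Variables (F : fieldType) (E : vectType F).
Implicit Types (X Y H : set E) (U : {vspace E}).

Definition afun := ('Hom(E, F^o) * F^o)%type.
Implicit Types g : afun.

Definition ev g (x : E) : F := g.1 x + g.2.
Definition zset X g : set E := X `&` [set x | ev g x = 0].

Lemma evD g g' x : ev (g + g') x = ev g x + ev g' x.
Proof. by rewrite /ev /= lfunE /= addrACA. Qed.

Lemma evN g x : ev (- g) x = - ev g x.
Proof. by rewrite /ev /= opp_lfunE opprD. Qed.

Lemma evB g g' x : ev (g - g') x = ev g x - ev g' x.
Proof. by rewrite evD evN. Qed.

Definition afun_cst c : afun := (0, c).

Lemma ev_cst c x : ev (afun_cst c) x = c.
Proof. by rewrite /ev lfunE /= add0r. Qed.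

Lemma ev_shift g x u t : ev g (x + t *: u) = ev g x + t * g.1 u.
Proof. by rewrite /ev linearD linearZ /= addrAC. Qed.

Lemma directionP X U : direction X U <->
  (X !=set0) /\ forall x y, X x -> (X y <-> y - x \in U).
Proof.
split=> [[x0 ->]|[[x0 x0X] XU]].
  split; first by exists x0, 0; rewrite ?addr0 //= mem0v.
  move=> _ y [u /= uU <-]; split.
    by move=> [v /= vU <-]; rewrite opprD addrACA subrr add0r rpredB.
  by move=> yU; exists (u + (y - (x0 + u))); [rewrite /= rpredD | rewrite addrA addrC subrK].
exists x0; apply/seteqP; split=> y /=.
  by move=> /(XU x0 _ x0X) yU; exists (y - x0) => //; rewrite addrC subrK.
by move=> [u /= uU <-]; apply/(XU x0) => //; rewrite addrAC subrr add0r.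
Qed.

Lemma direction_mem X U x u : direction X U -> X x -> X (x + u) <-> u \in U.
Proof.
by move=> /directionP[_ XU] xX; have := XU x (x + u) xX; rewrite addrAC subrr add0r.
Qed.

Lemma direction_inj X U V : direction X U -> direction X V -> U = V.
Proof.
move=> XU XV; have /directionP[[x xX] _] := XU; apply/vspaceP => u.
apply/idP/idP.
  by move=> /(direction_mem u XU xX).2 /(direction_mem u XV xX).1.
by move=> /(direction_mem u XV xX).2 /(direction_mem u XU xX).1.
Qed.

Lemma adimE X U : direction X U -> adim X = \dim U.
Proof.
move=> XU; rewrite /adim; congr (\dim _).
apply: (direction_inj _ XU); exact: (xgetPex _ (ex_intro _ _ XU)).
Qed.

Lemma direction_zset X U g x : direction X U -> zset X g x ->
  direction (zset X g) (U :&: lker g.1)%VS.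
Proof.
move=> /directionP[_ XU] xZ; apply/directionP; split; first by exists x.
move=> y z [yX /= gy]; split.
  move=> [zX /= gz]; rewrite memv_cap memv_ker ((XU _ _ yX).1 zX) /=.
  have := gz; rewrite -(subr0 (ev g z)) -gy /ev opprD addrACA subrr addr0 linearB /= => ->.
  exact: eqxx.
rewrite memv_cap memv_ker => /andP[zyU /eqP gzy]; split; first exact/(XU y).
by rewrite /= -(subrK y z) addrC -[z - y]scale1r ev_shift gy gzy mulr0 addr0.
Qed.

Definition hyperplane X H :=
  exists g, [/\ H = zset X g, (exists2 x, X x & ev g x = 0)
            & exists2 x, X x & ev g x != 0].

Lemma zset_nonconst X U g x y : direction X U -> X x -> X y ->
  ev g x != ev g y -> exists2 u, u \in U & g.1 u != 0.
Proof.
move=> /directionP[_ XU] xX yX gxy; exists (x - y); first exact/(XU y).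
by apply: contra gxy; rewrite linearB /= subr_eq0 => /eqP; rewrite /ev => ->.
Qed.

Lemma dim_lker (f : 'Hom(E, F^o)) U u : u \in U -> f u != 0 ->
  \dim U = (\dim (U :&: lker f)).+1.
Proof.
move=> uU fu; rewrite -(limg_ker_dim f U) -addn1; congr addn.
apply/eqP; rewrite eqn_leq; apply/andP; split.
  by apply: leq_trans (dimvS (subvf _)) _; rewrite dimvf /dim /=.
rewrite lt0n dimv_eq0; apply/negP => /eqP f0.
by have := memv_img f uU; rewrite f0 memv0 (negPf fu).
Qed.

Lemma hyperplane_direction X H U : direction X U -> hyperplane X H ->
  exists2 V, direction H V & \dim U = (\dim V).+1.
Proof.
move=> XU [g [-> [x xX gx] [y yX gy]]].
exists (U :&: lker g.1)%VS; first exact: (direction_zset (x := x) XU).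
have [|u uU gu] := zset_nonconst (g := g) XU yX xX; first by rewrite gx.
exact: dim_lker uU gu.
Qed.

Lemma adim_hyperplane X H : is_affine X -> hyperplane X H ->
  is_affine H /\ adim X = (adim H).+1.
Proof.
move=> [U XU] /(hyperplane_direction XU)[V HV UV]; split; first by exists V.
by rewrite (adimE XU) (adimE HV).
Qed.

Lemma hyperplane_sub X H : hyperplane X H -> H `<=` X.
Proof. by move=> [g [-> _ _]] x []. Qed.

Lemma hyperplane_neq0 X H : hyperplane X H -> H !=set0.
Proof. by move=> [g [-> [x xX gx] _]]; exists x. Qed.

Lemma hyperplane_nsub X H : hyperplane X H -> ~ X `<=` H.
Proof.
by move=> [g [-> _ [x xX gx]]] XH; have [_ /= /eqP] := XH x xX; rewrite (negPf gx).
Qed.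

Lemma hyperplane_eq X H K : is_affine X -> hyperplane X H -> hyperplane X K ->
  H `<=` K -> H = K.
Proof.
move=> [U XU] hH hK HK; have [VH dH UH] := hyperplane_direction XU hH.
have [VK dK UK] := hyperplane_direction XU hK.
have [[x xH] _] := (directionP H VH).1 dH.
suff VE : VH = VK.
  apply/seteqP; split=> // y yK; rewrite -(subrK x y) addrC.
  apply/(direction_mem _ dH xH); rewrite VE; apply/(direction_mem _ dK (HK _ xH)).
  by rewrite addrC subrK.
apply/eqP; rewrite eqEdim; apply/andP; split; last by rewrite -ltnS -UH -UK.
by apply/subvP => v /(direction_mem v dH xH).2 /HK /(direction_mem v dK (HK _ xH)).1.
Qed.

End AffineGeometry.

Section PowersetSum.
Local Open Scope fset_scope.
Local Open Scope ring_scope.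

Lemma sum_fpowersetU1 (T : choiceType) (R : zmodType) (k : T) (A : {fset T})
    (f : {fset T} -> R) : k \notin A ->
  \sum_(B <- fpowerset (k |` A)) f B =
  \sum_(B <- fpowerset A) f B + \sum_(B <- fpowerset A) f (k |` B).
Proof.
move=> kA; rewrite (bigID (fun B => k \notin B)) /=; congr (_ + _).
  rewrite -big_filter; apply: (@perm_big _ _ _ {fset T}); apply: uniq_perm.
  - by rewrite filter_uniq // fset_uniq.
  - exact: fset_uniq.
  move=> B; rewrite mem_filter !fpowersetE; apply/andP/idP => [[kB BA]|BA].
    by apply/fsubsetP => x xB; have := fsubsetP BA x xB;
      rewrite !inE => /predU1P[xk|//]; rewrite -xk xB in kB.
  split; last exact: fsubset_trans BA (fsubsetU1 _ _).
  by apply: contra kA => /(fsubsetP BA).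
rewrite -[RHS](big_map (fun B => k |` B) xpredT f) -big_filter.
apply: (@perm_big _ _ _ {fset T}); apply: uniq_perm.
- by rewrite filter_uniq // fset_uniq.
- rewrite map_inj_in_uniq ?fset_uniq // => B C; rewrite !fpowersetE => BA CA BC.
  have kn D : (D `<=` A)%fset -> k \notin D by move=> DA; apply: contra kA => /(fsubsetP DA).
  by rewrite -(fsetU1K (kn B BA)) BC fsetU1K // kn.
move=> B; rewrite mem_filter fpowersetE negbK; apply/andP/mapP => [[kB BA]|[C CA ->]].
  exists (B `\ k); last by rewrite fsetD1K.
  rewrite fpowersetE; apply/fsubsetP => x; rewrite !inE => /andP[xk xB].
  by have := fsubsetP BA x xB; rewrite !inE (negPf xk).
rewrite fpowersetE in CA; rewrite fset1U1; split=> //; exact: fsetUS.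
Qed.

End PowersetSum.

Section Whitney.
Variables (F : fieldType) (E : vectType F).
Implicit Types (X Y H : set E) (A B : {fset set E}).
Local Open Scope fset_scope.
Local Open Scope ring_scope.

Lemma flatP X B x : flat X B x <-> X x /\ forall K, K \in B -> K x.
Proof. by split=> [[xX xB]|[xX xB]]; split. Qed.

Lemma flat0 X : flat X fset0 = X.
Proof. by apply/seteqP; split=> x => [[]|xX] //; apply/flatP; split. Qed.

Lemma flat_sub X B : (flat X B `<=` X)%classic.
Proof. by move=> x []. Qed.

Lemma flatU1 X K B : flat X (K |` B) = flat (X `&` K)%classic B.
Proof.
apply/seteqP; split=> x /flatP.
  move=> [xX xB]; apply/flatP; split; first by split=> //; apply: xB; rewrite fset1U1.
  by move=> L LB; apply: xB; rewrite inE LB orbT.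
move=> [[xX xK] xB]; apply/flatP; split=> // L.
by rewrite !inE => /predU1P[->|/xB].
Qed.

Definition wterm X B : {poly int} :=
  if flat X B != set0 then (-1) ^+ #|` B| *: 'X^(adim (flat X B)) else 0.

(* Contrary to [char_poly_arr], the Whitney sum satisfies deletion-restriction
   ([wsumU1]) without conditions: [X] may be empty, or be contained in members
   of [A]. *)
Definition wsum X A : {poly int} := \sum_(B <- fpowerset A) wterm X B.

Lemma wsum0 A : wsum set0 A = 0.
Proof.
apply: big1 => B _; rewrite /wterm; case: eqP => // /eqP/set0P[x].
by move=> /flat_sub.
Qed.

Lemma wsum_nil X : X !=set0 -> wsum X fset0 = 'X^(adim X).
Proof.
move=> /set0P X0; rewrite /wsum fpowerset0 big_seq_fset1 /wterm flat0 X0.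
by rewrite cardfs0 scale1r.
Qed.

Lemma wsumU1 X A K : K \notin A -> wsum X (K |` A) = wsum X A - wsum (X `&` K)%classic A.
Proof.
move=> KA; rewrite /wsum sum_fpowersetU1 //= -sumrN; congr (_ + _).
rewrite big_seq [RHS]big_seq; apply: eq_bigr => B; rewrite fpowersetE => BA.
have KB : K \notin B by apply: contra KA => /(fsubsetP BA).
rewrite /wterm flatU1; case: ifP => _; last by rewrite oppr0.
by rewrite cardfsU1 KB add1n exprS mulN1r scaleNr.
Qed.

Lemma sum_sign_fpowerset A : A != fset0 ->
  \sum_(B <- fpowerset A) (-1) ^+ #|` B| = 0 :> int.
Proof.
move=> /fset0Pn[K KA]; rewrite -(fsetD1K KA).
have KA' : K \notin A `\ K by rewrite !inE eqxx.
rewrite sum_fpowersetU1 //= -big_split /= big_seq big1 // => B.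
rewrite fpowersetE => BA; have KB : K \notin B by apply: contra KA' => /(fsubsetP BA).
by rewrite cardfsU1 KB add1n exprS mulN1r subrr.
Qed.

(** The cross-cut expression of the Möbius function from [X] to [Y]. *)
Definition nu X A Y : int := \sum_(B <- fpowerset A | flat X B == Y) (-1) ^+ #|` B|.

Lemma flatsP X A Y : reflect (exists2 B, (B `<=` A)%fset & (flat X B = Y) /\ Y !=set0)
  ((Y : (set E)^d) \in flats X A).
Proof.
apply: (iffP (imfsetP _ _ _ _)) => /=.
  move=> [B]; rewrite !inE fpowersetE => /andP[BA /set0P B0] ->.
  by exists B.
move=> [B BA [BY /set0P Y0]]; exists B; last by rewrite BY.
by rewrite !inE fpowersetE BA BY.
Qed.

Lemma le_setd X Y : ((X : (set E)^d) <= Y)%O = `[< (Y `<=` X)%classic >].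
Proof. by rewrite leEdual; apply/idP/asboolP; [move=> /subsetPset | move=> /subsetPset]. Qed.

(** The subfamilies whose flat contains [Y] are the subsets of the family of all members containing
    [Y]. This family is nonempty as [Y] is not [X], so the signs cancel. *)
Lemma nu_sum X A Y : Y !=set0 -> (Y : (set E)^d) \in flats X A -> Y <> X ->
  \sum_(Z <- flats X A | (Z <= (Y : (set E)^d))%O) nu X A Z = 0.
Proof.
move=> Y0 /flatsP[B0 B0A [B0Y _]] YX.
pose AY := [fset K in A | `[< (Y `<=` K)%classic >]].
have YB B : B `<=` A -> (Y `<=` flat X B)%classic <-> B `<=` AY.
  move=> BA; split=> [YB|/fsubsetP BAY].
    apply/fsubsetP => K KB; rewrite !inE (fsubsetP BA) //=; apply/asboolP => y yY.
    by have /flatP[_] := YB y yY; apply.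
  move=> y yY; apply/flatP; split; first by move: yY; rewrite -B0Y => /flat_sub.
  by move=> K /BAY; rewrite !inE => /andP[_ /asboolP]; apply.
have AY0 : AY != fset0.
  have /fset0Pn[K KB0] : B0 != fset0.
    by apply: contra_notN YX => /eqP B00; rewrite -B0Y B00 flat0.
  apply/fset0Pn; exists K; rewrite !inE (fsubsetP B0A) //=; apply/asboolP => y.
  by rewrite -B0Y => /flatP[_]; apply.
rewrite (eq_bigr (fun Z => \sum_(B <- fpowerset A) if flat X B == Z then (-1) ^+ #|` B| else 0)); last first.
  by move=> Z _; rewrite /nu big_mkcond.
rewrite exchange_big /=; apply: etrans (sum_sign_fpowerset AY0).
transitivity (\sum_(B <- fpowerset A | B \in fpowerset AY) (-1) ^+ #|` B| : int).
  rewrite [RHS]big_mkcond big_seq [RHS]big_seq; apply: eq_bigr => B.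
  rewrite !fpowersetE => BA; case: (boolP (B `<=` AY)) => [/(YB B BA) YsB|nB].
    rewrite (big_rem (flat X B : (set E)^d)) /=; last first.
      apply/flatsP; exists B => //; split=> //; by case: Y0 => y /YsB yB; exists y.
    rewrite eqxx le_setd (asboolT YsB) big1_seq ?addr0 //= => Z /andP[_].
    by rewrite rem_filter ?fset_uniq // mem_filter /= eq_sym => /andP[/negPf ->].
  rewrite big1_seq // => Z /= /andP[]; rewrite le_setd => /asboolP YZ _.
  by case: eqP => // BZ; case/negP: nB; apply/(YB B BA); rewrite BZ.
rewrite -big_filter; apply: (@perm_big _ _ _ {fset set E}); apply: uniq_perm.
- by rewrite filter_uniq // fset_uniq.
- exact: fset_uniq.
move=> B; rewrite mem_filter andb_idr // !fpowersetE => /fsubsetP BAY.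
by apply/fsubsetP => K /BAY; rewrite !inE => /andP[].
Qed.

(** [nu] satisfies the recursion of the Möbius function by [nu_sum]. Its value at [X] is 1: since no
    member contains [X], only the empty subfamily has flat [X]. *)
Lemma nu_mobius X A Y : X !=set0 -> (forall K, K \in A -> ~ (X `<=` K)%classic) ->
  (Y : (set E)^d) \in flats X A -> @mobius _ (set E)^d (flats X A) X Y = nu X A Y.
Proof.
move=> X0 XA.
have topX Z : (Z : (set E)^d) \in flats X A -> ((X : (set E)^d) <= Z)%O.
  by move=> /flatsP[B _ [<- _]]; rewrite le_setd; apply/asboolP; exact: flat_sub.
have [m] := ubnP #|` [fset Z in flats X A | (Z <= (Y : (set E)^d))%O]|.
elim: m Y => // m IH Y lm YA; rewrite mobiusE //.
case: (eqVneq (X : (set E)^d) Y) => [<-|XY].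
  rewrite /nu big_mkcond (big_fsetD1 (fset0 : {fset set E})) /= ?fpowersetE ?fsub0set //.
  rewrite flat0 eqxx expr0 big1_seq ?addr0 // => B /=.
  rewrite !inE fpowersetE => /andP[/fset0Pn[K KB] BA]; case: eqP => // BX.
  case: (XA K (fsubsetP BA _ KB)) => x; rewrite -{1}BX => /flatP[_]; exact.
rewrite lt_neqAle XY topX //=.
have [B0 B0A [B0Y Y0]] := flatsP _ _ _ YA.
have /eqP := nu_sum Y0 YA (fun e => negP XY (introT eqP (esym e))).
rewrite (bigID (fun Z : (set E)^d => Z < (Y : (set E)^d))%O) /=.
rewrite [X in _ + X](_ : _ = nu X A Y); last first.
  rewrite (big_rem (Y : (set E)^d)) //= lexx ltxx /= big1_seq ?addr0 // => Z /andP[].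
  rewrite lt_neqAle => /andP[ZY]; rewrite ZY andbT negbK => /eqP ->.
  by rewrite rem_filter ?fset_uniq // mem_filter /= eqxx.
rewrite addrC addr_eq0 => /eqP ->; congr (- _).
rewrite big_seq_cond [RHS]big_seq_cond; apply: eq_big => Z.
  by case: (boolP (Z \in _)) => //= ZA; rewrite topX //= lt_neqAle; case: (_ <= _)%O; rewrite ?andbF ?andbT.
move=> /and3P[ZA _ ZY]; apply: IH => //.
rewrite -ltnS; apply: leq_trans lm; rewrite ltnS; apply: fproper_ltn_card.
rewrite fproperE; apply/andP; split.
  apply/fsubsetP => Z'; rewrite !inE => /andP[-> Z'Z] /=; exact: le_trans Z'Z (ltW ZY).
apply/negP => /fsubsetP/(_ Y); rewrite !inE YA lexx /= => /(_ isT).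
by rewrite lt_geF.
Qed.

Theorem char_poly_whitney X A : X !=set0 ->
  (forall K, K \in A -> ~ (X `<=` K)%classic) -> char_poly_arr X A = wsum X A.
Proof.
move=> X0 XA; rewrite /char_poly_arr big_seq.
under eq_bigr => Y YA do rewrite (nu_mobius X0 XA YA) /nu scaler_suml big_mkcond.
rewrite -big_seq exchange_big /= /wsum big_seq [RHS]big_seq; apply: eq_bigr => B.
rewrite fpowersetE => BA; rewrite /wterm; case: ifP => [|/negbT]; rewrite ?negbK.
  move=> B0; rewrite (big_rem (flat X B : (set E)^d)) /= ?eqxx; last first.
    by apply/flatsP; exists B => //; split=> //; apply/set0P.
  rewrite big1_seq ?addr0 // => Z /=.
  by rewrite rem_filter ?fset_uniq // mem_filter /= eq_sym => /andP[/negPf ->].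
move=> /eqP B0; rewrite big1_seq // => Z /= /flatsP[_ _ [_ [z zZ]]].
by case: eqP => // BZ; move: zZ; rewrite -BZ B0.
Qed.

(** Flats do not see that members with the same trace on [H] are merged and those disjoint from [H]
    dropped. Hence deletion-restriction can be carried out with [A \ H] in the ambient space [H]. *)
Lemma flats_restriction A H : flats H (A `\ H) = flats H (restriction A H).
Proof.
apply/fsetP => Y; apply/flatsP/flatsP => -[B BA [<- Y0]].
  exists [fset (H `&` K)%classic | K in B].
    apply/fsubsetP => Z /imfsetP[K /= KB ->]; apply/imfsetP; exists K => //=.
    rewrite !inE; have := fsubsetP BA K KB; rewrite !inE => -> /=; apply/set0P.
    by case: Y0 => x /flatP[xH xB]; exists x; split=> //; exact: xB.
  split=> //; apply/seteqP; split=> x /flatP[xH xB]; apply/flatP; split=> // K.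
    by move=> KB; have := xB (H `&` K)%classic; case=> //; apply/imfsetP; exists K.
  by move=> /imfsetP[L /= LB ->]; split=> //; exact: xB.
exists [fset K in A `\ H | (H `&` K)%classic \in B].
  by apply/fsubsetP => K; rewrite !inE => /andP[].
split=> //; apply/seteqP; split=> x /flatP[xH xB]; apply/flatP; split=> // K.
  move=> KB; have /imfsetP[L /=] := fsubsetP BA K KB.
  by rewrite inE => /andP[LA _] KE; rewrite KE; split=> //; apply: xB; rewrite !inE -KE KB andbT; rewrite !inE in LA.
by rewrite !inE => /andP[_ /xB[]].
Qed.

Lemma char_poly_restriction A H :
  char_poly_arr H (restriction A H) = char_poly_arr H (A `\ H).
Proof. by rewrite /char_poly_arr flats_restriction. Qed.

End Whitney.

(** * Exponents of inductively free arrangements *)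

Section InductiveExponents.
Variables (F : fieldType).

(* Inductive freeness with the list [ds] of exponents, up to order. *)
Inductive ifr (E : vectType F) : set E -> {fset set E} -> seq nat -> Prop :=
| ifr_nil X ds : is_affine X -> perm_eq ds (nseq (adim X) 0%N) -> ifr X fset0 ds
| ifr_add X A H b bs ds : is_affine X -> hyperplane X H -> H \in A ->
    ifr X (A `\ H)%fset (b :: bs) -> ifr H (restriction A H) bs ->
    perm_eq ds (b.+1 :: bs) -> ifr X A ds.

Variable E : vectType F.
Implicit Types (X H K : set E) (A : {fset set E}).

Lemma ifr_perm X A ds ds' : perm_eq ds' ds -> ifr X A ds -> ifr X A ds'.
Proof.
move=> dd h; case: h dd => [Y es aY esE|Y B H b bs es aY hH HB hd hr esE] dd.
  by apply: ifr_nil => //; exact: perm_trans dd esE.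
by apply: ifr_add hd hr _ => //; exact: perm_trans dd esE.
Qed.

Lemma ifr_affine X A ds : ifr X A ds -> is_affine X.
Proof. by case. Qed.

Lemma ifr_hyperplane X A ds : ifr X A ds -> {in A, forall K, hyperplane X K}.
Proof.
elim=> {X A ds} [X ds _ _ K|X A H b bs ds aX hH HA _ IH _ _ _ K KA]; first by rewrite inE.
by case: (eqVneq K H) => [->//|KH]; apply: IH; rewrite !inE KH.
Qed.

Lemma ifr_card X A ds : ifr X A ds -> #|` A| = sumn ds.
Proof.
elim=> {X A ds} [X ds _ dE|X A H b bs ds aX hH HA _ IH _ _ dE].
  by rewrite cardfs0 (perm_sumn dE) sumn_nseq mul0n.
by rewrite (cardfsD1 H) HA IH (perm_sumn dE) /= add1n.
Qed.

Lemma affine_neq0 X : is_affine X -> X !=set0.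
Proof. by move=> [U /directionP[]]. Qed.

Lemma ifr_char_poly X A ds : ifr X A ds ->
  char_poly_arr X A = \prod_(d <- ds) ('X - d%:R%:P).
Proof.
elim=> {X A ds} [X ds aX dE|X A H b bs ds aX hH HA hd IHd hr IHr dE].
  rewrite char_poly_whitney ?wsum_nil; [| exact: affine_neq0..| by move=> K; rewrite inE].
  rewrite (perm_big _ dE) /=; elim: (adim X) => [|n IH]; first by rewrite big_nil.
  by rewrite exprS IH big_cons subr0.
have aH := (adim_hyperplane aX hH).1.
have HA' : H \notin (A `\ H)%fset by rewrite !inE eqxx.
have hyp K : K \in A -> hyperplane X K.
  by apply: ifr_hyperplane K; exact: (ifr_add aX hH HA hd hr dE).
rewrite char_poly_whitney; [|exact: affine_neq0|by move=> K /hyp/hyperplane_nsub].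
rewrite -(fsetD1K HA) wsumU1 // setIidr; last exact: hyperplane_sub hH.
rewrite -(char_poly_whitney (affine_neq0 aX)); last first.
  by move=> K; rewrite !inE => /andP[_ /hyp/hyperplane_nsub].
(* A remaining member containing [H] would be equal to [H], so Whitney's formula applies in [H]. *)
rewrite -(char_poly_whitney (affine_neq0 aH)); last first.
  move=> K; rewrite !inE => /andP[/negP KH /hyp hK] HK.
  by apply: KH; rewrite (hyperplane_eq aX hH hK HK).
rewrite -char_poly_restriction IHd IHr (perm_big _ dE) /= !big_cons.
rewrite -[X in _ - X]mul1r -mulrBl; congr (_ * _).
by rewrite -natr1 polyCD polyC1 opprD addrA.
Qed.

Lemma root_mset_prod (ds : seq nat) :
  root_mset (map_poly intr (\prod_(d <- ds) ('X - d%:R%:P) : {poly int})) =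
  seq_mset [seq d%:R | d <- ds].
Proof.
rewrite /root_mset; case: closed_field_poly_normal => r /= rE.
apply/eq_seq_msetP; apply: prod_XsubC_eq.
have pE : map_poly intr (\prod_(d <- ds) ('X - d%:R%:P) : {poly int}) =
    \prod_(z <- [seq d%:R | d <- ds]) ('X - z%:P) :> {poly algC}.
  rewrite rmorph_prod big_map; apply: eq_bigr => d _.
  by rewrite rmorphB /= map_polyX map_polyC /= rmorph_nat.
by move: rE; rewrite pE (monicP (monic_prod_XsubC _ _ _)) scale1r => ->.
Qed.

Lemma ifr_exps X A ds : ifr X A ds -> exps X A = seq_mset [seq d%:R | d <- ds].
Proof. by move=> h; rewrite /exps (ifr_char_poly h) root_mset_prod. Qed.

Lemma ifr_inductively_free X A ds : ifr X A ds -> inductively_free X A.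
Proof.
elim=> {X A ds} [X ds aX _|X A H b bs ds aX hH HA hd IHd hr IHr _].
  exact: IF_empty.
apply: (IF_add HA IHd IHr); rewrite (ifr_exps hd) (ifr_exps hr) /=.
by apply/msubsetP => x; rewrite !mset_seqE /= leq_addl.
Qed.

End InductiveExponents.

(** * Cones of affine arrangements *)

Section Cone.
Variables (F : fieldType) (E : vectType F).
Implicit Types (X H K : set E) (A : {fset set E}) (g : afun E).
Local Notation EF := (E * F^o)%type.

Lemma homogenizeE X U x0 : direction X U -> X x0 ->
  homogenize X = [set w : EF | w.1 - w.2 *: x0 \in U].
Proof.
move=> XU x0X; apply/seteqP; split=> [w hw|w /= wU V VX].
  pose f (w : EF) : E := w.1 - w.2 *: x0.
  have fl : linear f.
    move=> k u v; rewrite /f /= scalerDl opprD addrACA scalerBr scalerA.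
    by rewrite -[k *: u.2]/(k * u.2).
  pose fL := GRing.isLinear.Build F EF E *:%R f fl.
  pose ff : {linear EF -> E} := HB.pack f fL.
  have SV : X `*` [set 1] `<=` [set` (linfun ff @^-1: U)%VS].
    move=> [x t] [/= xX ->]; rewrite -memv_preim (lfunE ff) /= /f /= scale1r.
    by apply/(direction_mem _ XU x0X); rewrite addrC subrK.
  by have := hw _ SV; rewrite /= -memv_preim (lfunE ff).
have x1 x : X x -> (x, 1) \in V by move=> xX; apply: VX.
rewrite /= -(subrK (w.2 *: x0) w.1) in wU *.
have -> : w = w.2 *: (x0, 1 : F^o) + ((x0 + (w.1 - w.2 *: x0), 1 : F^o) - (x0, 1 : F^o)).
  case: w wU => v t _ /=; rewrite -[_ - _]/(_ , _) /=; congr pair => /=.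
    by rewrite addrAC subrr add0r addrC subrK.
  by rewrite subrr addr0 -[t *: 1]/(t * 1) mulr1.
rewrite /= rpredD ?rpredZ ?rpredB ?x1 //.
by apply/(direction_mem _ XU x0X); rewrite subrK in wU.
Qed.

Lemma homogenize1 X x : is_affine X -> homogenize X (x, 1) <-> X x.
Proof.
move=> [U XU]; have [[x0 x0X] XP] := (directionP X U).1 XU.
by rewrite (homogenizeE XU x0X) /= scale1r; split=> /(XP _ _ x0X).
Qed.

Lemma homogenize0 X : homogenize X (0 : EF).
Proof. by move=> V _; rewrite /= mem0v. Qed.

Lemma homogenizeS X Y : X `<=` Y -> homogenize X `<=` homogenize Y.
Proof. by move=> XY w hw V YV; apply: hw => -[x t] [/= /XY xY ->]; apply: YV. Qed.

Definition homf g : afun EF := (linfun (fun w : EF => g.1 w.1 + w.2 * g.2), 0).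

Lemma ev_homf g w : ev (homf g) w = g.1 w.1 + w.2 * g.2.
Proof.
have fl : linear (fun w : EF => (g.1 w.1 + w.2 * g.2 : F^o)).
  move=> k u v /=; rewrite linearP /= mulrDl addrACA scalerDr.
  by congr (_ + _ + _); rewrite -[k *: u.2]/(k * u.2) -mulrA.
pose fL := GRing.isLinear.Build F EF F^o *:%R _ fl.
pose ff : {linear EF -> F^o} := HB.pack (fun w : EF => (g.1 w.1 + w.2 * g.2 : F^o)) fL.
by rewrite /ev /= addr0 (lfunE ff).
Qed.

Lemma homogenize_zset X g : is_affine X -> zset X g !=set0 ->
  homogenize (zset X g) = zset (homogenize X) (homf g).
Proof.
move=> [U XU] [x0 x0Z]; have [x0X gx0] := x0Z.
rewrite (homogenizeE (direction_zset XU x0Z) x0Z) (homogenizeE XU x0X).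
have evh w : ev (homf g) w = g.1 (w.1 - w.2 *: x0).
  rewrite ev_homf linearB linearZ /=; congr (_ + _); move: gx0 => /= /eqP.
  by rewrite addr_eq0 => /eqP ->; rewrite -[w.2 *: _]/(w.2 * _) mulrN opprK.
apply/seteqP; split=> w /=; rewrite memv_cap memv_ker -evh.
  by move=> /andP[wU /eqP gw]; split.
by move=> [/= -> ->]; rewrite eqxx.
Qed.

Lemma homogenize_hyperplane X H : is_affine X -> hyperplane X H ->
  hyperplane (homogenize X) (homogenize H).
Proof.
move=> aX [g [-> [x xX gx] [y yX gy]]]; exists (homf g); split.
- by apply: homogenize_zset => //; exists x.
- exists 0; first exact: homogenize0.
  by rewrite ev_homf linear0 mul0r addr0.
- exists (y, 1); first exact/(homogenize1 y aX).
  by rewrite ev_homf /= mul1r.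
Qed.

Lemma homogenize_cap X H K : is_affine X -> hyperplane X H -> hyperplane X K ->
  H `&` K !=set0 -> homogenize H `&` homogenize K = homogenize (H `&` K).
Proof.
move=> aX hH hK HK; have [aH _] := adim_hyperplane aX hH.
have [g [KE [x xX gx] _]] := hK; have HX := hyperplane_sub hH.
have HKE : H `&` K = zset H g.
  rewrite KE; apply/seteqP; split=> z [zH]; first by case.
  by move=> gz; split=> //; split=> //; apply: HX.
rewrite HKE homogenize_zset -?HKE // KE homogenize_zset //; last by exists x.
apply/seteqP; split=> z [zH]; first by case.
by move=> gz; split=> //; split=> //; apply: homogenizeS zH.
Qed.

(** The functional defining [K] is a nonzero constant on [H]; its homogenization is that constant
    times the last coordinate on the cone of [H]. So parallel members meet in the cone exactly at
    infinity. *)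
Lemma homogenize_disjoint X H K : is_affine X -> hyperplane X H -> hyperplane X K ->
  H `&` K = set0 -> homogenize H `&` homogenize K = homogenize H `&` [set w | w.2 = 0].
Proof.
move=> aX hH hK HK; have [[V HV] _] := adim_hyperplane aX hH.
have [g [KE [x xX gx] _]] := hK; have HX := hyperplane_sub hH.
have [[h hH'] _] := (directionP H V).1 HV.
have gH z : H z -> ev g z != 0.
  move=> zH; apply/eqP => gz; suff : (H `&` K) z by rewrite HK.
  by split=> //; rewrite KE; split=> //; apply: HX.
have gV u : u \in V -> g.1 u = 0.
  move=> uV; apply/eqP; apply: contraT => gu.
  have /gH : H (h + (- (ev g h / g.1 u)) *: u).
    by apply/(direction_mem _ HV hH'); rewrite rpredZ.
  by rewrite ev_shift mulNr mulfVK // subrr eqxx.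
have evh w : homogenize H w -> ev (homf g) w = w.2 * ev g h.
  rewrite (homogenizeE HV hH') /= => /gV; rewrite ev_homf /ev linearB linearZ /=.
  by move=> /eqP; rewrite subr_eq0 => /eqP ->; rewrite mulrDr.
rewrite KE homogenize_zset //; last by exists x.
apply/seteqP; split=> w [wH].
  move=> [_ /= /eqP]; rewrite evh // mulf_eq0 (negPf (gH _ hH')) orbF => /eqP w2.
  by split.
by move=> /= w2; split=> //; split; [exact: homogenizeS wH | rewrite /= evh // w2 mul0r].
Qed.

Local Notation infty X := (homogenize X `&` [set w | w.2 = 0])%classic.

Lemma homogenize_direction X U x0 : direction X U -> X x0 ->
  exists2 V : {vspace EF}, homogenize X = [set` V] &
    infty X = [set` (linfun (fun u : E => (u, 0 : F^o)) @: U)%VS].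
Proof.
move=> XU x0X.
have fl : linear (fun u : E => (u, 0 : F^o)).
  by move=> k u v; rewrite -[RHS]/(_, _) /= -[k *: 0]/(k * 0) mulr0 addr0.
pose fL := GRing.isLinear.Build F E EF *:%R _ fl.
pose ff : {linear E -> EF} := HB.pack (fun u : E => (u, 0 : F^o)) fL.
pose w0 : EF := (x0, 1).
exists (<[w0]> + linfun ff @: U)%VS.
  rewrite (homogenizeE XU x0X); apply/seteqP; split=> w /=.
    move=> wU; apply/memv_addP; exists (w.2 *: w0); first exact: memvZ (memv_line _).
    exists (ff (w.1 - w.2 *: x0)); first by rewrite -[ff _]lfunE memv_img.
    case: w {wU} => v t /=; congr pair => /=; first by rewrite addrC subrK.
    by rewrite addr0 -[t *: 1]/(t * 1) mulr1.
  move=> /memv_addP[_ /vlineP[k ->] [_ /memv_imgP[u uU ->] ->]].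
  by rewrite (lfunE ff) /= addr0 -[k *: 1]/(k * 1) mulr1 addrAC subrr add0r.
rewrite (homogenizeE XU x0X); apply/seteqP; split=> w /=.
  move=> [/= wU w2]; rewrite w2 scale0r subr0 in wU.
  apply/memv_imgP; exists w.1 => //; rewrite (lfunE ff) /= -w2.
  by case: (w).
move=> /memv_imgP[u uU ->]; rewrite (lfunE ff) /=; split=> //=.
by rewrite scale0r subr0.
Qed.

Lemma infty_hyperplane X : is_affine X -> hyperplane (homogenize X) (infty X).
Proof.
move=> [U XU]; have [[x xX] _] := (directionP X U).1 XU.
have fl : linear (fun w : EF => w.2) by [].
pose fL := GRing.isLinear.Build F EF F^o *:%R _ fl.
pose ff : {linear EF -> F^o} := HB.pack (fun w : EF => w.2) fL.
have evE w : ev (linfun ff, 0) w = w.2 by rewrite /ev /= addr0 (lfunE ff).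
exists (linfun ff, 0); split.
- by rewrite /zset; congr (_ `&` _); apply/seteqP; split=> w /=; rewrite evE.
- by exists 0; [exact: homogenize0|rewrite evE].
- exists (x, 1); last by rewrite evE oner_eq0.
  by apply/homogenize1 => //; exists U.
Qed.

Lemma direction_vspace (G : vectType F) (V : {vspace G}) : direction [set` V] V.
Proof.
apply/directionP; split; first by exists 0; exact: mem0v.
by move=> x y /= xV; split=> [yV|yxV]; [rewrite rpredB | rewrite -(subrK x y) rpredD].
Qed.

Lemma homogenize_affine X : is_affine X -> is_affine (homogenize X).
Proof.
move=> [U XU]; have [[x xX] _] := (directionP X U).1 XU.
by have [V -> _] := homogenize_direction XU xX; exists V; exact: direction_vspace.
Qed.

Lemma adim_infty X : is_affine X -> adim (infty X) = adim X.
Proof.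
move=> [U XU]; have [[x xX] _] := (directionP X U).1 XU.
have [V _ ->] := homogenize_direction XU xX.
rewrite (adimE (direction_vspace _)) (adimE XU); apply: limg_dim_eq.
have fl : linear (fun u : E => (u, 0 : F^o)).
  by move=> k u v; rewrite -[RHS]/(_, _) /= -[k *: 0]/(k * 0) mulr0 addr0.
pose fL := GRing.isLinear.Build F E EF *:%R _ fl.
pose ff : {linear E -> EF} := HB.pack (fun u : E => (u, 0 : F^o)) fL.
apply/eqP; rewrite -subv0; apply/subvP => u; rewrite memv_cap memv_ker (lfunE ff) memv0.
by move=> /andP[_ /eqP[->]].
Qed.

End Cone.

Section ConeExponents.
Variables (F : fieldType) (E : vectType F).
Implicit Types (X H K : set E) (A : {fset set E}).
Local Notation EF := (E * F^o)%type.
Local Notation infty X := (homogenize X `&` [set w : EF | w.2 = 0])%classic.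

Lemma coneP X A (Z : set EF) :
  reflect (Z = infty X \/ exists2 K, K \in A & Z = homogenize K) (Z \in cone X A).
Proof.
apply: (iffP (fset1UP _ _ _)) => -[->|]; [by left| |by left|].
  by move=> /imfsetP[K /= KA ->]; right; exists K.
by move=> [K KA ->]; right; apply/imfsetP; exists K.
Qed.

Lemma infty_neq_homogenize X H : is_affine H -> infty X <> homogenize H.
Proof.
move=> aH; have [[x xH] _] : (H !=set0) /\ True by split=> //; exact: affine_neq0 aH.
move=> e; have : homogenize H (x, 1) by apply/(homogenize1 x aH).
by rewrite -e => -[_ /= /eqP]; rewrite oner_eq0.
Qed.

Lemma homogenize_inj H K : is_affine H -> is_affine K -> homogenize H = homogenize K -> H = K.
Proof.
move=> aH aK e; apply/seteqP; split=> x.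
  by move=> /(homogenize1 x aH).2; rewrite e => /(homogenize1 x aK).1.
by move=> /(homogenize1 x aK).2; rewrite -e => /(homogenize1 x aH).1.
Qed.

Lemma coneD1 X A H : H \in A -> {in A, forall K, is_affine K} ->
  (cone X A `\ homogenize H)%fset = cone X (A `\ H)%fset.
Proof.
move=> HA aA; apply/fsetP => Z; rewrite in_fsetD1.
apply/andP/coneP => [[/eqP ZH /coneP[->|[K KA ZK]]]|[->|[K]]].
- by left.
- right; exists K => //; rewrite !inE KA andbT; apply/eqP => KH.
  by apply: ZH; rewrite ZK KH.
- by split; [exact/eqP/infty_neq_homogenize/aA | apply/coneP; left].
- rewrite in_fsetD1 => /andP[KH KA] ->; split; last by apply/coneP; right; exists K.
  by apply: contra KH => /eqP/homogenize_inj KH; apply/eqP/KH; apply: aA.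
Qed.

(** Members that meet [H] keep their trace; those parallel to [H], which the affine restriction
    drops, have the hyperplane at infinity of [H] as trace. *)
Lemma cone_restriction X A H : is_affine X -> H \in A ->
  {in A, forall K, hyperplane X K} ->
  restriction (cone X A) (homogenize H) = cone H (restriction A H).
Proof.
move=> aX HA hA; have hH := hA _ HA; have HX := hyperplane_sub hH.
have infE : homogenize H `&` infty X = infty H.
  apply/seteqP; split=> w; first by case=> wH [_ w2].
  by move=> [wH w2]; split=> //; split=> //; apply: homogenizeS wH.
have aA : {in A, forall K, is_affine K}.
  by move=> K KA; have [] := adim_hyperplane aX (hA _ KA).
have inf0 : infty H != set0 by apply/set0P; exists 0; split=> //; exact: homogenize0.
apply/fsetP => Z; apply/imfsetP/coneP => /=.
  move=> [K']; rewrite coneD1 // inE /= => /andP[/coneP[->|[K KA ->]] K0 ->].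
    by left; rewrite infE.
  move: KA; rewrite in_fsetD1 => /andP[KH KA]; have hK := hA _ KA.
  case: (eqVneq (H `&` K)%classic set0) => [HK|HK].
    by left; rewrite (homogenize_disjoint aX).
  right; exists (H `&` K)%classic; last by rewrite (homogenize_cap aX) //; exact/set0P.
  by apply/imfsetP; exists K => //=; rewrite !inE KH KA.
move=> [->|[L /imfsetP[K /= KA ->] ->]].
  exists (infty X); last by rewrite infE.
  by rewrite coneD1 // inE /= infE inf0 andbT; apply/coneP; left.
move: KA; rewrite !inE => /andP[/andP[KH KA] /set0P HK].
exists (homogenize K); last by rewrite (homogenize_cap aX hH (hA _ KA)).
rewrite coneD1 // inE /=; apply/andP; split.
  by apply/coneP; right; exists K => //; rewrite !inE KH.
by apply/set0P; exists 0; split; exact: homogenize0.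
Qed.

(** Deletion and restriction commute with the cone, so the chain is copied. In the base case the
    cone consists of the hyperplane at infinity alone, and adding it produces the exponent 1. *)
Lemma ifr_cone X A ds : ifr X A ds -> ifr (homogenize X) (cone X A) (1 :: ds)%N.
Proof.
elim=> {X A ds} [X ds aX dE|X A H b bs ds aX hH HA hd IHd hr IHr dE].
  have hI := infty_hyperplane aX; have aX' := homogenize_affine aX.
  have [aI dI] := adim_hyperplane aX' hI.
  have coneE : cone X fset0 = [fset infty X]%fset.
    by apply/fsetP => Z; apply/coneP/fset1P => [[->//|[K]]|->]; [rewrite inE|left].
  apply: (@ifr_add _ _ _ _ (infty X) 0%N ds) => //; first by rewrite coneE fset11.
    rewrite (_ : _ `\ _ = fset0)%fset; last by rewrite coneE fsetDv.
    by apply: ifr_nil => //; rewrite dI adim_infty //= perm_cons.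
  rewrite (_ : restriction _ _ = fset0).
    by apply: ifr_nil => //; rewrite adim_infty.
  by apply/fsetP => Z; rewrite inE; apply/imfsetP => -[K /=]; rewrite coneE fsetDv !inE.
have hA : {in A, forall K, hyperplane X K} := ifr_hyperplane (ifr_add aX hH HA hd hr dE).
have aA : {in A, forall K, is_affine K}.
  by move=> K KA; have [] := adim_hyperplane aX (hA _ KA).
apply: (@ifr_add _ _ _ _ (homogenize H) b (1 :: bs)%N).
- exact: homogenize_affine.
- exact: homogenize_hyperplane.
- by apply/coneP; right; exists H.
- rewrite coneD1 //; apply: ifr_perm IHd.
  by rewrite -[b :: 1%N :: bs]cat1s -[1%N :: b :: bs]cat1s -[b :: bs]cat1s -[1%N :: bs]cat1s perm_catCA.
- by rewrite cone_restriction.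
- rewrite -[b.+1 :: _]cat1s -[1%N :: bs]cat1s perm_sym -cat1s perm_catCA /= perm_cons perm_sym.
  exact: dE.
Qed.

End ConeExponents.

(** * From inductive freeness to bases of logarithmic fields *)

Section FreeArrangements.
Variable F : fieldType.

Lemma free_exp_perm n (T : eqType) (s s' : seq T) (a : T -> 'rV[F]_n) ds ds' :
  s =i s' -> perm_eq ds' ds -> free_exp s a ds -> free_exp s' a ds'.
Proof.
move=> ss dd [th [d [[thD thS thI thH] dE]]]; exists th, d; split; last first.
  exact: perm_trans dd dE.
split=> //; first by move=> i K Ks; apply: thD; rewrite ss.
by move=> v hv; apply: thS => K Ks; apply: hv; rewrite -ss.
Qed.

Lemma proportional_forms n (a b : 'rV[F]_n) : a != 0 -> b != 0 ->
  (forall x : 'rV_n, x *m b^T = 0 -> x *m a^T = 0) -> exists2 k, k != 0 & a = k *: b.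
Proof.
case: n a b => [a b|n a b a0 b0 ab]; first by rewrite thinmx0 eqxx.
have [u [io [pr [par bio]]]] := hyp_param_ex b0.
have [|k kE] := param_killsr par (b := a).
  have iob : io *m b^T = 0 by rewrite -[LHS]trmxK trmx_mul trmxK bio trmx0.
  rewrite -[LHS]trmxK trmx_mul trmxK (_ : io *m a^T = 0) ?trmx0 //.
  by apply/row_matrixP => i; rewrite row_mul row0; apply: ab; rewrite -row_mul iob row0.
by exists k => //; apply: contraNneq a0 => k0; rewrite kE k0 scale0r.
Qed.

Section Parametrization.
Variables (E : vectType F) (l : nat) (X : set E) (phi : {linear 'rV[F]_l -> E}).
Hypotheses (phi_inj : injective phi) (phiX : forall v, X v <-> exists x, v = phi x).

Definition form_of (K : set E) (a : 'rV[F]_l) := forall x, K (phi x) <-> x *m a^T = 0.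

Lemma form_of_neq0 K a : hyperplane X K -> form_of K a -> a != 0.
Proof.
move=> hK Ka; apply/eqP => a0; apply: (hyperplane_nsub hK) => v /phiX[x ->].
by apply/Ka; rewrite a0 trmx0 mulmx0.
Qed.

Lemma form_of_inj K K' a a' k : hyperplane X K -> hyperplane X K' ->
  form_of K a -> form_of K' a' -> a' = k *: a -> K = K'.
Proof.
move=> hK hK' Ka Ka' aa'; have a0 := form_of_neq0 hK' Ka'.
have k0 : k != 0 by apply: contraNneq a0 => k0; rewrite aa' k0 scale0r.
have KK' x : K (phi x) <-> K' (phi x).
  apply: (iff_trans (Ka x)); apply: iff_sym; apply: (iff_trans (Ka' x)).
  rewrite aa' linearZ /= -scalemxAr; split=> [/eqP|->]; last exact: scaler0.
  by rewrite scaler_eq0 (negPf k0) => /eqP.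
apply/seteqP; split=> v Kv.
  by move: (hyperplane_sub hK Kv) => /phiX[x vE]; rewrite vE in Kv *; apply/KK'.
by move: (hyperplane_sub hK' Kv) => /phiX[x vE]; rewrite vE in Kv *; apply/KK'.
Qed.

Lemma adim_param : adim X = l.
Proof.
have XE : X = [set` limg (linfun phi)].
  apply/seteqP; split=> v /=.
    by move=> /phiX[x ->]; rewrite -(lfunE phi) memv_img ?memvf.
  by move=> /memv_imgP[x _ ->]; apply/phiX; exists x; rewrite lfunE.
rewrite XE (adimE (direction_vspace _)) limg_dim_eq.
  by rewrite dimvf /dim /= mul1n.
apply/eqP; rewrite -subv0; apply/subvP => x; rewrite memv_cap memv_ker memv0.
by move=> /andP[_]; rewrite lfunE /= -(linear0 phi) (inj_eq phi_inj).
Qed.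

End Parametrization.

(** The parametrization [phi] and the defining forms [a] are arbitrary because the induction changes
    both: on [H] one uses [phi] composed with [io] and restricted forms. *)
Lemma ifr_free_exp (E : vectType F) (X : set E) A ds : ifr X A ds ->
  {in A, forall K, K 0} ->
  forall l (phi : {linear 'rV[F]_l -> E}), injective phi ->
  (forall v, X v <-> exists x, v = phi x) ->
  forall a : set E -> 'rV[F]_l, {in A, forall K, form_of phi K (a K)} ->
  free_exp (enum_fset A) a ds.
Proof.
elim=> {X A ds} [X ds aX dE|X A H b bs ds aX hH HA hd IHd hr IHr dE] A0 l phi phi_inj phiX a aP.
  apply: (free_exp_perm _ dE); last by rewrite (adim_param phi_inj phiX); exact: free_exp_nil.
  by [].
have hA : {in A, forall K, hyperplane X K} := ifr_hyperplane (ifr_add aX hH HA hd hr dE).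
have A'P K : K \in (A `\ H)%fset -> K != H /\ K \in A by rewrite !inE => /andP.
have fd : free_exp (enum_fset (A `\ H)%fset) a (b :: bs).
  by apply: (IHd _ _ phi) => // K /A'P[_ KA]; [exact: A0 | exact: aP].
have aH0 := form_of_neq0 phiX hH (aP _ HA).
case: l phi phi_inj phiX a aP fd aH0 => [|l] phi phi_inj phiX a aP fd aH0.
  by move: aH0; rewrite thinmx0 eqxx.
have [u [io [pr [par aio]]]] := hyp_param_ex aH0; have [iopr prio] := par.
have ioa : io *m (a H)^T = 0 by rewrite -[LHS]trmxK trmx_mul trmxK aio trmx0.
have psl : linear (fun y : 'rV[F]_l => phi (y *m io)).
  by move=> k x y; rewrite mulmxDl -scalemxAl linearP.
pose psL := GRing.isLinear.Build F _ E *:%R _ psl.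
pose psi : {linear 'rV[F]_l -> E} := HB.pack (fun y : 'rV[F]_l => phi (y *m io)) psL.
have psi_inj : injective psi.
  by move=> x y /phi_inj /(congr1 (mulmx^~ pr)); rewrite -!mulmxA iopr !mulmx1.
have psiH v : H v <-> exists y, v = psi y.
  split=> [vH|[y ->]]; last by apply/(aP _ HA); rewrite -mulmxA ioa mulmx0.
  have /phiX[x vE] := hyperplane_sub hH vH; exists (x *m pr).
  move: vH; rewrite vE => /(aP _ HA) xa; congr (phi _).
  by rewrite -mulmxA prio mulmxBr mulmx1 mulmxA xa mul0mx subr0.
(* [r Z] is a chosen member with trace [Z]; its restricted form serves as the form of [Z]. *)
pose r (Z : set E) : set E :=
  xget set0 [set K | K \in (A `\ H)%fset /\ Z = H `&` K].
pose c Z := a (r Z) *m io^T.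
have rP Z : Z \in restriction A H -> r Z \in (A `\ H)%fset /\ Z = H `&` r Z.
  move=> /imfsetP[K /=]; rewrite inE => /andP[KA _] ->.
  by apply: (@xgetPex _ set0 [set L | L \in (A `\ H)%fset /\ H `&` K = H `&` L]); exists K.
have formI K : K \in A -> form_of psi (H `&` K) (a K *m io^T).
  move=> KA y; rewrite trmx_mul trmxK mulmxA; apply: iff_trans (aP K KA (y *m io)).
  by split=> [[]//|Ky]; split=> //; apply/psiH; exists y.
have cP : {in restriction A H, forall Z, form_of psi Z (c Z)}.
  by move=> Z /rP[/A'P[_ rA] ZE]; rewrite {1}ZE; exact: formI.
have hR := ifr_hyperplane hr.
have cN0 : {in restriction A H, forall Z, c Z != 0}.
  by move=> Z ZR; exact: (form_of_neq0 psiH (hR _ ZR) (cP _ ZR)).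
have trR K : K \in (A `\ H)%fset -> H `&` K \in restriction A H.
  move=> KA; apply/imfsetP; exists K => //=; rewrite inE KA /=; apply/set0P.
  by exists 0; split; apply: A0 => //; have [] := A'P _ KA.
have hA' K : K \in (A `\ H)%fset -> hyperplane X K by move=> /A'P[_ /hA].
have aP' K : K \in (A `\ H)%fset -> form_of phi K (a K).
  by move=> KA; apply: aP; have [] := A'P _ KA.
apply: (free_exp_perm (s := H :: enum_fset (A `\ H)%fset) _ dE).
  by move=> K; rewrite inE in_fsetD1; case: eqVneq => [->|].
apply: (addition (tr := fun K => H `&` K) par aio (fset_uniq _) (fset_uniq _)
  _ _ _ cN0 _ _ _ aH0 _ _ fd).
- exact: trR.
- by move=> Z /rP[rA ZE]; exists (r Z).
- move=> K KA; have KR := trR K KA; apply: proportional_forms.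
  + by apply: (form_of_neq0 psiH (hR _ KR)); apply: formI; have [] := A'P _ KA.
  + exact: cN0.
  + move=> x /(cP _ KR) Kx; apply/formI => //; have [//] := A'P _ KA.
- move=> Z Z' ZR ZR' ZZ' k; apply: contra ZZ' => /eqP cE; apply/eqP.
  exact: (form_of_inj psiH (hR _ ZR) (hR _ ZR') (cP _ ZR) (cP _ ZR') cE).
- by move=> K KA; exact: (form_of_neq0 phiX (hA' _ KA) (aP' _ KA)).
- move=> K K' KA KA' KK' k; apply: contra KK' => /eqP cE; apply/eqP.
  exact: (form_of_inj phiX (hA' _ KA) (hA' _ KA') (aP' _ KA) (aP' _ KA') cE).
- move=> K KA k; have [KH _] := A'P _ KA; apply: contra KH => /eqP cE; apply/eqP.
  exact: (form_of_inj phiX (hA' _ KA) hH (aP' _ KA) (aP _ HA) cE).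
(* The cardinalities are the sums of the exponents, [b + sumn bs] and [sumn bs]. *)
- by rewrite (ifr_card hd) (ifr_card hr).
- apply: (IHr _ _ psi psi_inj psiH) => //.
  by move=> Z /rP[/A'P[_ rA] ->]; split; exact: A0.
Qed.

End FreeArrangements.

(** * Derivations as polynomial vector fields *)

Section Derivations.
Variable F : fieldType.
Local Notation S n := (mpoly.mpoly n F).
Local Notation mX i := (mpoly.mpolyX F (mpoly.mnm1 i)).
Local Notation mC := (mpoly.mpolyC _ (R:=F)).

Definition field_deriv n (v : 'rV[S n]_n) (p : S n) : S n :=
  \sum_i v 0 i * mpoly.mderiv i p.

Fact field_deriv_linear n (v : 'rV[S n]_n) : linear (field_deriv v).
Proof.
move=> k p q; rewrite /field_deriv scaler_sumr -big_split; apply: eq_bigr => i _ /=.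
by rewrite linearP mulrDr scalerAr.
Qed.
HB.instance Definition _ n v :=
  GRing.isLinear.Build F (S n) (S n) *:%R _ (@field_deriv_linear n v).

Lemma field_derivM n (v : 'rV[S n]_n) : is_derivation (field_deriv v).
Proof.
move=> p q; rewrite /= /field_deriv mulr_suml mulr_sumr -big_split; apply: eq_bigr => i _ /=.
by rewrite mpoly.mderivM mulrDr [X in _ = _ + X]mulrCA !mulrA.
Qed.

Lemma field_derivX n (v : 'rV[S n]_n) i : field_deriv v (mX i) = v 0 i.
Proof.
rewrite /field_deriv (bigD1 i) //= mpoly.mderivX mpoly.mnm1E eqxx scale1r.
rewrite (_ : mpoly.mnm_sub _ _ = mpoly.mnm0) ?mpoly.mpolyX0 ?mulr1; last first.
  by apply/mpoly.mnmP => j; rewrite mpoly.mnmBE subnn mpoly.mnm0E.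
rewrite big1 ?addr0 // => j ji.
by rewrite mpoly.mderivX mpoly.mnm1E eq_sym (negPf ji) scale0r mulr0.
Qed.

Lemma derivation_ext n (d d' : {linear S n -> S n}) :
  is_derivation d -> is_derivation d' -> (forall i, d (mX i) = d' (mX i)) -> d =1 d'.
Proof.
have d1 (e : {linear S n -> S n}) : is_derivation e -> forall c, e (mC c) = 0.
  move=> eD c; rewrite -(mulr1 (mC c)) mpoly.mul_mpolyC linearZ /=.
  have := eD 1 1; rewrite !mul1r !mulr1 => /eqP; rewrite -subr_eq0 opprD addNKr oppr_eq0.
  by move=> /eqP ->; rewrite scaler0.
move=> dD dD' dX p; elim/mpoly_alg_ind: p => [c|i|p q Hp Hq|p q Hp Hq].
- by rewrite !d1.
- exact: dX.
- by rewrite !raddfD /= Hp Hq.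
- by rewrite dD dD' Hp Hq.
Qed.

Definition field_of n (d : {linear S n -> S n}) : 'rV[S n]_n := \row_i d (mX i).

Lemma field_ofK n (d : {linear S n -> S n}) : is_derivation d ->
  d =1 field_deriv (field_of d).
Proof.
move=> dD; apply: (@derivation_ext _ d (field_deriv (field_of d))) => //.
  exact: field_derivM.
by move=> i; rewrite /= field_derivX mxE.
Qed.

Lemma deriv_lin n (d : {linear S n -> S n}) a : d (lin a) = ap (field_of d) a.
Proof. by rewrite linear_sum; apply: eq_bigr => i _; rewrite linearZ mxE. Qed.

Lemma field_derivK n (v : 'rV[S n]_n) : field_of (field_deriv v) = v.
Proof. by apply/rowP => i; rewrite mxE /= field_derivX. Qed.

Theorem ifr_is_free (E : vectType F) (W : {vspace E}) A ds :
  ifr [set` W] A ds -> {in A, forall K, K 0} -> is_free [set` W] A.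
Proof.
move=> hA A0; exists W => //; exists (\dim W).
pose B := vbasis W; have BW := vbasisP W.
have phil : linear (fun x : 'rV[F]_(\dim W) => \sum_i x 0 i *: B`_i).
  move=> k x y; rewrite scaler_sumr -big_split; apply: eq_bigr => i _.
  by rewrite !mxE scalerDl scalerA.
pose phiL := GRing.isLinear.Build F _ E *:%R _ phil.
pose phi : {linear 'rV[F]_(\dim W) -> E} :=
  HB.pack (fun x : 'rV[F]_(\dim W) => \sum_i x 0 i *: B`_i) phiL.
have phi_inj : injective phi.
  move=> x y /= xy; apply/rowP => i.
  have /freeP/(_ (fun i => x 0 i - y 0 i)) := basis_free BW.
  move=> /(_ _ i) /eqP; rewrite subr_eq0 => E'; apply/eqP; apply: E'.
  under eq_bigr do rewrite scalerBl; rewrite sumrB; apply/eqP; rewrite subr_eq0; exact/eqP.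
have phiX v : [set` W] v <-> exists x, v = phi x.
  split=> [/= vW|[x ->]] /=.
    exists (\row_i coord B i v) => /=; rewrite [LHS](coord_vbasis vW).
    by apply: eq_bigr => i _; rewrite mxE.
  by apply: rpred_sum => i _; rewrite rpredZ // vbasis_mem // mem_nth // size_tuple.
pose row_form (f : 'Hom(E, F^o)) : 'rV[F]_(\dim W) := \row_i f B`_i.
have row_formP f x : x *m (row_form f)^T = 0 <-> f (phi x) = 0.
  have -> : x *m (row_form f)^T = (f (phi x))%:M.
    apply/matrixP => i j; rewrite !ord1 !mxE eqxx mulr1n /= linear_sum.
    by apply: eq_bigr => k _; rewrite !mxE linearZ.
  split=> [/(congr1 (fun M : 'M[F]_1 => M 0 0))|->]; rewrite ?raddf0 //.
  by rewrite !mxE.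
have hK := ifr_hyperplane hA.
pose defines (K : set E) (f : 'Hom(E, F^o)) := K = [set w | w \in W /\ f w = 0].
have defP (f : 'Hom(E, F^o)) K : K = [set w | w \in W /\ f w = 0] -> form_of phi K (row_form f).
  move=> KE x; apply: iff_sym; apply: iff_trans (row_formP f x) _; rewrite KE.
  by split=> [fx|[]//]; split=> //; have : [set` W] (phi x) by apply/phiX; exists x.
have defE (K : set E) : K \in A -> exists f, defines K f.
  move=> KA; have [g [KE _ _]] := hK K KA; exists g.1.
  have := A0 K KA; rewrite KE => -[_ /=]; rewrite /ev linear0 add0r => g0.
  by apply/seteqP; split=> w [wW gw]; split; rewrite /= /ev ?g0 ?addr0 in gw *.
pose f_ K := xget 0 (defines K).
pose a K := row_form (f_ K).
have aP : {in A, forall K, form_of phi K (a K)}.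
  by move=> K KA; apply: defP; exact: (xgetPex 0 (defE K KA)).
have [th [d [[thD thS thI _] _]]] := ifr_free_exp hA A0 phi_inj phiX aP.
have linE f : lin_poly W f = lin (row_form f).
  by apply: eq_bigr => i _; rewrite mxE.
(* [log_derivation] tests every form defining a member; all of them are multiples of the chosen one,
   so the chosen one decides. *)
have logP (e : {linear poly_on W -> poly_on W}) :
    log_derivation A e <-> is_derivation e /\ lderiv (enum_fset A) a (field_of e).
  split=> -[eD eA]; split=> // K.
    move=> KA; rewrite -deriv_lin.
    by have := eA K (f_ K) KA (xgetPex 0 (defE K KA)); rewrite linE.
  move=> f KA KE; rewrite linE.
  have [k k0 fE] : exists2 k, k != 0 & row_form f = k *: a K.
    apply: proportional_forms.
    - exact: (form_of_neq0 phiX (hK _ KA) (defP _ _ KE)).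
    - exact: (form_of_neq0 phiX (hK _ KA) (aP _ KA)).
    - by move=> x /(aP _ KA) /(defP _ _ KE).
  have [q qE] := eA K KA; exists q; rewrite fE linZ linearZ /= deriv_lin qE.
  by rewrite scalerAl.
exists (fun i => field_deriv (row i th)); split.
  by move=> i; apply/logP; split; [exact: field_derivM | rewrite field_derivK; exact: thD].
move=> e /logP[eD eA]; have [c cE] := thS _ eA.
have sumE (c' : 'I_(\dim W) -> poly_on W) : (forall p, e p = \sum_i c' i * field_deriv (row i th) p) <->
    field_of e = (\row_i c' i) *m th.
  split=> [ep|ep p].
    apply/rowP => j; rewrite !mxE ep; apply: eq_bigr => i _.
    by rewrite field_derivX !mxE.
  rewrite (field_ofK eD) ep /field_deriv; under [RHS]eq_bigr do rewrite mulr_sumr.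
  rewrite exchange_big; apply: eq_bigr => j _; rewrite mxE mulr_suml.
  by apply: eq_bigr => i _; rewrite !mxE mulrA.
exists [ffun i => c 0 i]; split.
  apply/sumE; rewrite cE; congr (_ *m _); apply/rowP => i.
  by rewrite mxE ffunE.
move=> c' /sumE; rewrite cE => /eqP; rewrite -subr_eq0 -mulmxBl => /eqP/thI/eqP.
rewrite subr_eq0 => /eqP cc'; apply/ffunP => i; rewrite ffunE cc' mxE.
by [].
Qed.

End Derivations.

(** * Zaslavsky's theorems *)

Section Zaslavsky.
Variables (R : realFieldType) (E : vectType R) (f : set E -> afun E).
Implicit Types (X K L : set E) (A B : {fset set E}) (U : {vspace E}).
Local Open Scope fset_scope.
Local Open Scope ring_scope.

Lemma pos_nbhs (T : eqType) (s : seq T) (c d : T -> R) :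
  {in s, forall i, 0 < c i} ->
  exists2 e, 0 < e & forall t, `|t| <= e -> {in s, forall i, 0 < c i + t * d i}.
Proof.
elim: s => [|i s IH] cs; first by exists 1.
have [|e e0 eP] := IH; first by move=> j js; apply: cs; rewrite inE js orbT.
have ci : 0 < c i by apply: cs; rewrite mem_head.
have d1 : 0 < `|d i| + 1 by rewrite ltr_wpDl.
(* With this bound on [t], the change [t * d i] is at most half of [c i]. *)
exists (Num.min e (c i / (2 * (`|d i| + 1)))).
  by rewrite lt_min e0 divr_gt0 // mulr_gt0.
move=> t; rewrite le_min => /andP[te tc] j; rewrite inE => /predU1P[->|]; last exact: eP.
have : `|t * d i| <= c i / 2.
  rewrite normrM; apply: le_trans (ler_pM _ _ tc (_ : _ <= `|d i| + 1)) _ => //.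
    by rewrite lerDl.
  by rewrite invfM mulrA mulfVK ?gt_eqF.
by rewrite ler_norml => /andP[+ _]; lra.
Qed.

Definition sg K B : R := if K \in B then 1 else -1.

(** [B] is the set of members on whose positive side the cell lies; the regions will be the nonempty
    cells. *)
Definition cell X A B : set E :=
  [set x | X x /\ {in A, forall K, 0 < sg K B * ev (f K) x}].

Lemma cell_shift X U A B p u : direction X U -> cell X A B p -> u \in U ->
  exists2 e, 0 < e & forall t, `|t| <= e -> cell X A B (p + t *: u).
Proof.
move=> XU [pX pA] uU; have [e e0 eP] := pos_nbhs (fun K => sg K B * (f K).1 u) pA.
exists e => // t te; split; first by apply/(direction_mem _ XU pX); rewrite rpredZ.
by move=> K KA; rewrite ev_shift mulrDr mulrCA; exact: eP.
Qed.

Lemma cell_convex X U A B x y t : direction X U -> cell X A B x -> cell X A B y ->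
  0 <= t <= 1 -> cell X A B (x + t *: (y - x)).
Proof.
move=> XU [xX xA] [yX yA] t01; split.
  by apply/(direction_mem _ XU xX); rewrite rpredZ //;
    exact: (((directionP X U).1 XU).2 x y xX).1.
move=> K KA; rewrite ev_shift linearB /=.
have := xA K KA; have := yA K KA; rewrite /ev.
set a := (f K).1 x; set b := (f K).1 y; set c := (f K).2; set s := sg K B => hb ha.
have -> : s * (a + c + t * (b - a)) = (1 - t) * (s * (a + c)) + t * (s * (b + c)) by ring.
move/andP: t01 => [t0 t1]; have [->|tn] := eqVneq t 0; first by rewrite subr0 mul1r mul0r addr0.
apply: ltr_wpDl; first by rewrite mulr_ge0 ?subr_ge0 // ltW.
by rewrite mulr_gt0 // lt_neqAle eq_sym tn.
Qed.

Section AddOne.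
Variables (X K : set E) (U : {vspace E}) (A : {fset set E}).
Hypotheses (XU : direction X U) (KA : K \notin A) (XK : (X `&` K)%classic = zset X (f K)).

Lemma cell_neg B : B `<=` A ->
  cell X (K |` A) B = (cell X A B `&` [set x | ev (f K) x < 0])%classic.
Proof.
move=> BA; have KB : K \notin B by apply: contra KA => /(fsubsetP BA).
apply/seteqP; split=> x.
  move=> [xX xA]; split; first by split=> // L LA; apply: xA; rewrite inE LA orbT.
  by have := xA K (fset1U1 _ _); rewrite /sg (negPf KB) mulN1r oppr_gt0.
move=> [[xX xA] /= xK]; split=> // L; rewrite !inE => /predU1P[->|]; last exact: xA.
by rewrite /sg (negPf KB) mulN1r oppr_gt0.
Qed.

Lemma sgU1 L B : L \in A -> sg L (K |` B) = sg L B.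
Proof. by move=> LA; rewrite /sg !inE; case: eqP => // LK; rewrite LK (negPf KA) in LA. Qed.

Lemma cell_pos B : B `<=` A ->
  cell X (K |` A) (K |` B) = (cell X A B `&` [set x | 0 < ev (f K) x])%classic.
Proof.
move=> BA; apply/seteqP; split=> x.
  move=> [xX xA]; split.
    by split=> // L LA; rewrite -sgU1 //; apply: xA; rewrite inE LA orbT.
  by have := xA K (fset1U1 _ _); rewrite /sg fset1U1 mul1r.
move=> [[xX xA] /= xK]; split=> // L; rewrite !inE => /predU1P[->|LA].
  by rewrite /sg fset1U1 mul1r.
by rewrite sgU1 //; exact: xA.
Qed.

Lemma cell_zero B : cell (X `&` K) A B = (cell X A B `&` [set x | ev (f K) x = 0])%classic.
Proof.
rewrite /cell XK; apply/seteqP; split=> x; first by move=> [[xX xK] xA].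
by move=> [[xX xA] xK].
Qed.

End AddOne.

(* A nonempty cell is bounded iff no nonzero direction [u] recedes to infinity
   inside it; stated in this way, Zaslavsky's count needs no topology. *)
Definition rec_trivial U A B :=
  forall u, u \in U -> {in A, forall K, 0 <= sg K B * (f K).1 u} -> u = 0.

Definition reg X A B : bool := `[< cell X A B !=set0 >].
Definition breg U X A B : bool := `[< cell X A B !=set0 /\ rec_trivial U A B >].

Definition essential U A := forall u, u \in U -> {in A, forall K, (f K).1 u = 0} -> u = 0.

Lemma cell_rec X U A B p u : direction X U -> cell X A B p -> u \in U ->
  {in A, forall K, 0 <= sg K B * (f K).1 u} ->
  forall t, 0 <= t -> cell X A B (p + t *: u).
Proof.
move=> XU [pX pA] uU uA t t0; split; first by apply/(direction_mem _ XU pX); rewrite rpredZ.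
move=> K KA; rewrite ev_shift mulrDr mulrCA ltr_wpDr ?pA //.
by rewrite mulr_ge0 ?uA.
Qed.

Lemma ray_ge0 (a b : R) : (forall t, 0 <= t -> 0 < a + t * b) -> 0 <= b.
Proof.
move=> h; rewrite leNgt; apply/negP => b0.
(* At this parameter the value is [a] minus its absolute value, which is not positive. *)
have := h (- (`|a| / b)); rewrite mulNr mulfVK ?lt_eqF // -mulrN -invrN.
rewrite mulr_ge0 // ?invr_ge0 ?oppr_ge0 ?ltW // => /(_ isT).
by have := ler_norm a; lra.
Qed.

Section Deletion.
Variables (X K : set E) (U : {vspace E}) (A : {fset set E}).
Hypotheses (XU : direction X U) (KA : K \notin A) (XK : (X `&` K)%classic = zset X (f K)).

Lemma reg_disjoint B : (X `&` K = set0)%classic -> B `<=` A ->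
  (reg X (K |` A) B + reg X (K |` A) (K |` B) = reg X A B)%N.
Proof.
move=> XK0 BA; rewrite /reg cell_neg // cell_pos //.
have f0 x : X x -> ev (f K) x != 0.
  move=> xX; apply/eqP => fx; suff : (X `&` K)%classic x by rewrite XK0.
  by rewrite XK.
have fU u x : X x -> u \in U -> (f K).1 u = 0.
  move=> xX uU; apply/eqP; apply: contraT => fu.
  have /f0 : X (x + (- (ev (f K) x / (f K).1 u)) *: u).
    by apply/(direction_mem _ XU xX); rewrite rpredZ.
  by rewrite ev_shift mulNr mulfVK // subrr eqxx.
have fc x y : X x -> X y -> ev (f K) x = ev (f K) y.
  move=> xX yX; have [_ XP] := (directionP X U).1 XU.
  have /(fU _ _ xX) : y - x \in U by apply/XP.
  by rewrite linearB /ev => /eqP; rewrite subr_eq0 => /eqP ->.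
case: (pselect (cell X A B !=set0)) => [C0|C0]; last first.
  by rewrite !(asboolF _) // => -[x [xC _]]; apply: C0; exists x.
have [p pC] := C0; have pX := pC.1.
have [fp|fp] := ltP (ev (f K) p) 0.
  rewrite (asboolT C0) asboolT ?asboolF //; last by exists p.
  by move=> [x [[xX _] /= fx]]; rewrite (fc x p) // ltNge ltW in fx.
have {}fp : 0 < ev (f K) p by rewrite lt_neqAle eq_sym f0.
rewrite (asboolT C0) asboolF ?asboolT //; first by exists p.
by move=> [x [[xX _] /= fx]]; rewrite (fc x p) // ltNge ltW in fx.
Qed.

Lemma reg_within B : (X `<=` K)%classic -> B `<=` A ->
  reg X (K |` A) B = false /\ reg X (K |` A) (K |` B) = false.
Proof.
move=> sXK BA; rewrite /reg cell_neg // cell_pos //.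
have f0 x : X x -> ev (f K) x = 0.
  move=> xX; have : (X `&` K)%classic x by split=> //; exact: sXK.
  by rewrite XK => -[].
by split; apply: asboolF => -[x [[xX _] /=]]; rewrite f0 // ltxx.
Qed.

Hypotheses (XK0 : (X `&` K)%classic !=set0) (nXK : ~ (X `<=` K)%classic).

Lemma slope_ex : exists2 u, u \in U & 0 < (f K).1 u.
Proof.
have [x xK] := XK0; have : (X `&` K)%classic x by []. rewrite XK => -[xX /= fx].
have [y yX fy] : exists2 y, X y & ev (f K) y != 0.
  apply: contrapT => nex; apply: nXK => y yX.
  have : (X `&` K)%classic y; last by case.
  rewrite XK; split=> //=; apply: contrapT => /eqP fy; apply: nex; by exists y.
have [|u uU fu] := zset_nonconst (g := f K) XU yX xX; first by rewrite fx.
have [fu0|fu0] := ltP 0 ((f K).1 u); first by exists u.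
exists (- u); first by rewrite rpredN.
by rewrite linearN oppr_gt0 lt_neqAle fu.
Qed.

(** If [K] meets the cell, a small move along a direction of positive slope, either way, stays in
    the open cell. If [K] misses it, convexity prevents the functional of [K] from changing sign. *)
Lemma cell_cases B : cell X A B !=set0 ->
  [\/ cell (X `&` K) A B !=set0 /\ (cell X A B `&` [set x | ev (f K) x < 0] !=set0 /\
        cell X A B `&` [set x | 0 < ev (f K) x] !=set0)%classic,
      cell (X `&` K) A B = set0 /\ (cell X A B `<=` [set x | ev (f K) x < 0])%classic
    | cell (X `&` K) A B = set0 /\ (cell X A B `<=` [set x | 0 < ev (f K) x])%classic].
Proof.
move=> [p pC]; case: (pselect (cell (X `&` K) A B !=set0)) => [[q q0]|C0].
  constructor 1; split; first by exists q.
  move: q0; rewrite cell_zero // => -[qC /= fq].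
  have [u uU fu] := slope_ex; have [e e0 eP] := cell_shift XU qC uU.
  split; [exists (q + (- e) *: u)|exists (q + e *: u)]; split.
  - by apply: eP; rewrite normrN gtr0_norm.
  - by rewrite /= ev_shift fq add0r mulNr oppr_lt0 mulr_gt0.
  - by apply: eP; rewrite gtr0_norm.
  - by rewrite /= ev_shift fq add0r mulr_gt0.
have {}C0 : cell (X `&` K) A B = set0.
  by apply/seteqP; split=> x // xC; apply: C0; exists x.
have f0 x : cell X A B x -> ev (f K) x != 0.
  move=> xC; apply/eqP => fx; suff : cell (X `&` K) A B x by rewrite C0.
  by rewrite cell_zero.
have opp x y : cell X A B x -> cell X A B y -> ev (f K) x < 0 -> 0 < ev (f K) y -> False.
  move=> xC yC fx fy; set a := ev (f K) x in fx; set b := ev (f K) y in fy.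
  have ab : 0 < b - a by lra.
  have /f0 : cell X A B (x + (- a / (b - a)) *: (y - x)).
    apply: (cell_convex XU) => //; rewrite divr_ge0 ?ler_pdivrMr ?mul1r ?ltW //=; lra.
  rewrite ev_shift linearB /= -/a.
  have -> : (f K).1 y - (f K).1 x = b - a by rewrite /a /b /ev; ring.
  by rewrite mulfVK; [rewrite subrr eqxx | rewrite gt_eqF].
have [fp|fp] := ltP (ev (f K) p) 0.
  constructor 2; split=> // x xC /=; rewrite ltNge le_eqVlt eq_sym (negPf (f0 _ xC)) /=.
  by apply/negP => fx; exact: (opp p x).
constructor 3; split=> // x xC /=; rewrite ltNge le_eqVlt (negPf (f0 _ xC)) /=.
apply/negP => fx; apply: (opp x p) => //.
by rewrite lt_neqAle eq_sym f0.
Qed.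

Lemma reg_split B : B `<=` A ->
  (reg X (K |` A) B + reg X (K |` A) (K |` B) = reg X A B + reg (X `&` K) A B)%N.
Proof.
move=> BA; rewrite /reg cell_neg // cell_pos //.
case: (pselect (cell X A B !=set0)) => [C|C]; last first.
  rewrite cell_zero // !(asboolF _) //; by move=> -[x [xC _]]; apply: C; exists x.
case: (cell_cases C) => [[h0 [h1 h2]]|[h0 h1]|[h0 h1]].
- by rewrite !asboolT.
- rewrite h0 (asboolT C) (asboolF (P := set0 !=set0)); last by case.
  rewrite asboolT ?asboolF //; last by have [p pC] := C; exists p; split=> //; exact: h1.
  by move=> [x [/h1 /= fx fx']]; have := lt_trans fx fx'; rewrite ltxx.
- rewrite h0 (asboolT C) (asboolF (P := set0 !=set0)); last by case.
  rewrite asboolF ?asboolT //; first by have [p pC] := C; exists p; split=> //; exact: h1.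
  by move=> [x [/h1 /= fx fx']]; have := lt_trans fx fx'; rewrite ltxx.
Qed.

End Deletion.

End Zaslavsky.

Section ZaslavskyTheorem.
Variables (R : realFieldType) (E : vectType R) (f : set E -> afun E).
Implicit Types (X K L : set E) (A B : {fset set E}) (U : {vspace E}).
Local Open Scope fset_scope.
Local Open Scope ring_scope.
Local Notation cell := (cell f).
Local Notation reg := (reg f).
Local Notation breg := (breg f).
Local Notation rec_trivial := (rec_trivial f).
Local Notation essential := (essential f).

Section Deletion.
Variables (X K : set E) (U : {vspace E}) (A : {fset set E}).
Hypotheses (XU : direction X U) (KA : K \notin A) (XK : (X `&` K)%classic = zset X (f K)).

(** The recession cone of the cell [B]. *)
Let rc B u := u \in U /\ {in A, forall L, 0 <= sg L B * (f L).1 u}.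

Lemma rec_neg B : B `<=` A ->
  rec_trivial U (K |` A) B <-> forall u, rc B u -> (f K).1 u <= 0 -> u = 0.
Proof.
move=> BA; have KB : K \notin B by apply: contra KA => /(fsubsetP BA).
split=> h u.
  move=> [uU uA] uK; apply: h => // L; rewrite !inE => /predU1P[->|]; last exact: uA.
  by rewrite /sg (negPf KB) mulN1r oppr_ge0.
move=> uU uA; apply: h; first by split=> // L LA; apply: uA; rewrite inE LA orbT.
by have := uA K (fset1U1 _ _); rewrite /sg (negPf KB) mulN1r oppr_ge0.
Qed.

Lemma rec_pos B :
  rec_trivial U (K |` A) (K |` B) <-> forall u, rc B u -> 0 <= (f K).1 u -> u = 0.
Proof.
split=> h u.
  move=> [uU uA] uK; apply: h => // L; rewrite !inE => /predU1P[->|LA].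
    by rewrite /sg fset1U1 mul1r.
  by rewrite (sgU1 KA) //; exact: uA.
move=> uU uA; apply: h; last by have := uA K (fset1U1 _ _); rewrite /sg fset1U1 mul1r.
by split=> // L LA; rewrite -(sgU1 KA) //; apply: uA; rewrite inE LA orbT.
Qed.

Lemma rec_zero B :
  rec_trivial (U :&: lker (f K).1)%VS A B <-> forall u, rc B u -> (f K).1 u = 0 -> u = 0.
Proof.
split=> h u.
  by move=> [uU uA] uK; apply: h => //; rewrite memv_cap memv_ker uU uK /=.
by rewrite memv_cap memv_ker => /andP[uU /eqP uK] uA; apply: h.
Qed.

Lemma rcD B u v a b : 0 <= a -> 0 <= b -> rc B u -> rc B v -> rc B (a *: u + b *: v).
Proof.
move=> a0 b0 [uU uA] [vU vA]; split; first by rewrite rpredD ?rpredZ.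
move=> L LA; rewrite linearD !linearZ /= mulrDr addr_ge0 //.
  by rewrite mulrCA mulr_ge0 ?uA.
by rewrite mulrCA mulr_ge0 ?vA.
Qed.

Lemma sg_neq0 L B : sg L B != 0.
Proof. by rewrite /sg; case: ifP => _; rewrite ?oppr_eq0 oner_eq0. Qed.

Lemma rc_line B u : essential U A -> rc B u -> rc B (- u) -> u = 0.
Proof.
move=> eA [uU uA] [_ uA']; apply: eA => // L LA; apply/eqP.
have := uA L LA; have := uA' L LA; rewrite linearN mulrN oppr_ge0 => h1 h2.
have /eqP : sg L B * (f L).1 u = 0 by apply/eqP; rewrite eq_le h1.
by rewrite mulf_eq0 (negPf (sg_neq0 _ _)).
Qed.

(** For a trivial recession cone all terms are 1. For a nontrivial one, the half cones on the two
    sides of [K] cannot both be trivial, and if one is, so is the slice between them. If neither is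
    and the slice were trivial, vectors [v] and [w] strictly on the two sides would have a positive
    combination in the slice, hence 0; so the cone would contain a line, against [essential]. *)
Lemma rec_split B : B `<=` A -> essential U A ->
  (`[< rec_trivial U (K |` A) B >] + `[< rec_trivial U (K |` A) (K |` B) >] =
   `[< rec_trivial U A B >] + `[< rec_trivial (U :&: lker (f K).1)%VS A B >])%N.
Proof.
move=> BA eA.
have [rN rP rZ] := And3 (rec_neg BA) (rec_pos B) (rec_zero B).
case: (pselect (rec_trivial U A B)) => [r|r].
  have r0 u : rc B u -> u = 0 by move=> [uU uA]; exact: r.
  by rewrite !asboolT //; [apply/rZ|apply/rP|apply/rN] => u /r0.
have [u [u0 uB]] : exists u, u <> 0 /\ rc B u.
  apply: contrapT => nex; apply: r => u uU uA; apply: contrapT => u0.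
  by apply: nex; exists u.
rewrite (asboolF r).
case: (pselect (rec_trivial U (K |` A) B)) => [/[dup]/rN hN N|N].
  rewrite (asboolT N) asboolF ?asboolT //; first by apply/rZ => v vB v0; apply: hN; rewrite ?v0.
  move=> /rP hP; apply: u0; case: (leP ((f K).1 u) 0) => [|/ltW]; first exact: hN.
  exact: hP.
case: (pselect (rec_trivial U (K |` A) (K |` B))) => [/[dup]/rP hP P|P].
  rewrite (asboolF N) (asboolT P) asboolT //.
  by apply/rZ => v vB v0; apply: hP; rewrite ?v0.
rewrite !asboolF // => /rZ hZ.
have [v [v0 vB vK]] : exists v, [/\ v <> 0, rc B v & (f K).1 v < 0].
  apply: contrapT => nex; apply: N; apply/rN => v vB vK; apply: contrapT => v0.
  apply: nex; exists v; split=> //; rewrite lt_neqAle vK andbT; apply/eqP => e.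
  by apply: v0; exact: hZ.
have [w [w0 wB wK]] : exists w, [/\ w <> 0, rc B w & 0 < (f K).1 w].
  apply: contrapT => nex; apply: P; apply/rP => w wB wK; apply: contrapT => w0.
  apply: nex; exists w; split=> //; rewrite lt_neqAle wK andbT; apply/eqP => e.
  by apply: w0; exact: hZ.
set a := (f K).1 v in vK; set b := (f K).1 w in wK.
have a0 : 0 < - a by rewrite oppr_gt0.
have zB := rcD (ltW wK) (ltW a0) vB wB.
have z0 : b *: v + - a *: w = 0.
  by apply: hZ => //; rewrite linearD !linearZ /= -/a -/b -![_ *: _]/(_ * _) mulNr mulrC subrr.
apply: w0; apply: (rc_line eA wB).
have a0' : - a != 0 by rewrite gt_eqF.
have -> : - w = (b / - a) *: v + 0 *: v.
  apply: (scalerI a0'); rewrite scale0r addr0 scalerA mulrC mulfVK // scalerN.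
  by apply/esym/eqP; rewrite -addr_eq0 z0.
by apply: rcD => //; rewrite divr_ge0 // ltW.
Qed.

Lemma breg_neg_side B : (cell X A B `<=` [set x | ev (f K) x < 0])%classic ->
  B `<=` A -> cell X A B !=set0 -> rec_trivial U (K |` A) B <-> rec_trivial U A B.
Proof.
move=> neg BA [p pC]; apply: iff_trans (rec_neg BA) _; split=> h u.
  move=> uU uA; apply: h => //; rewrite -oppr_ge0; apply: (@ray_ge0 _ (- ev (f K) p)).
  move=> t t0; have /neg := cell_rec XU pC uU uA t0.
  by rewrite /= ev_shift mulrN -opprD oppr_gt0.
by move=> [uU uA] _; exact: h.
Qed.

Lemma breg_pos_side B : (cell X A B `<=` [set x | 0 < ev (f K) x])%classic ->
  cell X A B !=set0 -> rec_trivial U (K |` A) (K |` B) <-> rec_trivial U A B.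
Proof.
move=> pos [p pC]; apply: iff_trans (rec_pos B) _; split=> h u.
  move=> uU uA; apply: h => //; apply: (@ray_ge0 _ (ev (f K) p)) => t t0.
  by have /pos := cell_rec XU pC uU uA t0; rewrite /= ev_shift.
by move=> [uU uA] _; exact: h.
Qed.

Lemma bregE V Y D B : breg V Y D B = reg Y D B && `[< rec_trivial V D B >].
Proof. by apply/asboolP/andP => -[h1 h2]; split; apply/asboolP. Qed.

Lemma breg_side B : B `<=` A -> cell X A B !=set0 ->
  (cell X A B `<=` [set x | ev (f K) x < 0])%classic \/
  (cell X A B `<=` [set x | 0 < ev (f K) x])%classic ->
  (breg U X (K |` A) B + breg U X (K |` A) (K |` B) = breg U X A B)%N.
Proof.
move=> BA [p pC] side; rewrite !bregE /reg (cell_neg _ _ KA BA) (cell_pos _ _ KA BA).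
have C0 : cell X A B !=set0 by exists p.
rewrite (asboolT C0); case: side => side.
  have N : (cell X A B `&` [set x | ev (f K) x < 0] !=set0)%classic.
    by exists p; split=> //; exact: side.
  have P : ~ (cell X A B `&` [set x | 0 < ev (f K) x] !=set0)%classic.
    by move=> [x [/side /= fx fx']]; have := lt_trans fx fx'; rewrite ltxx.
  by rewrite (asboolT N) (asboolF P) (asbool_equiv_eq (breg_neg_side side BA C0)) addn0.
have P : (cell X A B `&` [set x | 0 < ev (f K) x] !=set0)%classic.
  by exists p; split=> //; exact: side.
have N : ~ (cell X A B `&` [set x | ev (f K) x < 0] !=set0)%classic.
  by move=> [x [/side /= fx fx']]; have := lt_trans fx fx'; rewrite ltxx.
by rewrite (asboolF N) (asboolT P) (asbool_equiv_eq (breg_pos_side side C0)).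
Qed.

Lemma breg_within B : (X `<=` K)%classic -> B `<=` A ->
  breg U X (K |` A) B = false /\ breg U X (K |` A) (K |` B) = false.
Proof. by move=> h BA; have [r1 r2] := reg_within KA XK h BA; rewrite !bregE r1 r2. Qed.

Lemma breg_empty B : B `<=` A -> ~ (cell X A B !=set0) ->
  breg U X (K |` A) B = false /\ breg U X (K |` A) (K |` B) = false.
Proof.
move=> BA C0; rewrite !bregE /reg (cell_neg _ _ KA BA) (cell_pos _ _ KA BA).
split; rewrite asboolF // => -[x [xC _]]; apply: C0; by exists x.
Qed.

Lemma breg_disjoint B : (X `&` K = set0)%classic -> B `<=` A ->
  (breg U X (K |` A) B + breg U X (K |` A) (K |` B) = breg U X A B)%N.
Proof.
move=> h BA; have := reg_disjoint XU KA XK h BA.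
case: (pselect (cell X A B !=set0)) => [C0|C0 _]; last first.
  by have [-> ->] := breg_empty BA C0; rewrite bregE /reg (asboolF C0).
rewrite /reg (asboolT C0) (cell_neg _ _ KA BA) (cell_pos _ _ KA BA) => e.
apply: breg_side => //; move: e.
case: asboolP => [_|nN]; case: asboolP => [_|nP] // _; [left|right] => x xC /=.
  rewrite ltNge; apply/negP; rewrite le_eqVlt => /predU1P[fx|fx]; last by apply: nP; exists x.
  suff : (X `&` K)%classic x by rewrite h.
  by rewrite XK; split=> //; exact: xC.1.
rewrite ltNge; apply/negP; rewrite le_eqVlt => /predU1P[fx|fx]; last by apply: nN; exists x.
suff : (X `&` K)%classic x by rewrite h.
by rewrite XK; split=> //; exact: xC.1.
Qed.

Hypotheses (XK0 : (X `&` K)%classic !=set0) (nXK : ~ (X `<=` K)%classic).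

Lemma breg_split B : B `<=` A -> essential U A ->
  (breg U X (K |` A) B + breg U X (K |` A) (K |` B) =
   breg U X A B + breg (U :&: lker (f K).1)%VS (X `&` K) A B)%N.
Proof.
move=> BA eA; have noset0 : ~ (@set0 E !=set0) by case.
case: (pselect (cell X A B !=set0)) => [C0|C0]; last first.
  have Z : ~ (cell (X `&` K) A B !=set0).
    by move=> [x]; rewrite (cell_zero _ XK) => -[xC _]; apply: C0; exists x.
  by have [-> ->] := breg_empty BA C0; rewrite !bregE /reg (asboolF C0) (asboolF Z).
have := cell_cases XU XK XK0 nXK C0; case=> [[h0 [h1 h2]]|[h0 h1]|[h0 h1]].
- rewrite !bregE /reg (cell_neg _ _ KA BA) (cell_pos _ _ KA BA).
  by rewrite (asboolT C0) (asboolT h0) (asboolT h1) (asboolT h2); exact: rec_split.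
- rewrite breg_side //; last by left.
  by rewrite [breg _ (X `&` K) _ _]bregE /reg h0 (asboolF noset0) addn0.
- rewrite breg_side //; last by right.
  by rewrite [breg _ (X `&` K) _ _]bregE /reg h0 (asboolF noset0) addn0.
Qed.

(** A line of directions common to all of [A] lies in the recession cone of every cell, and each
    side of [K] retains at least one half of it. *)
Lemma breg_line B : B `<=` A -> essential U (K |` A) -> ~ essential U A ->
  breg U X (K |` A) B = false /\ breg U X (K |` A) (K |` B) = false.
Proof.
move=> BA eKA neA.
have [u [uU u0 uA]] : exists u, [/\ u \in U, u <> 0 & {in A, forall L, (f L).1 u = 0}].
  apply: contrapT => nex; apply: neA => u uU uA; apply: contrapT => u0.
  by apply: nex; exists u.
have uB : rc B u by split=> // L LA; rewrite uA // mulr0.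
have nuB : rc B (- u).
  by split=> [|L LA]; rewrite ?rpredN // linearN /= uA // oppr0 mulr0.
rewrite !bregE; split; apply/negP => /andP[_ /asboolP].
  move=> /(rec_neg BA) h; apply: u0; case: (leP ((f K).1 u) 0) => [|uK]; first exact: h.
  by apply/eqP; rewrite -oppr_eq0; apply/eqP/h => //; rewrite linearN oppr_le0 ltW.
move=> /rec_pos h; apply: u0; case: (leP 0 ((f K).1 u)) => [|uK]; first exact: h.
by apply/eqP; rewrite -oppr_eq0; apply/eqP/h => //; rewrite linearN oppr_ge0 ltW.
Qed.

End Deletion.

Definition nreg X A : int := \sum_(B <- fpowerset A) (reg X A B)%:R.
Definition nbreg U X A : int := \sum_(B <- fpowerset A) (breg U X A B)%:R.

Lemma fset_ind_card (P : {fset set E} -> Prop) : P fset0 ->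
  (forall K A, K \notin A -> P A -> P (K |` A)) -> forall A, P A.
Proof.
move=> P0 PU A; have [m] := ubnP #|` A|; elim: m A => // m IH A.
case: (fset_0Vmem A) => [-> //|[K KA]]; rewrite (cardfsD1 K) KA => lm.
by rewrite -(fsetD1K KA); apply: PU; [rewrite !inE eqxx | exact: IH].
Qed.

Lemma nreg_rec X K A (rK rX rZ : {fset set E} -> bool) : K \notin A ->
  (forall B, B `<=` A -> (rK B + rK (K |` B) = rX B + rZ B)%N) ->
  \sum_(B <- fpowerset (K |` A)) (rK B)%:R =
  \sum_(B <- fpowerset A) (rX B)%:R + \sum_(B <- fpowerset A) (rZ B)%:R :> int.
Proof.
move=> KA h; rewrite sum_fpowersetU1 // -!big_split /= big_seq [RHS]big_seq.
by apply: eq_bigr => B; rewrite fpowersetE => BA; rewrite -!natrD h.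
Qed.

(** The ambient space varies while the functionals [f] stay fixed, so the same [f] serves for all
    restrictions. Passing to [X] cut by [K] lowers the dimension by one, and the sign turns the
    difference of Whitney sums into a sum of counts. *)
Theorem zaslavsky A X U : direction X U ->
  {in A, forall K, (X `&` K)%classic = zset X (f K)} ->
  nreg X A = (-1) ^+ \dim U * (wsum X A).[-1].
Proof.
elim/fset_ind_card: A X U => [|K A KA IH] X U XU XA.
  have [X0 _] := (directionP X U).1 XU.
  rewrite /nreg fpowerset0 big_seq_fset1 wsum_nil // hornerXn (adimE XU).
  rewrite -exprMn mulrNN mulr1 expr1n /reg asboolT //.
  by have [x xX] := X0; exists x; split.
have XK := XA K (fset1U1 _ _).
have XA' : {in A, forall L, (X `&` L)%classic = zset X (f L)}.
  by move=> L LA; apply: XA; rewrite inE LA orbT.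
rewrite wsumU1 // hornerD hornerN mulrDr -(IH X U) //.
case: (pselect ((X `&` K)%classic !=set0)) => [XK0|/set0P/negP]; last first.
  rewrite negbK => /eqP XK0; rewrite XK0 wsum0 horner0 oppr0 mulr0.
  rewrite /nreg (nreg_rec X (rX := reg X A) (rZ := fun=> false) KA).
    by congr (_ + _); apply: big1 => B _.
  by move=> B BA; rewrite addn0 (reg_disjoint XU KA XK XK0 BA).
case: (pselect (X `<=` K)%classic) => [sXK|nXK].
  rewrite (setIidl sXK) mulrN -(IH X U) // subrr.
  rewrite /nreg (nreg_rec X (rX := fun=> false) (rZ := fun=> false) KA).
    by rewrite !big1 // => B _.
  by move=> B BA; have [-> ->] := reg_within KA XK sXK BA.
have [u uU u0] := slope_ex XU XK XK0 nXK.
have dU := dim_lker uU (lt0r_neq0 u0).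
have [x xK] := XK0; have xZ : zset X (f K) x by rewrite -XK.
have XKU : direction (X `&` K)%classic (U :&: lker (f K).1)%VS.
  by rewrite XK; exact: direction_zset xZ.
have -> : (-1) ^+ \dim U * - (wsum (X `&` K) A).[-1] = nreg (X `&` K) A.
  rewrite (IH _ _ XKU) ?dU ?exprS ?mulN1r ?mulrNN ?mulNr ?mulrN ?opprK // => L LA.
  rewrite setIAC XA' //; apply/seteqP; split=> y; first by case=> [[yX yL] yK].
  by case=> [[yX yK] yL].
by rewrite /nreg (nreg_rec X (rX := reg X A) (rZ := reg (X `&` K) A) KA) // => B BA;
  rewrite (reg_split XU KA XK XK0 nXK BA).
Qed.

End ZaslavskyTheorem.

Section BoundedRegions.
Variables (R : realFieldType) (E : vectType R) (f : set E -> afun E).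
Implicit Types (X K L : set E) (A B : {fset set E}) (U : {vspace E}).
Local Open Scope fset_scope.
Local Open Scope ring_scope.

Lemma flat_affine B X : is_affine X -> {in B, forall K, (X `&` K)%classic = zset X (f K)} ->
  flat X B !=set0 -> is_affine (flat X B).
Proof.
elim/fset_ind_card: B X => [|K B KB IH] X aX XB; first by rewrite flat0.
rewrite flatU1 => Y0; have XK := XB K (fset1U1 _ _).
apply: IH => //.
  have [U XU] := aX; have [x xY] := Y0; exists (U :&: lker (f K).1)%VS; rewrite XK.
  by apply: (direction_zset (x := x) XU); rewrite -XK; exact: flat_sub xY.
move=> L LB; rewrite setIAC XB ?inE ?LB ?orbT //.
by apply/seteqP; split=> y; [case=> [[yX yL] yK] | case=> [[yX yK] yL]].
Qed.

(** Every nonempty flat is invariant under translation by [u], which crosses [K], so it meets [K] in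
    a flat of dimension one less. The two Whitney sums therefore agree at 1. *)
Lemma wsum_line X K U A u : direction X U -> u \in U ->
  {in K |` A, forall L, (X `&` L)%classic = zset X (f L)} ->
  {in A, forall L, (f L).1 u = 0} -> (f K).1 u != 0 ->
  wsum X A = 'X * wsum (X `&` K)%classic A.
Proof.
move=> XU uU XA uA uK; rewrite /wsum mulr_sumr big_seq [RHS]big_seq.
apply: eq_bigr => B; rewrite fpowersetE => BA.
have XK := XA K (fset1U1 _ _).
have XL L : L \in B -> (X `&` L)%classic = zset X (f L).
  by move=> /(fsubsetP BA) LA; apply: XA; rewrite inE LA orbT.
have XuX x t : X x -> X (x + t *: u).
  by move=> xX; apply/(direction_mem _ XU xX); rewrite rpredZ.
have flat_shift x t : flat X B x -> flat X B (x + t *: u).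
  move=> /flatP[xX xB]; apply/flatP; split; first exact: XuX.
  move=> L LB; have : zset X (f L) (x + t *: u).
    have : zset X (f L) x by rewrite -XL //; split=> //; exact: xB.
    move=> [_ /= xL]; split; first exact: XuX.
    by rewrite /= ev_shift xL (uA _ (fsubsetP BA _ LB)) mulr0 addr0.
  by rewrite -XL // => -[].
have flatK : flat (X `&` K)%classic B = zset (flat X B) (f K).
  apply/seteqP; split=> x.
    move=> /flatP[xXK xB]; have : zset X (f K) x by rewrite -XK.
    by move=> [xX xK]; split=> //; apply/flatP; split.
  move=> [/flatP[xX xB] xK]; apply/flatP; split=> //.
  by rewrite XK; split.
rewrite /wterm; case: (eqVneq (flat X B) set0) => [Y0|/set0P[x xY]].
  rewrite flatK Y0 /zset set0I eqxx mulr0 //.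
have yP : zset (flat X B) (f K) (x + (- (ev (f K) x / (f K).1 u)) *: u).
  by split; [exact: flat_shift | rewrite /= ev_shift mulNr mulfVK // subrr].
rewrite flatK ifT; last by apply/set0P; eexists; exact: yP.
rewrite -scalerAr -exprS; congr (_ *: _ ^+ _).
have [|||V YV] := @flat_affine B X; [by exists U|exact: XL|by exists x|].
rewrite (adimE YV) (adimE (direction_zset YV yP)); apply: dim_lker uK.
apply/(direction_mem u YV xY); rewrite -[u]scale1r; exact: flat_shift.
Qed.

Lemma disjoint_slope X K U u : direction X U -> (X `&` K)%classic = zset X (f K) ->
  (X `&` K = set0)%classic -> u \in U -> (f K).1 u = 0.
Proof.
move=> XU XK XK0 uU; have [[x xX] _] := (directionP X U).1 XU.
apply/eqP; apply: contraT => fu.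
suff : zset X (f K) (x + (- (ev (f K) x / (f K).1 u)) *: u) by rewrite -XK XK0.
split; first by apply/(direction_mem _ XU xX); rewrite rpredZ.
by rewrite /= ev_shift mulNr mulfVK // subrr.
Qed.

(** Deleting [K] may destroy essentiality, which blocks the induction. In that case both sides are
    0, by [breg_line] and by [wsum_line] evaluated at 1. *)
Theorem zaslavsky_bounded A X U : direction X U ->
  {in A, forall K, (X `&` K)%classic = zset X (f K)} -> essential f U A ->
  nbreg f U X A = (-1) ^+ \dim U * (wsum X A).[1].
Proof.
elim/fset_ind_card: A X U => [|K A KA IH] X U XU XA eKA.
  have [X0 _] := (directionP X U).1 XU.
  have U0 : U = 0%VS.
    by apply/eqP; rewrite -subv0; apply/subvP => u uU; rewrite memv0; apply/eqP/eKA.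
  rewrite /nbreg fpowerset0 big_seq_fset1 wsum_nil // hornerXn (adimE XU) U0 dimv0.
  rewrite !expr0 mul1r /breg asboolT //; split; last by move=> u; rewrite memv0 => /eqP.
  by have [x xX] := X0; exists x; split.
have XK := XA K (fset1U1 _ _).
have XA' : {in A, forall L, (X `&` L)%classic = zset X (f L)}.
  by move=> L LA; apply: XA; rewrite inE LA orbT.
have eK : (forall u, u \in U -> (f K).1 u = 0) -> essential f U A.
  by move=> K0 u uU uA; apply: eKA => // L; rewrite !inE => /predU1P[->|/uA//]; exact: K0.
rewrite wsumU1 // hornerD hornerN mulrDr.
case: (pselect ((X `&` K)%classic !=set0)) => [XK0|/set0P/negP]; last first.
  rewrite negbK => /eqP XK0; rewrite XK0 wsum0 horner0 oppr0 mulr0.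
  rewrite -(IH X U) //; last by apply: eK => u; exact: (disjoint_slope XU XK XK0).
  rewrite /nbreg (nreg_rec X (rX := breg f U X A) (rZ := fun=> false) KA).
    by congr (_ + _); apply: big1 => B _.
  by move=> B BA; rewrite addn0 (breg_disjoint XU KA XK XK0 BA).
case: (pselect (X `<=` K)%classic) => [sXK|nXK].
  rewrite (setIidl sXK) mulrN subrr.
  rewrite /nbreg (nreg_rec X (rX := fun=> false) (rZ := fun=> false) KA).
    by rewrite !big1 // => B _.
  by move=> B BA; have [-> ->] := breg_within U KA XK sXK BA.
have [u uU u0] := slope_ex XU XK XK0 nXK.
have dU := dim_lker uU (lt0r_neq0 u0).
have [x xK] := XK0; have xZ : zset X (f K) x by rewrite -XK.
have XKU : direction (X `&` K)%classic (U :&: lker (f K).1)%VS.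
  by rewrite XK; exact: direction_zset xZ.
case: (pselect (essential f U A)) => [eA|neA]; last first.
  have [v [vU v0 vA]] : exists v, [/\ v \in U, v <> 0 & {in A, forall L, (f L).1 v = 0}].
    apply: contrapT => nex; apply: neA => v vU vA; apply: contrapT => v0.
    by apply: nex; exists v.
  have vK : (f K).1 v != 0.
    apply/eqP => vK; apply: v0; apply: eKA => // L.
    by rewrite !inE => /predU1P[->|/vA].
  rewrite (wsum_line XU vU XA vA vK) hornerM hornerX mul1r mulrN subrr.
  rewrite /nbreg (nreg_rec X (rX := fun=> false) (rZ := fun=> false) KA).
    by rewrite !big1 // => B _.
  by move=> B BA; have [-> ->] := breg_line X KA BA eKA neA.
rewrite -(IH X U) //.
have -> : (-1) ^+ \dim U * - (wsum (X `&` K) A).[1] =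
    nbreg f (U :&: lker (f K).1)%VS (X `&` K)%classic A.
  rewrite (IH _ _ XKU) ?dU ?exprS ?mulN1r ?mulrNN ?mulNr ?mulrN ?opprK //.
    move=> L LA; rewrite setIAC XA' //; apply/seteqP; split=> y; first by case=> [[yX yL] yK].
    by case=> [[yX yK] yL].
  by move=> w; rewrite memv_cap => /andP[wU _]; exact: eA.
rewrite /nbreg (nreg_rec X (rX := breg f U X A)
  (rZ := breg f (U :&: lker (f K).1)%VS (X `&` K)%classic A) KA) // => B BA.
by rewrite (breg_split XU KA XK XK0 nXK BA eA).
Qed.

Lemma card_fset_sum (T : choiceType) (S : {fset T}) (P : pred T) :
  (\sum_(B <- S) (P B)%:R : int) = #|` [fset B in S | P B]|%:R.
Proof.
have -> : #|` [fset B in S | P B]| = count P S.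
  rewrite -size_filter; apply/perm_size/uniq_perm.
  - exact: fset_uniq.
  - by rewrite filter_uniq // fset_uniq.
  - by move=> B; rewrite mem_filter !inE andbC.
rewrite -sum1_count natr_sum [RHS]big_mkcond; apply: eq_bigr => B _.
by case: (P B).
Qed.

End BoundedRegions.

(** * Connected components and boundedness of cells *)

Section RegionTopology.
Variables (R : realType) (n : nat).
Local Notation vec := 'rV[R]_n.
Implicit Types (X K : set vec) (A B : {fset set vec}) (U : {vspace vec}).

Lemma hom_sum (g : 'Hom(vec, R^o)) (x : vec) : g x = \sum_i x 0 i * g (delta_mx 0 i).
Proof. by rewrite {1}[x]row_sum_delta linear_sum; apply: eq_bigr => i _; rewrite linearZ. Qed.

Lemma sum_continuous (T : topologicalType) I (r : seq I) (F : I -> T -> R) :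
  (forall i, continuous (F i)) -> continuous (fun x => \sum_(i <- r) F i x).
Proof.
move=> cF; elim: r => [|i r IH].
  rewrite (_ : (fun x => _) = cst 0); first by move=> x; exact: cvg_cst.
  by apply/funext => x; rewrite big_nil.
rewrite (_ : (fun x => _) = (fun x => F i x + \sum_(j <- r) F j x)).
  by move=> x; apply: continuousD; [exact: cF | exact: IH].
by apply/funext => x; rewrite big_cons.
Qed.

Lemma hom_continuous (g : 'Hom(vec, R^o)) : continuous (fun x : vec => g x : R).
Proof.
have -> : (fun x : vec => g x : R) = (fun x : vec => \sum_i x 0 i * g (delta_mx 0 i)).
  by apply/funext => x; exact: hom_sum.
apply: sum_continuous => i x.
exact: (@continuousM R _ (fun y : vec => y 0 i) (cst (g (delta_mx 0 i))) x
  (@coord_continuous R 1 n 0 i x) (@cst_continuous _ _ _ x)).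
Qed.

Lemma ev_continuous (g : afun vec) : continuous (fun x : vec => ev g x : R).
Proof.
move=> x; exact: (@continuousD R R^o _ (fun y : vec => g.1 y) (cst g.2) x
  (@hom_continuous g.1 x) (@cst_continuous _ _ _ x)).
Qed.

Lemma bounded_setP (C : set vec) :
  bounded_set C <-> exists m, forall x, C x -> `|x| <= m.
Proof.
split=> [[m [_ hm]]|[m hm]]; first by exists (m + 1) => x; apply: hm; rewrite ltrDl.
exists m; split; first exact: num_real.
by move=> y my x /hm xm; exact: le_trans xm (ltW my).
Qed.

Lemma segment_convex_connected (C : set vec) p : C p ->
  (forall y t, C y -> 0 <= t <= 1 -> C (p + t *: (y - p))) -> connected C.
Proof.
move=> pC cC; have -> : C = \bigcup_(y in C) [set p + t *: (y - p) | t in `[0, 1]%classic].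
  apply/seteqP; split=> x.
    move=> xC; exists x => //; exists 1; first by rewrite /= in_itv /= ler01 lexx.
    by rewrite scale1r addrC subrK.
  by move=> [y yC [t /=]]; rewrite in_itv /= => t01 <-; exact: cC.
apply: bigcup_connected.
  by exists p => y yC; exists 0; rewrite ?scale0r ?addr0 //= in_itv /= lexx ler01.
move=> y yC; apply: connected_continuous_connected; first exact: segment_connected.
apply: continuous_subspaceT => t.
exact: (@continuousD R vec R^o (cst p) (fun s : R^o => s *: (y - p)) t
  (@cst_continuous _ _ _ t) (@scalel_continuous _ _ (y - p) t)).
Qed.

Section Arrangement.
Variables (X : set vec) (U : {vspace vec}) (A : {fset set vec}) (f : set vec -> afun vec).
Hypotheses (XU : direction X U) (XA : {in A, forall K, X `&` K = zset X (f K)}).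
Let M := X `\` \bigcup_(H in [set` A]) H.

Lemma cell_subM B : cell f X A B `<=` M.
Proof.
move=> x [xX xA]; split=> // -[K KA xK]; have := xA K KA.
have : (X `&` K) x by []. rewrite XA // => -[_ /= ->].
by rewrite mulr0 ltxx.
Qed.

Lemma memM_cell x : M x -> exists2 B, B \in fpowerset A & cell f X A B x.
Proof.
move=> [xX xA]; exists [fset K in A | 0 < ev (f K) x]%fset.
  by rewrite fpowersetE; apply/fsubsetP => K; rewrite !inE => /andP[].
split=> // K KA; rewrite /sg !inE KA /=; case: (ltP 0 (ev (f K) x)) => [|fx]; first by rewrite mul1r.
rewrite mulN1r oppr_gt0 lt_neqAle fx andbT; apply/eqP => fx0; apply: xA; exists K => //.
by have : zset X (f K) x by []; rewrite -XA // => -[].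
Qed.

(** A cell is convex, hence connected; a connected subset of the complement cannot leave it, since
    each functional is continuous and has no zero there. *)
Lemma component_cell B x : cell f X A B x -> connected_component M x = cell f X A B.
Proof.
move=> xB; apply/seteqP; split; last first.
  apply: connected_component_max => //; first exact: cell_subM.
  apply: (segment_convex_connected xB) => y t yB t01; exact: (cell_convex XU).
move=> y [D [Dx DM cD] Dy]; have [yX yA] := DM y Dy; split=> // K KA.
have nz z : D z -> ev (f K) z != 0.
  move=> /DM[zX zA]; apply/eqP => fz; apply: zA; exists K => //.
  by have : zset X (f K) z by []; rewrite -XA // => -[].
have /connected_intervalP itv : connected ((fun x => ev (f K) x : R) @` D).
  apply: connected_continuous_connected => //; apply: continuous_subspaceT.
  exact: ev_continuous.
have noz : ~ ((fun x => ev (f K) x : R) @` D) 0.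
  by move=> [z Dz fz]; have := nz z Dz; rewrite fz eqxx.
have fx := xB.2 K KA; have fy := nz y Dy.
have fDx : ((fun x => ev (f K) x : R) @` D) (ev (f K) x) by exists x.
have fDy : ((fun x => ev (f K) x : R) @` D) (ev (f K) y) by exists y.
move: fx; rewrite /sg; case: ifP => _.
  rewrite !mul1r => fx; rewrite ltNge; apply/negP => fy0; apply: noz.
  by apply: (itv _ _ fDy fDx); rewrite fy0 ltW.
rewrite !mulN1r !oppr_gt0 => fx; rewrite ltNge; apply/negP => fy0; apply: noz.
by apply: (itv _ _ fDx fDy); rewrite fy0 ltW.
Qed.

Lemma cell_inj : {in [set B | B \in [fset B in fpowerset A | reg f X A B]%fset] &,
  injective (cell f X A)}.
Proof.
move=> B B'; rewrite !inE /= !inE !fpowersetE => /andP[BA /asboolP[x xB]] /andP[BA' _] e.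
have xB' : cell f X A B' x by rewrite -e.
apply/fsetP => K; apply/idP/idP => KB.
  have KA := fsubsetP BA K KB; have := xB.2 K KA; have := xB'.2 K KA; rewrite /sg KB.
  by case: ifP => // _; lra.
have KA := fsubsetP BA' K KB; have := xB.2 K KA; have := xB'.2 K KA; rewrite /sg KB.
by case: ifP => // _; lra.
Qed.

Lemma regionsE : regions X A =
  cell f X A @` [set` [fset B in fpowerset A | reg f X A B]%fset].
Proof.
apply/seteqP; split=> C.
  move=> [x xM <-]; have [B BA xB] := memM_cell xM; exists B; last first.
    by rewrite (component_cell xB).
  by rewrite /= !inE BA /=; apply/asboolP; exists x.
move=> [B /=]; rewrite !inE => /andP[BA /asboolP[x xB]] <-; exists x.
  exact: cell_subM xB.
exact: component_cell.
Qed.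

Theorem regions_card :
  (regions X A #= `I_(#|` [fset B in fpowerset A | reg f X A B]%fset|))%card.
Proof.
rewrite regionsE; apply: (card_eq_trans (inj_card_eq cell_inj)).
exact/card_eq_fsetP.
Qed.

Lemma bounded_cell_rec B : cell f X A B !=set0 -> bounded_set (cell f X A B) ->
  rec_trivial f U A B.
Proof.
move=> [p pC] /bounded_setP[M' bM] u uU uA; apply/eqP; apply: contraT => u0.
have nu : 0 < `|u| by rewrite normr_gt0.
have M0 : 0 <= M' by apply: le_trans (bM p pC).
(* This makes the norm of [t *: u] exceed [M'] plus the norm of [p], so that [p + t *: u] violates
   the bound. *)
pose t := (M' + `|p| + 1) / `|u|.
have t0 : 0 <= t by rewrite divr_ge0 // ?addr_ge0.
have := bM _ (cell_rec XU pC uU uA t0).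
have : `|t *: u| = M' + `|p| + 1 by rewrite normrZ ger0_norm // /t mulfVK ?gt_eqF.
have := ler_normB (p + t *: u) p; rewrite [p + _]addrC addrK => h1 h2 h3.
by exfalso; move: h1 h2 h3; set a := `|_ + _|; set b := `|t *: u|; set c := `|p|; lra.
Qed.

Hypothesis cU : closed [set` U].

(** The function [h], the sum of the negative slopes, is negative on the unit sphere of [U], hence
    by compactness at most a constant [h c < 0]. Along a ray from [p] the functionals can only
    decrease by the total amount [Mp] inside the cell, which bounds the length. *)
Lemma rec_bounded_cell B : cell f X A B !=set0 -> rec_trivial f U A B ->
  bounded_set (cell f X A B).
Proof.
move=> [p pC] rU.
pose h (u : vec) : R := \sum_(K <- A) Num.min 0 (sg K B * (f K).1 u).
pose S := [set u | `|u| = 1] `&` [set` U].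
have hle u : h u <= 0 by apply: sumr_le0 => K _; rewrite ge_min lexx.
have hneg u : S u -> h u < 0.
  move=> [/= u1 uU]; rewrite lt_neqAle hle andbT; apply/eqP => hu.
  have u0 : u != 0 by rewrite -normr_gt0 u1.
  move/eqP: u0; apply; apply: rU => // K KA; rewrite leNgt; apply/negP => fu.
  move: hu; rewrite /h (big_rem K) //= min_r ?ltW // => /eqP; apply/negP.
  rewrite lt_eqF // ltr_wnDr // sumr_le0 // => L _; by rewrite ge_min lexx.
have hc : continuous h.
  apply: sum_continuous => K u.
  have sc := @continuousM R _ (cst (sg K B : R)) (fun v : vec => (f K).1 v) u
    (@cst_continuous _ _ _ u) (@hom_continuous (f K).1 u).
  exact: (@continuous_min R vec (cst 0) _ u (@cst_continuous _ _ _ u) sc).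
have cS : compact S.
  apply: bounded_closed_compact.
    by apply/bounded_setP; exists 1 => u [/= -> _]; exact: lexx.
  apply: closedI => //; apply: (@preimage_closed _ _ (fun u : vec => `|u|) [set 1]).
    by move=> u _; exact: norm_continuous.
  exact: closed_eq.
pose Mp := \sum_(K <- A) sg K B * ev (f K) p.
have hx u t : 0 <= t -> cell f X A B (p + t *: u) -> - Mp <= t * h u.
  move=> t0 [_ xA]; rewrite /Mp /h mulr_sumr -sumrN big_seq [leRHS]big_seq.
  apply: ler_sum => K KA; have := xA K KA; rewrite ev_shift mulrDr.
  have := pC.2 K KA; set a := sg K B * ev _ _; set b := (f K).1 u; set s := sg K B => a0.
  rewrite mulrCA => ab; case: (leP 0 (s * b)) => sb; last by lra.
  by rewrite mulr0 oppr_le0 ltW.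
have decomp x : cell f X A B x -> x != p ->
    S (`|x - p|^-1 *: (x - p)) /\ x = p + `|x - p| *: (`|x - p|^-1 *: (x - p)).
  move=> xC xp; have d0 : `|x - p| != 0 by rewrite normr_eq0 subr_eq0.
  split; last by rewrite scalerA divff // scale1r addrC subrK.
  split; first by rewrite /= normrZ ger0_norm ?invr_ge0 // mulVf.
  rewrite /= rpredZ //; exact: ((((directionP X U).1 XU).2 p x pC.1).1 xC.1).
case: (pselect (S !=set0)) => [S0|S0]; last first.
  apply/bounded_setP; exists `|p| => x xC; case: (eqVneq x p) => [->//|xp].
  by case: S0; exists (`|x - p|^-1 *: (x - p)); have [] := decomp x xC xp.
have [c cSc hmax] := EVT_max_rV S0 cS (continuous_subspaceT hc).
have hc0 := hneg c (set_mem cSc).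
apply/bounded_setP; exists (`|p| + Mp / - h c) => x xC.
have Mp0 : 0 <= Mp.
  by rewrite /Mp big_seq sumr_ge0 // => K KA; apply/ltW/(pC.2 K KA).
case: (eqVneq x p) => [->|xp].
  by rewrite lerDl divr_ge0 // oppr_ge0 ltW.
have [t [u [t0 tE uS xE]]] : exists t u, [/\ 0 <= t, t = `|x - p|, S u & x = p + t *: u].
  by have [uS xE] := decomp x xC xp; exists `|x - p|, (`|x - p|^-1 *: (x - p)).
have tM : - Mp <= t * h u by apply: hx => //; rewrite -xE.
have : t * h u <= t * h c by rewrite ler_wpM2l // hmax //; exact/mem_set.
have : `|x| <= `|p| + t by rewrite tE -{1}(subrK p x) addrC ler_normD.
move=> h1 h2; apply: le_trans h1 _; rewrite lerD2l ler_pdivlMr ?oppr_gt0 //.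
by rewrite mulrN; lra.
Qed.

Lemma bounded_regionsE : bounded_regions X A =
  cell f X A @` [set` [fset B in fpowerset A | breg f U X A B]%fset].
Proof.
rewrite /bounded_regions regionsE; apply/seteqP; split=> C.
  move=> [[B /=]]; rewrite !inE => /andP[BA /asboolP B0] <- bC; exists B => //=.
  by rewrite !inE BA; apply/asboolP; split=> //; exact: bounded_cell_rec.
move=> [B /=]; rewrite !inE => /andP[BA /asboolP[B0 rB]] <-; split.
  by exists B => //=; rewrite !inE BA; exact/asboolP.
exact: rec_bounded_cell.
Qed.

Theorem bounded_regions_card :
  (bounded_regions X A #= `I_(#|` [fset B in fpowerset A | breg f U X A B]%fset|))%card.
Proof.
rewrite bounded_regionsE.
apply: (card_eq_trans (inj_card_eq _)); last exact/card_eq_fsetP.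
move=> B B' hB hB'; apply: cell_inj.
  by move: hB; rewrite !inE /= !inE => /andP[-> /asboolP[? _]]; exact/asboolP.
by move: hB'; rewrite !inE /= !inE => /andP[-> /asboolP[? _]]; exact/asboolP.
Qed.

End Arrangement.
End RegionTopology.

(** * Threshold arrangements *)

Section ThresholdArrangements.
Variables (F : realFieldType) (E : vectType F).
Implicit Types (X H K : set E) (A : {fset set E}) (n w v : nat) (t : nat -> nat).
Implicit Types (y : nat -> afun E).

(** Affine independence of the first [n] functions on [X], stated as the existence of points with
    prescribed values. *)
Definition surj_coords X n y :=
  forall c : nat -> F, exists2 x, X x & forall k, (k < n)%N -> ev (y k) x = c k.

Definition eqset X (a b : E -> F) : set E := [set x | X x /\ a x = b x].

(* The condition on [t i] in the last clause is what makes this family closed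
   under restriction to a hyperplane [y_v = -1]: there the equations
   [y_v = y_j + 1] become [y_j + 1 = -1], i.e. clauses of the second kind with the
   new bound [v := t v]. *)
Definition threshold_hyp X n y t w v K : Prop :=
  [\/ exists k j, [/\ (k < n)%N, (j < w)%N & K = eqset X (ev (y k)) (fun=> j%:R)],
      exists2 k, (v <= k < n)%N & K = eqset X (ev (y k)) (fun=> -1),
      exists i j, (i < j < n)%N /\ K = eqset X (ev (y i)) (ev (y j))
    | exists i j, [/\ (i < j < n)%N, (t i <= j)%N &
        K = eqset X (ev (y i)) (fun x => ev (y j) x + 1)]].

(** This counts the hyperplanes assigned to [k]: the [w] values of [y_k], the [y_k = y_j] with
    [j > k], then [y_k = -1], and the [y_i = y_k + 1] with [i < k]. The entries of [threshold_exps]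
    beyond [n] are the zeros of the free directions. *)
Definition threshold_exp n t w v k : nat :=
  (w + (n.-1 - k) + (v <= k) + \sum_(i < k) (t i <= k))%N.

Definition threshold_exps d n t w v : seq nat :=
  [seq threshold_exp n t w v k | k <- iota 0 n] ++ nseq (d - n) 0%N.

Lemma eqset_ext X a b a' b' : (forall x, X x -> (a x = b x <-> a' x = b' x)) ->
  eqset X a b = eqset X a' b'.
Proof. by move=> h; apply/seteqP; split=> x [xX /(h x xX)]. Qed.

Lemma eqset_zset X a b (g : afun E) : (forall x, ev g x = a x - b x) ->
  eqset X a b = zset X g.
Proof.
move=> h; apply/seteqP; split=> x [xX /= e]; split=> //=; first by rewrite h e subrr.
by move/eqP: e; rewrite h subr_eq0 => /eqP.
Qed.

Lemma natr_lt_neq (i j : nat) : (i < j)%N -> (i%:R : F) <> j%:R + 1.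
Proof. by move=> ij /eqP; rewrite natr1 eqr_nat ltn_eqF // ltnS ltnW. Qed.

Lemma threshold_hyperplane X n y t w v K : surj_coords X n y ->
  threshold_hyp X n y t w v K -> hyperplane X K.
Proof.
move=> sy; have y_eq c : exists2 x, X x & forall k, (k < n)%N -> ev (y k) x = c k := sy c.
case=> [[k [j [kn jw ->]]]|[k /andP[vk kn] ->]|[i [j [/andP[ij jn] ->]]]|[i [j [/andP[ij jn] tij ->]]]].
- exists (y k - afun_cst E j%:R); split.
  + by apply: eqset_zset => x; rewrite evB ev_cst.
  + have [x xX xc] := y_eq (fun=> j%:R); exists x => //.
    by rewrite evB ev_cst xc // subrr.
  + have [x xX xc] := y_eq (fun=> j%:R + 1); exists x => //.
    by rewrite evB ev_cst xc // addrAC subrr add0r oner_neq0.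
- exists (y k - afun_cst E (-1)); split.
  + by apply: eqset_zset => x; rewrite evB ev_cst.
  + have [x xX xc] := y_eq (fun=> -1); exists x => //.
    by rewrite evB ev_cst xc // subrr.
  + have [x xX xc] := y_eq (fun=> 0); exists x => //.
    by rewrite evB ev_cst xc // sub0r opprK oner_neq0.
- exists (y i - y j); split.
  + by apply: eqset_zset => x; rewrite evB.
  + have [x xX xc] := y_eq (fun=> 0); exists x => //.
    by rewrite evB !xc // ?subrr // (ltn_trans ij).
  + have [x xX xc] := y_eq (fun k => k%:R); exists x => //.
    by rewrite evB !xc // ?(ltn_trans ij) // subr_eq0 eqr_nat ltn_eqF.
- exists (y i - (y j + afun_cst E 1)); split.
  + by apply: eqset_zset => x; rewrite evB evD ev_cst.
  + have [x xX xc] := y_eq (fun k => (k == i)%:R); exists x => //.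
    rewrite evB evD ev_cst !xc ?(ltn_trans ij) // eqxx (gtn_eqF ij).
    by rewrite add0r subrr.
  + have [x xX xc] := y_eq (fun k => k%:R); exists x => //.
    rewrite evB evD ev_cst !xc ?(ltn_trans ij) // subr_eq0; apply/eqP.
    exact: natr_lt_neq.
Qed.

Lemma sum_threshold_bump t k c : (c <= k)%N ->
  (\sum_(i < k.+1) (t i <= k.+1) = (t c <= k.+1) + \sum_(i < k) (t (bump c i) <= k.+1))%N.
Proof.
by move=> ck; rewrite (bigD1_ord (Ordinal (n:=k.+1) (m:=c) ck)).
Qed.

Lemma unbump_le c T k : (c <= k)%N -> (unbump c T <= k)%N = (T <= k.+1)%N.
Proof. by rewrite /unbump; case: (ltnP c T) => /=; lia. Qed.

(** Restriction to [y_v = -1] removes the coordinate [v] and preserves the exponents of the others;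
    [bump v k] is the old index of the new coordinate [k]. *)
Lemma threshold_exp_bump n t w v k : (v < n)%N -> (forall i, (i < n)%N -> (i < t i)%N) ->
  (k < n.-1)%N ->
  threshold_exp n.-1 (fun i => unbump v (t (bump v i))) w.+1 (unbump v (t v)) k =
  threshold_exp n t w v (bump v k).
Proof.
move=> vn it kn; rewrite /threshold_exp; have vt := it v vn.
case: (leqP v k) => vk; rewrite /bump ?vk ?(leqNgt v k) ?vk /=.
  rewrite add1n (sum_threshold_bump t vk) unbump_le //.
  under eq_bigr do rewrite unbump_le //.
  have -> : (v <= k.+1)%N by lia.
  rewrite /bump; set S := (\sum_(i < k) _)%N; set T := (t v <= k.+1)%N.
  by move: S T => S T; lia.
rewrite add0n.
have -> : (unbump v (t v) <= k)%N = false by rewrite /unbump; lia.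
have -> : (v <= k)%N = false by lia.
have -> : (\sum_(i < k) (unbump v (t ((v <= i) + i)) <= k) = \sum_(i < k) (t i <= k))%N.
  apply: eq_bigr => i _; have ik := ltn_ord i.
  have -> : (v <= i)%N = false by lia.
  by rewrite add0n /unbump; congr nat_of_bool; case: (ltnP v (t i)) => /=; lia.
by set S := (\sum_(i < k) _)%N; move: S => S; lia.
Qed.

Lemma threshold_expS n t w v k : threshold_exp n t w v k =
  (threshold_exp n t w v.+1 k + (v == k))%N.
Proof. by rewrite /threshold_exp leq_eqVlt; case: (eqVneq v k) => [->|_] /=; rewrite ?ltnn; lia. Qed.

Lemma perm_iota_bump n c : (c < n)%N ->
  perm_eq (iota 0 n) (c :: [seq bump c k | k <- iota 0 n.-1]).
Proof.
move=> cn; apply: uniq_perm; first exact: iota_uniq.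
  rewrite /= map_inj_uniq ?iota_uniq ?andbT; last exact: can_inj (bumpK c).
  apply/negP => /mapP[k _]; rewrite /bump; case: (leqP c k) => /=; lia.
move=> k; rewrite inE mem_iota /= add0n; apply/idP/predU1P => [kn|[->//|/mapP[i]]].
  case: (eqVneq k c) => [->|kc]; [by left|right; apply/mapP; exists (unbump c k)].
    by rewrite mem_iota /unbump; case: (ltnP c k) => /=; lia.
  by rewrite /bump /unbump; case: (ltnP c k) => /= ck; case: leqP => /=; lia.
by rewrite mem_iota /bump => ?->; case: (leqP c i) => /=; lia.
Qed.

Lemma threshold_exps_delete d n t w v : (v < n <= d)%N ->
  (forall i, (i < n)%N -> (i < t i)%N) ->
  exists b, [/\ perm_eq (threshold_exps d n t w v.+1) (b ::
      threshold_exps d.-1 n.-1 (fun i => unbump v (t (bump v i))) w.+1 (unbump v (t v))) &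
    perm_eq (threshold_exps d n t w v) (b.+1 ::
      threshold_exps d.-1 n.-1 (fun i => unbump v (t (bump v i))) w.+1 (unbump v (t v)))].
Proof.
move=> /andP[vn nd] it; exists (threshold_exp n t w v.+1 v).
rewrite /threshold_exps (_ : d.-1 - n.-1 = d - n)%N; last by lia.
have bumpE : [seq threshold_exp n.-1 (fun i => unbump v (t (bump v i))) w.+1 (unbump v (t v)) k
    | k <- iota 0 n.-1] = [seq threshold_exp n t w v (bump v k) | k <- iota 0 n.-1].
  apply/eq_in_map => k; rewrite mem_iota => kn; apply: threshold_exp_bump => //; lia.
rewrite -!cat_cons !perm_cat2r bumpE; split.
  apply: perm_trans (perm_map _ (perm_iota_bump vn)) _.
  rewrite /= perm_cons -map_comp (_ : map _ _ = map (fun k => threshold_exp n t w v (bump v k)) (iota 0 n.-1)) //.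
  apply/eq_map => k /=; rewrite [RHS]threshold_expS.
  by rewrite (negPf (neq_bump v k)) addn0.
apply: perm_trans (perm_map _ (perm_iota_bump vn)) _.
by rewrite /= -map_comp threshold_expS eqxx addn1.
Qed.

End ThresholdArrangements.

Section ThresholdChain.
Variables (F : realFieldType) (E : vectType F).
Implicit Types (X H K : set E) (A : {fset set E}) (n w v : nat) (t : nat -> nat).
Implicit Types (y : nat -> afun E).

Section Step.
Variables (X : set E) (n : nat) (y : nat -> afun E) (t : nat -> nat) (w v : nat).
Variable A : {fset set E}.
Hypotheses (sy : surj_coords X n y) (it : forall i, (i < n)%N -> (i < t i)%N).
Hypotheses (w0 : w = 0%N -> forall i, (i < n)%N -> (n <= t i)%N) (vn : (v < n)%N).
Hypothesis AP : forall K, K \in A <-> threshold_hyp X n y t w v K.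

Let H := eqset X (ev (y v)) (fun=> -1).
(** The shift by 1 turns the value -1 of [y_v] into 0, so that the trace of [y_v = y_k] is the
    vanishing of the new coordinate. *)
Let y' k := y (bump v k) + afun_cst E 1.
Let t' i := unbump v (t (bump v i)).
Let v' := unbump v (t v).

Lemma ev_y' k x : ev (y' k) x = ev (y (bump v k)) x + 1.
Proof. by rewrite evD ev_cst. Qed.

Lemma step_H_mem : H \in A.
Proof. by apply/AP; constructor 2; exists v => //; rewrite leqnn. Qed.

Lemma step_delete K : K \in (A `\ H)%fset <-> threshold_hyp X n y t w v.+1 K.
Proof.
have nat_neqN1 (j : nat) : (j%:R : F) <> -1.
  by move=> e; have : (0 : F) <= j%:R by []; rewrite e oppr_ge0 ler10.
rewrite !inE; split.
  move=> /andP[/eqP KH /AP]; case=> [|[k /andP[vk kn] KE]||]; try by [constructor 1|constructor 3|constructor 4].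
  constructor 2; exists k => //; rewrite kn andbT ltn_neqAle vk andbT.
  by apply/eqP => e; apply: KH; rewrite KE -e.
move=> hK; apply/andP; split; last first.
  apply/AP; case: hK => [|[k /andP[vk kn] KE]||]; try by [constructor 1|constructor 3|constructor 4].
  by constructor 2; exists k => //; rewrite kn (ltnW vk).
apply/eqP => KH.
(* Two points of [H] that separate it from the others: at [x] the other coordinates are distinct and
   positive, at [z] all coordinates are -1. *)
have [x xX xc] := sy (fun k => if k == v then -1 else k.+1%:R).
have [z zX zc] := sy (fun=> -1).
have xH : H x by split=> //; rewrite xc // eqxx.
have zH : H z by split=> //; rewrite zc.
case: hK => [[k [j [kn jw KE]]]|[k /andP[vk kn] KE]|[i [j [/andP[ij jn] KE]]]|[i [j [/andP[ij jn] tij KE]]]].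
- by move: zH; rewrite -KH KE => -[_]; rewrite zc // => e; apply: (@nat_neqN1 j).
- move: xH; rewrite -KH KE => -[_]; rewrite xc // gtn_eqF // => e.
  exact: (@nat_neqN1 k.+1).
- move: xH; rewrite -KH KE => -[_]; rewrite !xc ?(ltn_trans ij) //.
  case: eqP => [iv|_]; case: eqP => [jv|_].
  + by rewrite iv jv ltnn in ij.
  + by move=> e; apply: (@nat_neqN1 j.+1).
  + exact: nat_neqN1.
  + by move=> /eqP; rewrite eqr_nat eqSS ltn_eqF.
- move: xH; rewrite -KH KE => -[_]; rewrite !xc ?(ltn_trans ij) //.
  case: eqP => [iv|_]; case: eqP => [jv|_].
  + by rewrite iv jv ltnn in ij.
  + by rewrite natr1 => e; apply: (@nat_neqN1 j.+2).
  + by rewrite addNr => /eqP; rewrite pnatr_eq0.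
  + by rewrite -ltnS in ij; exact: natr_lt_neq.
Qed.

Lemma step_surj : surj_coords H n.-1 y'.
Proof.
move=> c; have [x xX xc] := sy (fun k => if k == v then -1 else c (unbump v k) - 1).
exists x; first by split=> //; rewrite xc // eqxx.
move=> k kn; have kb : (bump v k < n)%N by clear -vn kn; rewrite /bump; case: (leqP v k) => /=; lia.
by rewrite ev_y' xc // eq_sym (negPf (neq_bump v k)) bumpK subrK.
Qed.

Lemma bump_lt k : (k < n.-1)%N -> (bump v k < n)%N.
Proof. by clear -vn; rewrite /bump; case: (leqP v k) => /=; lia. Qed.

Lemma unbump_lt k : (k < n)%N -> k != v -> (unbump v k < n.-1)%N.
Proof. by clear -vn; rewrite /unbump; case: (ltnP v k) => /=; lia. Qed.

Lemma unbumpKv k : k != v -> bump v (unbump v k) = k.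
Proof. by move=> kv; apply: unbumpK; rewrite inE. Qed.

Lemma ltn_bump i j : (bump v i < bump v j)%N = (i < j)%N.
Proof. by rewrite ltnNge leq_bump2 -ltnNge. Qed.

Lemma cap_eqset a b : H `&` eqset X a b = eqset H a b.
Proof.
by apply/seteqP; split=> x; [case=> xH [xX e] | case=> xH e; split=> //; split=> //; have [] := xH].
Qed.

Lemma step_trace_sub K : threshold_hyp X n y t w v.+1 K -> H `&` K !=set0 ->
  threshold_hyp H n.-1 y' t' w.+1 v' (H `&` K).
Proof.
have yv x : H x -> ev (y v) x = -1 by case.
have yk k x : k != v -> ev (y k) x = ev (y' (unbump v k)) x - 1.
  by move=> kv; rewrite ev_y' unbumpKv // addrK.
case=> [[k [j [kn jw ->]]]|[k /andP[vk kn] ->]|[i [j [/andP[ij jn] ->]]]|[i [j [/andP[ij jn] tij ->]]]];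
  rewrite cap_eqset => -[z [zH ez]].
- have kv : k != v.
    apply/eqP => e; move: ez; rewrite e (yv _ zH) => e1.
    by have : (0 : F) <= j%:R by []; rewrite -e1 oppr_ge0 ler10.
  constructor 1; exists (unbump v k), j.+1; rewrite unbump_lt // ltnS jw; split=> //.
  by apply: eqset_ext => x xH; rewrite yk // -natr1; split=> e; lra.
- have kv : k != v by rewrite gtn_eqF.
  constructor 1; exists (unbump v k), 0%N; rewrite unbump_lt //; split=> //.
  by apply: eqset_ext => x xH; rewrite yk //; split=> e; lra.
- have jn' := jn; have i_n := ltn_trans ij jn.
  case: (eqVneq i v) => [iv|iv].
    have jv : j != v by rewrite gtn_eqF // -iv.
    constructor 1; exists (unbump v j), 0%N; rewrite unbump_lt //; split=> //.
    by apply: eqset_ext => x xH; rewrite iv (yv _ xH) yk //; split=> e; lra.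
  case: (eqVneq j v) => [jv|jv].
    constructor 1; exists (unbump v i), 0%N; rewrite unbump_lt //; split=> //.
    by apply: eqset_ext => x xH; rewrite jv (yv _ xH) yk //; split=> e; lra.
  constructor 3; exists (unbump v i), (unbump v j); split.
    by rewrite unbump_lt // andbT -ltn_bump !unbumpKv.
  by apply: eqset_ext => x xH; rewrite !yk //; split=> e; lra.
- have i_n := ltn_trans ij jn; case: (eqVneq i v) => [iv|iv].
    have jv : j != v by rewrite gtn_eqF // -iv.
    constructor 2; exists (unbump v j).
      rewrite unbump_lt // andbT /v' -leq_bump unbumpKv //; by rewrite -iv.
    by apply: eqset_ext => x xH; rewrite iv (yv _ xH) yk //; split=> e; lra.
  case: (eqVneq j v) => [jv|jv].
    (* The trace of [y_i = y_v + 1] is the value 1, admissible only if [1 < w + 1]. This is the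
       purpose of [w0]. *)
    have wpos : (0 < w)%N.
      rewrite lt0n; apply/eqP => /w0/(_ i i_n) nti.
      by have := leq_trans nti tij; rewrite leqNgt jn.
    constructor 1; exists (unbump v i), 1%N; rewrite unbump_lt //; split=> //.
    by apply: eqset_ext => x xH; rewrite jv (yv _ xH) yk //; split=> e; lra.
  constructor 4; exists (unbump v i), (unbump v j); split.
  + by rewrite unbump_lt // andbT -ltn_bump !unbumpKv.
  + by rewrite /t' -leq_bump !unbumpKv.
  + by apply: eqset_ext => x xH; rewrite !yk //; split=> e; lra.
Qed.

Lemma step_trace_sup K : threshold_hyp H n.-1 y' t' w.+1 v' K ->
  exists2 L, threshold_hyp X n y t w v.+1 L & K = H `&` L.
Proof.
have yv x : H x -> ev (y v) x = -1 by case.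
case=> [[k [j [kn jw ->]]]|[k /andP[vk kn] ->]|[i [j [/andP[ij jn] ->]]]|[i [j [/andP[ij jn] tij ->]]]].
- have kb := bump_lt kn; have kv := neq_bump v k.
  case: j jw => [|j] jw.
    have [lt|lt] := ltnP v (bump v k).
      exists (eqset X (ev (y v)) (ev (y (bump v k)))).
        by constructor 3; exists v, (bump v k); rewrite lt kb.
      rewrite cap_eqset; apply: eqset_ext => x xH.
      by rewrite ev_y' yv //; split=> e; lra.
    exists (eqset X (ev (y (bump v k))) (ev (y v))).
      by constructor 3; exists (bump v k), v; rewrite vn andbT ltn_neqAle eq_sym kv lt.
    rewrite cap_eqset; apply: eqset_ext => x xH.
    by rewrite ev_y' yv //; split=> e; lra.
  exists (eqset X (ev (y (bump v k))) (fun=> j%:R)).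
    by constructor 1; exists (bump v k), j.
  rewrite cap_eqset; apply: eqset_ext => x xH.
  by rewrite ev_y' -natr1; split=> e; lra.
- have kb := bump_lt kn; have vt := it vn.
  have tk : (t v <= bump v k)%N by rewrite leq_bump.
  exists (eqset X (ev (y v)) (fun x => ev (y (bump v k)) x + 1)).
    by constructor 4; exists v, (bump v k); rewrite kb andbT (leq_trans vt tk).
  rewrite cap_eqset; apply: eqset_ext => x xH.
  by rewrite ev_y' yv //; split=> e; lra.
- exists (eqset X (ev (y (bump v i))) (ev (y (bump v j)))).
    by constructor 3; exists (bump v i), (bump v j); rewrite ltn_bump ij bump_lt.
  rewrite cap_eqset; apply: eqset_ext => x xH.
  by rewrite !ev_y'; split=> e; lra.
- exists (eqset X (ev (y (bump v i))) (fun x => ev (y (bump v j)) x + 1)).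
    by constructor 4; exists (bump v i), (bump v j); rewrite ltn_bump ij bump_lt // leq_bump.
  rewrite cap_eqset; apply: eqset_ext => x xH.
  by rewrite !ev_y'; split=> e; lra.
Qed.

Lemma step_restrict K : K \in restriction A H <-> threshold_hyp H n.-1 y' t' w.+1 v' K.
Proof.
split=> [/imfsetP[L /=]|hK].
  by rewrite inE => /andP[/step_delete hL /set0P HL] ->; exact: step_trace_sub.
have [L hL KE] := step_trace_sup hK.
apply/imfsetP; exists L => //=; rewrite inE; apply/andP; split; first exact/step_delete.
rewrite -KE; apply/set0P; exact: hyperplane_neq0 (threshold_hyperplane step_surj hK).
Qed.

Lemma step_unbump_lt i : (i < n.-1)%N -> (i < t' i)%N.
Proof.
move=> i_n; have := it (bump_lt i_n); rewrite /t' /bump /unbump; clear -vn.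
by case: (leqP v i) => /= vi; case: (ltnP v (t _)) => /=; lia.
Qed.

End Step.

Section Recoordinatization.
Variables (X : set E) (n : nat) (y : nat -> afun E) (t : nat -> nat) (v : nat).
Hypotheses (sy : surj_coords X n y) (nv : (n <= v)%N).

(** Translating by -1 turns the hyperplanes [y_k = 0] into [y_k = -1] for every [k]: [w] drops by
    one and [v] becomes 0. *)
Let y1 k := y k + afun_cst E (-1).

Lemma ev_y1 k x : ev (y1 k) x = ev (y k) x - 1.
Proof. by rewrite evD ev_cst. Qed.

Lemma shift_surj : surj_coords X n y1.
Proof.
move=> c; have [x xX xc] := sy (fun k => c k + 1); exists x => // k kn.
by rewrite ev_y1 xc // addrK.
Qed.

Lemma shift_hyp w K : threshold_hyp X n y t w.+1 v K <-> threshold_hyp X n y1 t w 0 K.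
Proof.
split.
  case=> [[k [j [kn jw ->]]]|[k /andP[vk kn] ->]|[i [j [ij ->]]]|[i [j [ij tij ->]]]].
  - case: j jw => [|j] jw.
      constructor 2; exists k => //; apply: eqset_ext => x _.
      by rewrite ev_y1; split=> e; lra.
    constructor 1; exists k, j; split=> //; apply: eqset_ext => x _.
    by rewrite ev_y1 -natr1; split=> e; lra.
  - by have := leq_trans nv vk; rewrite leqNgt kn.
  - constructor 3; exists i, j; split=> //; apply: eqset_ext => x _.
    by rewrite !ev_y1; split=> e; lra.
  - constructor 4; exists i, j; split=> //; apply: eqset_ext => x _.
    by rewrite !ev_y1; split=> e; lra.
case=> [[k [j [kn jw ->]]]|[k /andP[vk kn] ->]|[i [j [ij ->]]]|[i [j [ij tij ->]]]].
- constructor 1; exists k, j.+1; split=> //; apply: eqset_ext => x _.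
  by rewrite ev_y1 -natr1; split=> e; lra.
- constructor 1; exists k, 0%N; split=> //; apply: eqset_ext => x _.
  by rewrite ev_y1; split=> e; lra.
- constructor 3; exists i, j; split=> //; apply: eqset_ext => x _.
  by rewrite !ev_y1; split=> e; lra.
- constructor 4; exists i, j; split=> //; apply: eqset_ext => x _.
  by rewrite !ev_y1; split=> e; lra.
Qed.

Lemma shift_exps d w : threshold_exps d n t w.+1 v = threshold_exps d n t w 0.
Proof.
congr (_ ++ _); apply/eq_in_map => k; rewrite mem_iota add0n => /andP[_ kn].
by rewrite /threshold_exp leqNgt (leq_trans kn nv) /= addn0 addn1 !addSn.
Qed.

Variable a : nat.
Hypotheses (an : (a < n)%N) (at_ : (a < t a)%N).
Hypothesis amin : forall i, (i < a)%N -> (n <= t i)%N.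

(** The coordinate [a] and the old origin exchange roles. The hyperplanes [y_a = y_j + 1] become
    values -1 for [j >= t a], so [t a] is the new [v], and no edge leaves position [a] any more. By
    [amin] no edge ends in [a], which excludes a value 1. *)
Let y2 k := if k == a then - y a else y k - y a.
Let t2 k := if k == a then n else t k.

Lemma ev_y2 k x : ev (y2 k) x = if k == a then - ev (y a) x else ev (y k) x - ev (y a) x.
Proof. by rewrite /y2; case: eqP => _; rewrite ?evN ?evB. Qed.

Lemma recenter_surj : surj_coords X n y2.
Proof.
move=> c; have [x xX xc] := sy (fun k => if k == a then - c a else c k - c a).
exists x => // k kn; rewrite ev_y2 !xc // eqxx; case: eqP => [->|_]; first by rewrite opprK.
by rewrite opprK subrK.
Qed.

Lemma recenter_hyp K : threshold_hyp X n y t 1 v K <-> threshold_hyp X n y2 t2 1 (t a) K.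
Proof.
have noin i j : (i < j)%N -> (t i <= j)%N -> (j < n)%N -> j = a -> False.
  move=> ij tij jn ja; rewrite ja in ij tij; have := leq_trans (amin ij) tij.
  by rewrite leqNgt an.
split.
  case=> [[k [j [kn jw ->]]]|[k /andP[vk kn] ->]|[i [j [/andP[ij jn] ->]]]|[i [j [/andP[ij jn] tij ->]]]].
  - have {jw} -> : j = 0%N by case: j jw.
    case: (ltngtP k a) => [ka|ka|ka].
    + constructor 3; exists k, a; rewrite ka an; split=> //; apply: eqset_ext => x _.
      by rewrite !ev_y2 eqxx ltn_eqF //; split=> e; lra.
    + constructor 3; exists a, k; rewrite ka kn; split=> //; apply: eqset_ext => x _.
      by rewrite !ev_y2 eqxx gtn_eqF //; split=> e; lra.
    + constructor 1; exists a, 0%N; split=> //; apply: eqset_ext => x _.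
      by rewrite ka !ev_y2 eqxx; split=> e; lra.
  - by have := leq_trans nv vk; rewrite leqNgt kn.
  - have i_n := ltn_trans ij jn; case: (eqVneq i a) => [ia|ia].
      have ja : j != a by rewrite -ia gtn_eqF.
      constructor 1; exists j, 0%N; split=> //; apply: eqset_ext => x _.
      by rewrite ia !ev_y2 (negPf ja); split=> e; lra.
    case: (eqVneq j a) => [ja|ja].
      constructor 1; exists i, 0%N; split=> //; apply: eqset_ext => x _.
      by rewrite ja !ev_y2 (negPf ia); split=> e; lra.
    constructor 3; exists i, j; rewrite ij; split=> //; apply: eqset_ext => x _.
    by rewrite !ev_y2 (negPf ia) (negPf ja); split=> e; lra.
  - have ja : j != a by apply/eqP; exact: noin ij tij jn.
    case: (eqVneq i a) => [ia|ia].
      constructor 2; exists j; first by rewrite -ia tij.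
      by apply: eqset_ext => x _; rewrite ia !ev_y2 (negPf ja); split=> e; lra.
    constructor 4; exists i, j; rewrite ij /t2 (negPf ia); split=> //.
    by apply: eqset_ext => x _; rewrite !ev_y2 (negPf ia) (negPf ja); split=> e; lra.
case=> [[k [j [kn jw ->]]]|[k /andP[vk kn] ->]|[i [j [/andP[ij jn] ->]]]|[i [j [/andP[ij jn] tij ->]]]].
- have {jw} -> : j = 0%N by case: j jw.
  case: (ltngtP k a) => [ka|ka|ka].
  + constructor 3; exists k, a; rewrite ka an; split=> //; apply: eqset_ext => x _.
    by rewrite !ev_y2 ltn_eqF //; split=> e; lra.
  + constructor 3; exists a, k; rewrite ka kn; split=> //; apply: eqset_ext => x _.
    by rewrite !ev_y2 gtn_eqF //; split=> e; lra.
  + constructor 1; exists a, 0%N; split=> //; apply: eqset_ext => x _.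
    by rewrite ka !ev_y2 eqxx; split=> e; lra.
- have ka : (a < k)%N := leq_trans at_ vk.
  constructor 4; exists a, k; rewrite ka kn; split=> //; apply: eqset_ext => x _.
  by rewrite !ev_y2 gtn_eqF //; split=> e; lra.
- have i_n := ltn_trans ij jn; case: (eqVneq i a) => [ia|ia].
    have ja : j != a by rewrite -ia gtn_eqF.
    constructor 1; exists j, 0%N; split=> //; apply: eqset_ext => x _.
    by rewrite ia !ev_y2 eqxx (negPf ja); split=> e; lra.
  case: (eqVneq j a) => [ja|ja].
    constructor 1; exists i, 0%N; split=> //; apply: eqset_ext => x _.
    by rewrite ja !ev_y2 eqxx (negPf ia); split=> e; lra.
  constructor 3; exists i, j; rewrite ij; split=> //; apply: eqset_ext => x _.
  by rewrite !ev_y2 (negPf ia) (negPf ja); split=> e; lra.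
- move: tij; rewrite /t2; case: (eqVneq i a) => [_|ia tij]; first by rewrite leqNgt jn.
  have ja : j != a by apply/eqP; exact: noin ij tij jn.
  constructor 4; exists i, j; rewrite ij; split=> //; apply: eqset_ext => x _.
  by rewrite !ev_y2 (negPf ia) (negPf ja); split=> e; lra.
Qed.

Lemma recenter_exps d w : threshold_exps d n t w v = threshold_exps d n t2 w (t a).
Proof.
congr (_ ++ _); apply/eq_in_map => k; rewrite mem_iota add0n => /andP[_ kn].
rewrite /threshold_exp leqNgt (leq_trans kn nv) /= addn0 -!addnA; congr (_ + (_ + _))%N.
case: (ltnP a k) => [ak|ka].
  rewrite (bigD1 (Ordinal ak)) //= [in RHS](bigD1 (Ordinal ak)) //= /t2 eqxx.
  rewrite [(n <= k)%N]leqNgt kn add0n; congr (_ + _)%N; apply: eq_bigr => i.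
  by rewrite -val_eqE /= => /negPf ->.
rewrite [(t a <= k)%N]leqNgt (leq_ltn_trans ka at_) add0n; apply: eq_bigr => i _.
by rewrite /t2 ltn_eqF // (leq_trans (ltn_ord i)).
Qed.

End Recoordinatization.

Section NoOrigin.
Variables (X : set E) (n : nat) (y : nat -> afun E) (t : nat -> nat) (v : nat).
Hypotheses (sy : surj_coords X n.+1 y) (nv : (n < v)%N).
Hypothesis nt : forall i, (i < n.+1)%N -> (n < t i)%N.

(** Here only the [y_i = y_j] are left, a braid arrangement. Taking [y_n + 1] as origin uses its
    translation invariance to save one coordinate and to produce the values -1. *)
Let y3 k := y k - (y n + afun_cst E 1).

Lemma ev_y3 k x : ev (y3 k) x = ev (y k) x - (ev (y n) x + 1).
Proof. by rewrite evB evD ev_cst. Qed.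

Lemma origin_surj : surj_coords X n y3.
Proof.
move=> c; have [x xX xc] := sy (fun k => if (k < n)%N then c k + 1 else 0).
exists x => // k kn; have k_n : (k < n.+1)%N := leqW kn.
rewrite ev_y3 (xc _ k_n) (xc _ (ltnSn n)) kn ltnn.
by rewrite add0r addrK.
Qed.

Lemma origin_hyp K : threshold_hyp X n.+1 y t 0 v K <-> threshold_hyp X n y3 t 0 0 K.
Proof.
split.
  case=> [[k [j []]]|[k /andP[vk kn] ->]|[i [j [/andP[ij jn] ->]]]|[i [j [/andP[ij jn] tij _]]]] //.
  - by have := leq_trans nv vk; rewrite ltnNge -ltnS kn.
  - case: (eqVneq j n) => [jn'|jn'].
      constructor 2; exists i; first by rewrite /= -jn'.
      by apply: eqset_ext => x _; rewrite jn' ev_y3; split=> e; lra.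
    have jn2 : (j < n)%N by rewrite ltn_neqAle jn' -ltnS.
    constructor 3; exists i, j; rewrite ij jn2; split=> //; apply: eqset_ext => x _.
    by rewrite !ev_y3; split=> e; lra.
  - by have := leq_trans (nt (ltn_trans ij jn)) tij; rewrite ltnNge -ltnS jn.
case=> [[k [j []]]|[k /andP[vk kn] ->]|[i [j [/andP[ij jn] ->]]]|[i [j [/andP[ij jn] tij _]]]] //.
- constructor 3; exists k, n; rewrite kn ltnSn; split=> //; apply: eqset_ext => x _.
  by rewrite ev_y3; split=> e; lra.
- constructor 3; exists i, j; rewrite ij ltnS ltnW //; split=> //; apply: eqset_ext => x _.
  by rewrite !ev_y3; split=> e; lra.
- have := leq_trans (nt (leqW (ltn_trans ij jn))) tij.
  by rewrite ltnNge ltnW.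
Qed.

Lemma origin_exps d : (n < d)%N -> threshold_exps d n.+1 t 0 v = threshold_exps d n t 0 0.
Proof.
move=> nd; rewrite /threshold_exps -[n.+1]addn1 iotaD map_cat add0n -catA /=.
have t0 k : (k <= n)%N -> (\sum_(i < k) (t i <= k) = 0)%N.
  move=> kn; apply: big1 => i _; rewrite leqNgt (leq_ltn_trans kn) //.
  by apply: nt; apply: leq_trans (ltn_ord i) (leqW kn).
congr (_ ++ _).
  apply/eq_in_map => k; rewrite mem_iota => /andP[_ kn]; rewrite add0n in kn.
  rewrite /threshold_exp !t0 ?(ltnW kn) // [(v <= k)%N]leqNgt (ltn_trans kn nv) /=; lia.
rewrite {1}/threshold_exp t0 // [(v <= n)%N]leqNgt nv addn1 /= subnn.
by rewrite (_ : d - n = (d - n.+1).+1)%N //; lia.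
Qed.

End NoOrigin.

(** Induction on the number of hyperplanes, as the sum of the exponents. Changes of coordinates do
    not lower it, so the case [v < n] is isolated as [step], to be applied after such a change
    without using the induction hypothesis. *)
Theorem threshold_ifr X n y t w v A : is_affine X -> (n <= adim X)%N ->
  surj_coords X n y -> (forall i, (i < n)%N -> (i < t i)%N) ->
  (w = 0%N -> forall i, (i < n)%N -> (n <= t i)%N) ->
  (forall K, K \in A <-> threshold_hyp X n y t w v K) ->
  ifr X A (threshold_exps (adim X) n t w v).
Proof.
have [m] := ubnP (sumn (threshold_exps (adim X) n t w v)).
elim: m X n y t w v A => // m IH X n y t w v A lm aX nX sy it w0 AP.
have step Y p z s a b B : (sumn (threshold_exps (adim Y) p s a b) < m.+1)%N ->
    is_affine Y -> (p <= adim Y)%N -> surj_coords Y p z ->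
    (forall i, (i < p)%N -> (i < s i)%N) ->
    (a = 0%N -> forall i, (i < p)%N -> (p <= s i)%N) ->
    (forall K, K \in B <-> threshold_hyp Y p z s a b K) -> (b < p)%N ->
    ifr Y B (threshold_exps (adim Y) p s a b).
  move=> lm' aY pY sz is' a0 BP bp; pose H := eqset Y (ev (z b)) (fun=> -1).
  have HB : H \in B := step_H_mem bp BP.
  have hH : hyperplane Y H := threshold_hyperplane sz ((BP H).1 HB).
  have [aH dH] := adim_hyperplane aY hH.
  have [||e [e1 e2]] := @threshold_exps_delete (adim Y) p s a b; first by rewrite bp pY.
    exact: is'.
  have le1 := perm_sumn e1; have le2 := perm_sumn e2.
  rewrite dH /= in e1 e2 le1 le2.
  apply: (ifr_add (H := H) aY hH HB _ _ _); last by rewrite dH; exact: e2.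
    apply: ifr_perm (_ : perm_eq _ (threshold_exps (adim Y) p s a b.+1)) _.
      by rewrite perm_sym dH.
    apply: (IH Y p z s a b.+1) => //; first by rewrite dH in lm' *; lia.
    exact: step_delete.
  apply: (IH H p.-1 _ _ _ _ _ _ aH _ (step_surj sz bp)).
  - by rewrite dH in lm'; lia.
  - by move: pY; rewrite dH; lia.
  - exact: step_unbump_lt.
  - by [].
  - exact: step_restrict.
have base Y p z s B : is_affine Y -> p = 0%N ->
    (forall K, K \in B <-> threshold_hyp Y p z s w v K) ->
    ifr Y B (threshold_exps (adim Y) p s w v).
  move=> aY -> BP; rewrite /threshold_exps /= subn0.
  rewrite (_ : B = fset0); first exact: ifr_nil.
  apply/fsetP => K; rewrite inE; apply/negP => /BP.
  by case=> [[k [j []]]|[k /andP[]]|[i [j [/andP[]]]]|[i [j [/andP[]]]]].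
case: (posnP n) => [n0|npos]; first exact: base AP.
case: (ltnP v n) => [vn|nv]; first exact: step AP vn.
(* With no hyperplane [y_k = -1], the arrangement is rewritten in other
   coordinates for which there is one. *)
case: (posnP w) => [w00|wpos].
  rewrite w00 in w0 AP lm base *.
  case: n npos nX sy it w0 AP nv lm base => // p _ pX sy it w0 AP pv lm base.
  have nt := w0 erefl; rewrite (origin_exps pv nt pX) in lm *.
  have AP' K := iff_trans (AP K) (origin_hyp X y pv nt K).
  have [p0|ppos] := posnP p.
    rewrite /threshold_exps p0 subn0 /= (_ : A = fset0); first exact: ifr_nil.
    apply/fsetP => K; rewrite inE; apply/negP => /AP'; rewrite p0.
    by case=> [[k [j []]]|[k /andP[]]|[i [j [/andP[]]]]|[i [j [/andP[]]]]].
  apply: (step X p _ _ 0%N 0%N A lm aX (ltnW pX) (origin_surj sy)) => //.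
    by move=> i ip; apply: it; exact: leqW.
  by move=> _ i ip; apply: ltnW; apply: nt; exact: leqW.
case: w wpos w0 AP lm base => // w _ w0 AP lm base.
(* Translation lowers the number of values to the present [w], which the condition on [t] allows if
   [w] is positive or no [y_i = y_j + 1] is left. Otherwise the origin moves to the least [a] with
   [t a < n]. *)
case: (boolP ((0 < w)%N || [forall i : 'I_n, n <= t i]%N)) => [h|].
  rewrite (shift_exps t nv) in lm *.
  apply: (step X n _ _ w 0%N A lm aX nX (shift_surj sy) it) => //.
    by move=> w00 i i_n; move: h; rewrite w00 => /forallP/(_ (Ordinal i_n)).
  by move=> K; apply: iff_trans (AP K) _; exact: shift_hyp.
rewrite negb_or -leqNgt leqn0 => /andP[/eqP w00 /forallPn[[b bn] /= tb]].
have [|a] := ex_minnP (P := fun a => (a < n)%N && (t a < n)%N); first by exists b; rewrite bn ltnNge.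
move=> /andP[an ta] amin'; rewrite w00 in AP lm *.
have amin i : (i < a)%N -> (n <= t i)%N.
  move=> ia; rewrite leqNgt; apply/negP => tin.
  by have := amin' i; rewrite tin (ltn_trans ia an) leqNgt ia => /(_ isT).
rewrite (recenter_exps nv (it a an)) in lm *.
apply: (step X n _ _ 1%N (t a) A lm aX nX (recenter_surj sy an)) => //.
  by move=> i i_n; case: eqP => // _; exact: it.
move=> K; apply: iff_trans (AP K) _; exact: (recenter_hyp X y nv an (it a an) amin).
Qed.

End ThresholdChain.

(** * The arrangements Shi(I) *)

Section ShiRoots.
Variables (R : realType) (n : nat).
Local Notation vec := 'rV[R]_n.
Implicit Types (I : {fset vec}) (i j k : 'I_n).

Lemma erootE (p : 'I_n * 'I_n) k : (eroot p : vec) 0 k = (k == p.1)%:R - (k == p.2)%:R.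
Proof. by rewrite !mxE. Qed.

Lemma inner_eroot (x : vec) i j : inner x (eroot (i, j)) = x 0 i - x 0 j.
Proof.
rewrite /inner; under eq_bigr do rewrite erootE mulrBr.
have s l : \sum_k x 0 k * (k == l)%:R = x 0 l.
  rewrite (bigD1 l) //= eqxx mulr1 big1 ?addr0 // => k /negPf ->.
  by rewrite mulr0.
by rewrite sumrB !s.
Qed.

Lemma DeltaP (a : vec) : reflect (exists i j, i != j /\ a = eroot (i, j)) (a \in Delta).
Proof.
apply: (iffP (imfsetP _ _ _ _)) => /= [[[i j] /= ij ->]|[i [j [ij ->]]]]; last by exists (i, j).
by exists i, j; move: ij; rewrite !inE.
Qed.

Lemma Delta_posP (a : vec) :
  reflect (exists i j, (i < j)%N /\ a = eroot (i, j)) (a \in Delta_pos).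
Proof.
apply: (iffP (imfsetP _ _ _ _)) => /= [[[i j] /= ij ->]|[i [j [ij ->]]]]; last by exists (i, j).
by exists i, j; move: ij; rewrite !inE.
Qed.

Lemma simple_rootsP (a : vec) :
  reflect (exists i j, i.+1 = j /\ a = eroot (i, j)) (a \in simple_roots).
Proof.
apply: (iffP (imfsetP _ _ _ _)) => /= [[[i j] /= ij ->]|[i [j [ij ->]]]].
  by exists i, j; split=> //; apply/eqP; move: ij; rewrite !inE.
by exists (i, j) => //=; rewrite !inE /= ij.
Qed.

(* [joined I m] says that the vertices [m - 1] and [m] are in the same block
   of the set partition of the vertices defined by [I]; so [m] is the first
   vertex of a block iff [~~ joined I m] and the last one iff
   [~~ joined I m.+1]. *)
Definition joined I (m : nat) : bool :=
  [exists p : 'I_n * 'I_n, [&& p.1.+1 == p.2 :> nat, p.2 == m :> nat & eroot p \in I]].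

Lemma joinedP I (m : nat) :
  reflect (exists i j, [/\ i.+1 = j, j = m :> nat & eroot (i, j) \in I]) (joined I m).
Proof.
apply: (iffP existsP) => [[[i j] /and3P[/eqP ij /eqP jm pI]]|[i [j [ij jm pI]]]].
  by exists i, j.
by exists (i, j); apply/and3P; split=> //=; apply/eqP.
Qed.

(* A coweight: on the simple roots, [psum m] is nonzero only at [e_m - e_(m+1)],
   so it vanishes on the span of [I] iff [~~ joined I m.+1]. *)
Definition psum (m : nat) (x : vec) : R^o := \sum_(i < n | (i <= m)%N) x 0 i.

Fact psum_linear m : linear (psum m).
Proof.
move=> c x y; rewrite /psum scaler_sumr -big_split; apply: eq_bigr => i _ /=.
by rewrite !mxE.
Qed.
HB.instance Definition _ m := GRing.isLinear.Build R vec R^o *:%R (psum m) (psum_linear m).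

Lemma psum_eroot m i j : psum m (eroot (i, j)) = (i <= m)%:R - (j <= m)%:R.
Proof.
rewrite /psum big_mkcond /=.
have s k : \sum_(l < n) (if (l <= m)%N then (l == k)%:R else 0) = (k <= m)%:R :> R.
  rewrite (bigD1 k) //= eqxx big1 ?addr0; first by case: ifP.
  by move=> l /negPf ->; case: ifP.
rewrite -!s -sumrB; apply: eq_bigr => l _; rewrite erootE.
by case: ifP => // _; rewrite subrr.
Qed.

Lemma psum_span I m a : (I `<=` simple_roots)%fset -> ~~ joined I m.+1 ->
  a \in <<I>>%VS -> psum m a = 0.
Proof.
move=> sI nJ aI; suff /subvP/(_ a aI) : (<<I>> <= lker (linfun (psum m)))%VS.
  by rewrite memv_ker lfunE => /eqP.
apply/span_subvP => b bI; rewrite memv_ker lfunE /=.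
have /simple_rootsP[i [j [ij bE]]] := fsubsetP sI b bI.
rewrite bE psum_eroot -ij; case: (ltngtP i m) => im; rewrite ?subrr //.
case/negP: nJ; apply/joinedP; exists i, j; rewrite -ij im -bE.
by split.
Qed.

(** If [i] is not last in its block, subtracting the simple root [e_i - e_(i+1)] of [I] from
    [e_i - e_j] leaves a root, unless [j = i + 1] and it is in the subsystem; similarly for [j].
    Conversely, [psum] shows that a positive root [e_c - e_d] of the subsystem has [c != i] and
    [d != j]. The difference then has positive coefficients at [i] and [d], or 2 if they coincide,
    which no root has. *)
Lemma C_subP I (b : vec) : (I `<=` simple_roots)%fset ->
  b \in C_sub I <-> exists i j, [/\ (i < j)%N, ~~ joined I i.+1, ~~ joined I j & b = eroot (i, j)].
Proof.
move=> sI.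
have I_sub_pos a : a \in I -> a \in Delta_sub_pos I.
  move=> aI; have /simple_rootsP[i [j [ij aE]]] := fsubsetP sI a aI.
  rewrite !inE (memv_span aI) andbT; apply/andP; split.
    by apply/DeltaP; exists i, j; split=> //; rewrite -val_eqE /= -ij ltn_eqF.
  by apply/Delta_posP; exists i, j; rewrite -ij.
split.
  rewrite inE => /andP[]; rewrite inE => /andP[bD /Delta_posP[i [j [ij bE]]]].
  move=> /allP bA; exists i, j; split=> //.
    apply/joinedP => -[i' [j' [ij' ji' pI]]].
    have ii : i' = i by apply: val_inj; case: ij' => /=; lia.
    rewrite ii in pI ij'; case: (eqVneq j j') => [jj|jj].
      case/negP: bD; rewrite bE jj; have := I_sub_pos _ pI.
      by rewrite inE => /andP[].
    have /negP := bA _ (I_sub_pos _ pI); apply; apply/DeltaP; exists j', j.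
    rewrite eq_sym jj; split=> //; rewrite bE; apply/rowP => k; rewrite mxE [X in _ + X]mxE !erootE /=.
    by rewrite opprB addrC addrA subrK.
  apply/joinedP => -[i' [j' [ij' jj pI]]].
  have {}jj : j' = j by exact: val_inj.
  rewrite jj in pI ij'; case: (eqVneq i i') => [ii|ii].
    case/negP: bD; rewrite bE ii; have := I_sub_pos _ pI.
    by rewrite inE => /andP[].
  have /negP := bA _ (I_sub_pos _ pI); apply; apply/DeltaP; exists i, i'.
  split=> //; rewrite bE; apply/rowP => k; rewrite mxE [X in _ + X]mxE !erootE /=.
  by rewrite opprB addrA subrK.
move=> [i [j [ij iM jm bE]]].
have jpos : (0 < j)%N by exact: leq_ltn_trans ij.
have jm' : ~~ joined I j.-1.+1 by rewrite prednK.
rewrite inE; apply/andP; split.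
  rewrite inE; apply/andP; split; last by apply/Delta_posP; exists i, j.
  apply/negP; rewrite inE => /andP[_ /(psum_span sI iM)].
  by rewrite bE psum_eroot leqnn leqNgt ij subr0 => /eqP; rewrite oner_eq0.
apply/allP => a; rewrite inE => /andP[]; rewrite inE => /andP[_ aI] /Delta_posP[c [d [cd aE]]].
have ci : c != i.
  apply/eqP => ci; have := psum_span sI iM aI.
  by rewrite aE psum_eroot -ci leqnn leqNgt cd subr0 => /eqP; rewrite oner_eq0.
have dj : d != j.
  apply/eqP => dj; have := psum_span sI jm' aI.
  rewrite aE psum_eroot dj (_ : (c <= j.-1)%N); last by rewrite dj in cd; lia.
  rewrite (_ : (j <= j.-1)%N = false) ?subr0; last by lia.
  by move=> /eqP; rewrite oner_eq0.
have ij' : i != j by rewrite -val_eqE /= ltn_eqF.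
have cd' : c != d by rewrite -val_eqE /= ltn_eqF.
apply/DeltaP => -[e [f [ef E]]].
have co k := congr1 (fun x : vec => x 0 k) E.
have {}co k : (k == i)%:R - (k == j)%:R - ((k == c)%:R - (k == d)%:R) =
    (k == e)%:R - (k == f)%:R :> R.
  by have := co k; rewrite mxE [X in _ + X = _]mxE bE aE !erootE.
have := co i; rewrite eqxx (negPf ij') [i == c]eq_sym (negPf ci).
case: (eqVneq i e) => [ie|ie].
  move=> _; have := co d; rewrite eqxx (negPf dj) [d == c]eq_sym (negPf cd').
  have [de|de] := eqVneq d e.
    by rewrite ie -de eqxx; case: (d == f) => /=; lra.
  by case: (d == i); case: (d == f) => /=; lra.
by case: (i == d); case: (i == f) => /=; lra.
Qed.

End ShiRoots.

(** * Reordering the vertices *)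

Section BlockOrder.
Variables (nm : nat -> bool) (n : nat).
Hypotheses (nm0 : nm 0 = false) (nmn : nm n = false) (n_gt0 : (0 < n)%N).

(* [nm j] says that the vertex [j] is not the first one of its block. The
   vertices are reordered by [vpos]: first those with [nm], then the others;
   [vthr i] is the first position of an edge leaving [i]. *)
Let r := count nm (iota 0 n).
Let cm k := count (predC nm) (iota 0 k).
Definition vpos j := if nm j then count nm (iota 0 j) else (r + cm j)%N.
Definition vthr i := if nm i.+1 then n else (r + cm i.+1)%N.

Lemma count_iotaS (p : pred nat) k : count p (iota 0 k.+1) = (count p (iota 0 k) + p k)%N.
Proof. by rewrite -addn1 iotaD count_cat /= addn0. Qed.

Lemma count_iota_le (p : pred nat) i j : (i <= j)%N -> (count p (iota 0 i) <= count p (iota 0 j))%N.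
Proof. by move=> ij; rewrite -(subnKC ij) iotaD count_cat leq_addr. Qed.

Lemma count_iota_lt (p : pred nat) i j : (i < j)%N -> p i ->
  (count p (iota 0 i) < count p (iota 0 j))%N.
Proof. by move=> ij pi; apply: leq_trans (count_iota_le p ij); rewrite count_iotaS pi addn1. Qed.

Lemma count_iotaC k : (count nm (iota 0 k) + cm k = k)%N.
Proof. by rewrite count_predC size_iota. Qed.

Lemma vpos_lt j : (j < n)%N -> (vpos j < n)%N.
Proof.
move=> jn; rewrite /vpos; have := count_iotaC n; rewrite -/r => e; case: ifP => nj.
  have := count_iota_lt jn nj; rewrite -/r; lia.
have : (cm j < cm n)%N by apply: count_iota_lt => //=; rewrite nj.
lia.
Qed.

Lemma vpos_inj i j : (i < n)%N -> (j < n)%N -> vpos i = vpos j -> i = j.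
Proof.
move=> i_n jn; rewrite /vpos; case: ifP => ni; case: ifP => nj e.
- case: (ltngtP i j) => // ij; last by have := count_iota_lt ij nj; lia.
  by have := count_iota_lt ij ni; lia.
- by have := count_iota_lt i_n ni; rewrite -/r; lia.
- by have := count_iota_lt jn nj; rewrite -/r; lia.
- case: (ltngtP i j) => // ij.
    have : (cm i < cm j)%N by apply: count_iota_lt => //=; rewrite ni.
    lia.
  have : (cm j < cm i)%N by apply: count_iota_lt => //=; rewrite nj.
  lia.
Qed.

(** The first vertices of blocks occupy the positions from [r] on in increasing order, so those
    after [i] form a final segment. A vertex that is not last in its block gets the threshold [n],
    beyond all positions. *)
Lemma vthr_le i j : (i < n)%N -> (j < n)%N ->
  (vthr i <= vpos j)%N = [&& ~~ nm i.+1, ~~ nm j & (i < j)%N].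
Proof.
move=> i_n jn; rewrite /vthr; case: ifP => ni /=.
  by rewrite leqNgt vpos_lt.
rewrite /vpos; case: ifP => nj /=.
  have := count_iota_lt jn nj; rewrite -/r; lia.
case: (ltnP i j) => ij.
  by have : (cm i.+1 <= cm j)%N := count_iota_le _ ij; lia.
have : (cm j < cm i.+1)%N by apply: count_iota_lt => //=; rewrite nj.
lia.
Qed.

Lemma vthr_gt i : (i < n)%N -> (vpos i < vthr i)%N.
Proof. by move=> i_n; rewrite ltnNge vthr_le // ltnn !andbF. Qed.

(** Position [r + q] holds the first vertex of the block numbered [q] from 0, and each of the [q]
    earlier blocks has one last vertex. *)
Lemma sum_vthr_le q : (q < n - r)%N -> (\sum_(i < n) (vthr i <= r + q) = q)%N.
Proof.
move=> qm; have cmn := count_iotaC n; rewrite -/r in cmn.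
have S k : (k <= n)%N -> (\sum_(i < k) (vthr i <= r + q) = minn q (cm k.+1).-1)%N.
  elim: k => [|k IH] kn; first by rewrite big_ord0 /cm /= nm0.
  have cS : cm k.+2 = (cm k.+1 + ~~ nm k.+1)%N := count_iotaS _ _.
  rewrite big_ord_recr /= IH ?(ltnW kn) // /vthr cS.
  have : (0 < cm k.+1)%N by apply: leq_trans (count_iota_le _ (_ : 1 <= k.+1)%N); rewrite //= nm0.
  case: ifP => nk /=; first by rewrite addn0 => _; lia.
  by rewrite leq_add2l => c0; case: leqP; lia.
have cS : cm n.+1 = (cm n + ~~ nm n)%N := count_iotaS _ _.
by rewrite S // cS nmn; lia.
Qed.

Lemma sum_vthr_le0 p : (p <= r)%N -> (p < n)%N -> (\sum_(i < n) (vthr i <= p) = 0)%N.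
Proof.
move=> pr pn; apply: big1 => i _; rewrite /vthr; case: ifP => ni; first by rewrite leqNgt pn.
have : (0 < cm i.+1)%N by apply: leq_trans (count_iota_le _ (_ : 1 <= i.+1)%N); rewrite //= nm0.
by lia.
Qed.

Lemma vpos_inv_ex : exists L : nat -> nat,
  (forall k, (k < n)%N -> (L k < n)%N /\ vpos (L k) = k) /\
  (forall i, (i < n)%N -> L (vpos i) = i).
Proof.
pose s (i : 'I_n) : 'I_n := Ordinal (vpos_lt (ltn_ord i)).
have s_inj : injective s.
  by move=> i j /(congr1 val) /= /vpos_inj e; apply: val_inj; exact: e.
have sK := f_invF s_inj.
pose L k := oapp (fun k' : 'I_n => val (invF s_inj k')) 0%N (insub k).
have LP k : (k < n)%N -> (L k < n)%N /\ vpos (L k) = k.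
  move=> kn; rewrite /L insubT /=; split=> //.
  by have /(congr1 val) := sK (Ordinal kn).
exists L; split=> // i i_n; have [Ln Lv] := LP _ (vpos_lt i_n).
exact: vpos_inj.
Qed.

Variable L : nat -> nat.
Hypothesis LP : forall k, (k < n)%N -> (L k < n)%N /\ vpos (L k) = k.
Hypothesis LK : forall i, (i < n)%N -> L (vpos i) = i.
Hypothesis r_gt0 : (0 < r)%N.

Lemma r_lt : (r < n)%N.
Proof.
have := count_iotaC n; rewrite -/r.
have : (0 < cm n)%N by apply: leq_trans (count_iota_le _ (_ : 1 <= n)%N); rewrite //= nm0.
lia.
Qed.

Lemma vexpE k : (k < n.-1)%N ->
  threshold_exp n.-1 (fun i => (vthr (L i.+1)).-1) 1 (vthr (L 0)).-1 k =
  if (k.+1 <= r)%N then (n - k.+1)%N else (n - r)%N.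
Proof.
move=> kn; have kn' : (k.+1 < n)%N by lia.
have Tpos i : (i < n)%N -> (i < vthr (L i))%N.
  by move=> i_n; have [Ln Lv] := LP i_n; rewrite -{1}Lv vthr_gt.
have sumE : (\sum_(i < n) (vthr i <= k.+1) =
    ((vthr (L 0)).-1 <= k) + \sum_(i < k) ((vthr (L i.+1)).-1 <= k))%N.
  have le1 i : (i < n)%N -> ((vthr (L i)).-1 <= k)%N = (vthr (L i) <= k.+1)%N.
    by move=> /Tpos; case: (vthr _).
  transitivity (\sum_(i < k.+1) (vthr (L i) <= k.+1))%N; last first.
    rewrite big_ord_recl le1 //; congr (_ + _)%N; apply: eq_bigr => i _.
    by rewrite le1 //; have := ltn_ord i; lia.
  pose Lo (i : 'I_n) : 'I_n := Ordinal (LP (ltn_ord i)).1.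
  rewrite (reindex Lo) /=; last first.
    exists (fun i : 'I_n => Ordinal (vpos_lt (ltn_ord i))) => i _; apply: val_inj => /=.
      by have [_ ->] := LP (ltn_ord i).
    exact: LK.
  rewrite [RHS](big_ord_widen_cond _ xpredT (fun i => (vthr (L i) <= k.+1) : nat) (ltnW kn')).
  rewrite [RHS]big_mkcond; apply: eq_bigr => i _ /=; case: ltnP => // ki.
  by apply/eqP; rewrite eqb0 -ltnNge; apply: leq_ltn_trans ki (Tpos i (ltn_ord i)).
rewrite /threshold_exp -addnA -sumE; have rn := r_lt.
case: (leqP k.+1 r) => kr; first by rewrite sum_vthr_le0 //; lia.
have kE : (k.+1 = r + (k.+1 - r))%N by lia.
by rewrite kE sum_vthr_le; lia.
Qed.

Lemma vexps_perm :
  perm_eq (nseq (n - r) (n - r)%N ++ index_iota (n - r).+1 n)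
    (threshold_exps n.-1 n.-1 (fun i => (vthr (L i.+1)).-1) 1 (vthr (L 0)).-1).
Proof.
have rn := r_lt; rewrite /threshold_exps subnn cats0.
rewrite (_ : map _ _ = [seq (if k.+1 <= r then n - k.+1 else n - r)%N | k <- iota 0 n.-1]); last first.
  by apply/eq_in_map => k; rewrite mem_iota => /andP[_ kn]; exact: vexpE.
rewrite (_ : n.-1 = r.-1 + (n - r))%N; last by lia.
rewrite iotaD map_cat perm_catC; apply: perm_cat; last first.
  rewrite (_ : map _ _ = nseq (n - r) (n - r)%N) //; apply/esym.
  apply: (@eq_from_nth _ 0%N); rewrite size_nseq ?size_map ?size_iota // => i im.
  rewrite (nth_map 0%N) ?size_iota // nth_iota // nth_nseq im.
  by case: leqP => // kr; lia.
apply: uniq_perm; first exact: iota_uniq.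
  rewrite map_inj_in_uniq ?iota_uniq // => i j; rewrite !mem_iota => /andP[_ ir] /andP[_ jr].
  by rewrite !ifT; lia.
move=> x; rewrite mem_index_iota; apply/idP/mapP => [xr|[k]].
  by exists (n - x).-1; rewrite ?mem_iota ?ifT; lia.
by rewrite mem_iota => kr ->; rewrite ifT; lia.
Qed.

End BlockOrder.

(** * Shi(I) as a threshold arrangement *)

Section ShiExponents.
Variables (R : realType) (n : nat) (I : {fset 'rV[R]_n}).
Local Notation vec := 'rV[R]_n.
Hypothesis sI : (I `<=` simple_roots)%fset.
Local Notation V := (Vsp R n).
Local Notation J := (joined I).

Lemma joined0 : J 0%N = false.
Proof. by apply/negbTE/negP => /joinedP[i [j [ij j0 _]]]; rewrite j0 in ij. Qed.

Lemma joinedn : J n = false.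
Proof. by apply/negbTE/negP => /joinedP[i [j [_ jn _]]]; have := ltn_ord j; rewrite jn ltnn. Qed.

Lemma count_joined : count J (iota 0 n) = #|` I|.
Proof.
(* The predecessor of 0 is 0, a default value that never matters because [J 0] is false. *)
pose p (j : 'I_n) : 'I_n := Ordinal (leq_ltn_trans (leq_pred j) (ltn_ord j)).
pose h (j : 'I_n) : vec := eroot (p j, j).
have hE (i j : 'I_n) : i.+1 = j -> eroot (i, j) = h j.
  by move=> ij; rewrite /h; congr (eroot (_, _)); apply: val_inj; rewrite /= -ij.
rewrite -val_enum_ord count_map -size_filter -(size_map h).
apply/perm_size/uniq_perm.
- rewrite map_inj_in_uniq; first exact: filter_uniq (enum_uniq _).
  move=> j j'; rewrite !mem_filter /=.
  have lt_neq (a b : 'I_n) : J a -> J b -> (a < b)%N -> h a = h b -> False.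
    move=> /joinedP[i [a' [ia aa _]]] /joinedP[i' [b' [ib bb _]]] ab.
    move=> /(congr1 (fun x : vec => x 0 a)); rewrite !erootE /= eqxx.
    have -> : (a == p a) = false by apply/eqP => /(congr1 val) /=; lia.
    have -> : (a == b) = false by apply/eqP => /(congr1 val) /=; lia.
    by case: (a == p b) => /=; lra.
  move=> /andP[Jj _] /andP[Jj' _] e; apply: val_inj; case: (ltngtP j j') => // jj.
    by case: (lt_neq j j').
  by case: (lt_neq j' j).
- exact: fset_uniq.
- move=> a; apply/mapP/idP => [[j]|aI].
    rewrite mem_filter => /andP[/joinedP[i [j' [ij jj aI]]] _] ->.
    have jE : j' = j := val_inj jj.
    by rewrite jE in ij aI; rewrite -(hE i).
  have /simple_rootsP[i [j [ij aE]]] := fsubsetP sI a aI.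
  exists j; last by rewrite -(hE i).
  rewrite mem_filter mem_enum andbT; apply/joinedP; exists i, j.
  by rewrite -aE.
Qed.

Hypothesis n2 : (2 <= n)%N.

(** Indexed by natural numbers, with value 0 from [n] on, to be composed with the reordering [L]. *)
Definition coordf (m : nat) (x : vec) : R^o := \sum_(i < n | i == m :> nat) x 0 i.

Fact coordf_linear m : linear (coordf m).
Proof.
move=> c x y; rewrite /coordf scaler_sumr -big_split; apply: eq_bigr => i _ /=.
by rewrite !mxE.
Qed.
HB.instance Definition _ m := GRing.isLinear.Build R vec R^o *:%R (coordf m) (coordf_linear m).

Lemma coordfE (i : 'I_n) x : coordf i x = x 0 i.
Proof. by rewrite /coordf (big_pred1 i). Qed.

Lemma Vsp_zset : V = zset [set: vec] (linfun (psum n), 0).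
Proof.
have psumn (x : vec) : psum n x = \sum_i x 0 i.
  by rewrite /psum; apply: eq_bigl => i; rewrite ltnW.
apply/seteqP; split=> x.
  by move=> /= xV; split=> //=; rewrite /ev /= addr0 lfunE /= psumn.
by move=> [_ /=]; rewrite /ev /= addr0 lfunE /= psumn.
Qed.

Lemma setT_direction : direction [set: vec] fullv.
Proof. by apply/directionP; split=> [|x y _]; [exists 0|rewrite memvf]. Qed.

Lemma Vsp_direction : direction V (lker (linfun (psum n : vec -> R^o))).
Proof.
rewrite Vsp_zset -[lker _](capfv (lker _)).
apply: (direction_zset (x := 0) setT_direction); split=> //.
by rewrite /= /ev /= linear0 addr0.
Qed.

Lemma Vsp_affine : is_affine V. Proof. by eexists; exact: Vsp_direction. Qed.

Lemma adim_Vsp : adim V = n.-1.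
Proof.
have aT : is_affine [set: vec] by exists fullv; exact: setT_direction.
have hV : hyperplane [set: vec] V.
  exists (linfun (psum n), 0); split; first exact: Vsp_zset.
    by exists 0 => //; rewrite /ev /= linear0 addr0.
  have i : 'I_n by exists 0%N; lia.
  exists (delta_mx 0 i) => //; rewrite /ev /= addr0 lfunE /=.
  rewrite /psum (bigD1 i) /=; last exact: ltnW (ltn_ord i).
  rewrite mxE !eqxx big1 ?addr0 ?oner_eq0 // => j /andP[_ ji].
  by rewrite mxE eqxx (negPf ji).
have [_] := adim_hyperplane aT hV.
by rewrite (adimE setT_direction) dimvf /dim /= mul1n => /(congr1 predn).
Qed.

Lemma CoxP (K : set vec) : K \in Cox R n <->
  exists i j : 'I_n, i != j /\ K = eqset V (coordf i) (coordf j).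
Proof.
have hE i j : hyp (eroot (i, j)) 0 = eqset V (coordf i) (coordf j) :> set vec.
  apply/seteqP; split=> x [xV /= e]; split=> //; move: e; rewrite inner_eroot !coordfE.
    by move=> /eqP; rewrite subr_eq0 => /eqP.
  by move=> ->; rewrite subrr.
split=> [/imfsetP[a /= /Delta_posP[i [j [ij ->]]] ->]|[i [j [ij ->]]]].
  by exists i, j; rewrite -val_eqE /= ltn_eqF.
wlog lt_ij : i j ij / (i < j)%N.
  move=> W; case: (ltngtP i j) => e; first exact: W.
    rewrite (_ : eqset _ _ _ = eqset V (coordf j) (coordf i)); first by apply: W; rewrite // eq_sym.
    by apply: eqset_ext => x _; split=> ->.
  by case/eqP: ij; exact: val_inj.
by rewrite -hE; apply/imfsetP; exists (eroot (i, j)) => //=; apply/Delta_posP; exists i, j.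
Qed.

Lemma ShiP (K : set vec) : K \in Shi I <->
  (exists i j : 'I_n, i != j /\ K = eqset V (coordf i) (coordf j)) \/
  (exists i j : 'I_n, [/\ (i < j)%N, ~~ J i.+1, ~~ J j &
     K = eqset V (coordf i) (fun x => coordf j x + 1)]).
Proof.
have hE i j : hyp (eroot (i, j)) 1 = eqset V (coordf i) (fun x => coordf j x + 1) :> set vec.
  apply/seteqP; split=> x [xV /= e]; split=> //; move: e; rewrite inner_eroot !coordfE.
    by move=> <-; rewrite addrC subrK.
  by move=> ->; rewrite addrAC subrr add0r.
split.
  rewrite /Shi in_fsetU => /orP[/CoxP|]; first by left.
  move=> /imfsetP[b /= /(C_subP _ sI)[i [j [ij iM jm ->]]] ->].
  by right; exists i, j.
rewrite /Shi in_fsetU => -[/CoxP ->//|[i [j [ij iM jm ->]]]].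
apply/orP; right; rewrite -hE; apply/imfsetP; exists (eroot (i, j)) => //=.
by apply/(C_subP _ sI); exists i, j.
Qed.

Let r := #|` I|.

Hypothesis I0 : (0 < #|` I|)%N.

Theorem shi_ifr : ifr V (Shi I) (nseq (n - r) (n - r)%N ++ index_iota (n - r).+1 n).
Proof.
have n0 : (0 < n)%N by lia.
have [L [LP LK]] := vpos_inv_ex joined0 joinedn n0.
pose y k : afun vec := (linfun (coordf (L k.+1)) - linfun (coordf (L 0%N)), 0).
pose t i := (vthr J n (L i.+1)).-1; pose v := (vthr J n (L 0%N)).-1.
have evy k x : ev (y k) x = coordf (L k.+1) x - coordf (L 0%N) x.
  by rewrite /ev /= addr0 add_lfunE opp_lfunE !lfunE.
have Ln k : (k < n)%N -> (L k < n)%N by move=> /LP[].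
have Lv k : (k < n)%N -> vpos J n (L k) = k by move=> /LP[].
have Tpos i : (i < n)%N -> (i < vthr J n (L i))%N.
  by move=> i_n; rewrite -{1}(Lv i i_n); exact: vthr_gt joined0 joinedn n0 _ (Ln i i_n).
apply: (ifr_perm (ds := threshold_exps n.-1 n.-1 t 1 v)).
  rewrite /r -count_joined; apply: (vexps_perm joined0 joinedn n0 LP LK).
  by rewrite count_joined.
rewrite -{1}adim_Vsp; apply: (threshold_ifr (y := y)) => //.
- exact: Vsp_affine.
- by rewrite adim_Vsp.
(* Give the origin the value 0 and the other positions the prescribed values, then subtract the mean
   to land in V. *)
- move=> c; pose z : vec := \row_i (if vpos J n i == 0%N then 0 else c (vpos J n i).-1).
  pose mu := (\sum_i z 0 i) / n%:R.
  have n0' : n%:R != 0 :> R by rewrite pnatr_eq0; lia.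
  exists (\row_i (z 0 i - mu)).
    rewrite /Vsp /=; under eq_bigr do rewrite mxE.
    by rewrite sumrB sumr_const card_ord -mulr_natr mulfVK // subrr.
  move=> k kn; have kn' : (k.+1 < n)%N by lia.
  rewrite evy -[L k.+1]/(nat_of_ord (Ordinal (Ln _ kn'))) -[L 0%N]/(nat_of_ord (Ordinal (Ln _ n0))).
  rewrite !coordfE !mxE /= !Lv //=; ring.
- by move=> i i_n; rewrite /t; have := Tpos i.+1; case: (vthr _ _ _) => [|m] /=; lia.
move=> K; apply: iff_trans (ShiP K) _.
have posO (i : 'I_n) : L (vpos J n i) = i by exact: LK.
have vlt (i : 'I_n) : (vpos J n i < n)%N := vpos_lt joined0 joinedn n0 (ltn_ord i).
split.
  case=> [[i [j [ij ->]]]|[i [j [ij iM jm ->]]]].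
    have : vpos J n i != vpos J n j.
      by apply: contra ij => /eqP e; apply/eqP/val_inj; rewrite /= -(posO i) e posO.
    have -> : eqset V (coordf i) (coordf j) =
        eqset V (coordf (L (vpos J n i))) (coordf (L (vpos J n j))) by rewrite !posO.
    move: (vlt i) (vlt j); move: (vpos J n i) (vpos J n j) => P Q Pn Qn PQ.
    wlog lt_PQ : P Q Pn Qn PQ / (P < Q)%N.
      move=> W; case: (ltngtP P Q) => e; first exact: W.
        rewrite (_ : eqset _ _ _ = eqset V (coordf (L Q)) (coordf (L P))).
          by apply: W; rewrite // eq_sym.
        by apply: eqset_ext => x _; split=> ->.
      by rewrite e eqxx in PQ.
    case: P Pn PQ lt_PQ => [|P] Pn _ lt_PQ; case: Q Qn lt_PQ => // Q Qn lt_PQ.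
      constructor 1; exists Q, 0%N; split=> //; first by lia.
      by apply: eqset_ext => x _; rewrite evy; split=> e; lra.
    constructor 3; exists P, Q; split; first by lia.
    by apply: eqset_ext => x _; rewrite !evy; split=> e; lra.
  have : (vthr J n i <= vpos J n j)%N.
    by rewrite (vthr_le joined0 joinedn n0) // iM jm.
  have -> : eqset V (coordf i) (fun x => coordf j x + 1) =
      eqset V (coordf (L (vpos J n i))) (fun x => coordf (L (vpos J n j)) x + 1) by rewrite !posO.
  rewrite -{1}(posO i); move: (vlt i) (vlt j); move: (vpos J n i) (vpos J n j) => P Q Pn Qn PQ.
  have lt_PQ := leq_trans (Tpos P Pn) PQ.
  case: P Pn PQ lt_PQ => [|P] Pn PQ lt_PQ; case: Q Qn PQ lt_PQ => // Q Qn PQ lt_PQ.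
    constructor 2; exists Q; first by rewrite /v; lia.
    by apply: eqset_ext => x _; rewrite evy; split=> e; lra.
  constructor 4; exists P, Q; split; [by lia|by rewrite /t; lia|].
  by apply: eqset_ext => x _; rewrite !evy; split=> e; lra.
have ordL k (kn : (k < n)%N) : L k = nat_of_ord (Ordinal (Ln k kn)) by [].
have cox P Q (Pn : (P < n)%N) (Qn : (Q < n)%N) : P != Q ->
    exists i j : 'I_n, i != j /\ eqset V (coordf (L P)) (coordf (L Q)) = eqset V (coordf i) (coordf j).
  move=> PQ; exists (Ordinal (Ln P Pn)), (Ordinal (Ln Q Qn)); split=> //.
  by apply: contra PQ => /eqP[e]; rewrite -(Lv P Pn) e Lv.
have shi P Q (Pn : (P < n)%N) (Qn : (Q < n)%N) : (vthr J n (L P) <= Q)%N ->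
    exists i j : 'I_n, [/\ (i < j)%N, ~~ J i.+1, ~~ J j &
      eqset V (coordf (L P)) (fun x => coordf (L Q) x + 1) =
      eqset V (coordf i) (fun x => coordf j x + 1)].
  move=> PQ; exists (Ordinal (Ln P Pn)), (Ordinal (Ln Q Qn)) => /=.
  rewrite -(Lv Q Qn) (vthr_le joined0 joinedn n0 (Ln P Pn) (Ln Q Qn)) in PQ.
  by case/and3P: PQ.
case=> [[k [j [kn jw ->]]]|[k /andP[vk kn] ->]|[i [j [/andP[ij jn] ->]]]|[i [j [/andP[ij jn] tij ->]]]].
- left; have {jw} -> : j = 0%N by case: j jw.
  rewrite (_ : eqset _ _ _ = eqset V (coordf (L k.+1)) (coordf (L 0%N))); first by apply: cox => //; lia.
  by apply: eqset_ext => x _; rewrite evy; split=> e; lra.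
- right; have kn' : (k.+1 < n)%N by lia.
  rewrite (_ : eqset _ _ _ = eqset V (coordf (L 0%N)) (fun x => coordf (L k.+1) x + 1)).
    by apply: shi => //; move: vk; rewrite /v; lia.
  by apply: eqset_ext => x _; rewrite evy; split=> e; lra.
- left; rewrite (_ : eqset _ _ _ = eqset V (coordf (L i.+1)) (coordf (L j.+1))).
    by apply: cox; lia.
  by apply: eqset_ext => x _; rewrite !evy; split=> e; lra.
- right; have jn' : (j.+1 < n)%N by lia.
  rewrite (_ : eqset _ _ _ = eqset V (coordf (L i.+1)) (fun x => coordf (L j.+1) x + 1)).
    by apply: shi => //; [lia|move: tij; rewrite /t; lia].
  by apply: eqset_ext => x _; rewrite !evy; split=> e; lra.
Qed.

End ShiExponents.

(** * Numbers of regions from exponents *)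

Section RegionCount.
Variables (R : realType) (n : nat).
Local Notation vec := 'rV[R]_n.
Implicit Types (X K : set vec) (A : {fset set vec}) (U : {vspace vec}) (ds : seq nat).

Lemma ifr_size X A ds : ifr X A ds -> size ds = adim X.
Proof.
elim=> {X A ds} [X ds _ /perm_size ->|X A H b bs ds aX hH HA _ _ _ IH /perm_size ->].
  by rewrite size_nseq.
by rewrite /= IH (adim_hyperplane aX hH).2.
Qed.

Lemma ifr_wsum X A ds : ifr X A ds -> wsum X A = \prod_(d <- ds) ('X - d%:R%:P).
Proof.
move=> h; rewrite -(ifr_char_poly h) char_poly_whitney //.
  exact: affine_neq0 (ifr_affine h).
by move=> K /(ifr_hyperplane h)/hyperplane_nsub.
Qed.

Lemma ifr_afun X A ds : ifr X A ds ->
  exists f : set vec -> afun vec, {in A, forall K, X `&` K = zset X (f K)}.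
Proof.
move=> h; have /choice[f fP] : forall K, exists g, K \in A -> X `&` K = zset X g.
  move=> K; case: (boolP (K \in A)) => [KA|_]; last by exists 0.
  have [g [KE _ _]] := ifr_hyperplane h KA; exists g => _.
  by rewrite setIidr // KE => x [].
by exists f => K; exact: fP.
Qed.

Lemma horner_prodXsubC (ds : seq nat) (x : int) :
  (\prod_(d <- ds) ('X - d%:R%:P)).[x] = \prod_(d <- ds) (x - d%:R).
Proof. by rewrite horner_prod; apply: eq_bigr => d _; rewrite !hornerE. Qed.

Theorem ifr_regions X A ds : ifr X A ds ->
  (regions X A #= `I_(\prod_(d <- ds) d.+1))%card.
Proof.
move=> h; have [f fP] := ifr_afun h; have [U XU] := ifr_affine h.
have := regions_card XU fP; set N := #|` _|; suff -> : N = (\prod_(d <- ds) d.+1)%N by [].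
apply/eqP; rewrite -(eqr_nat int) /N -card_fset_sum; apply/eqP.
rewrite -[LHS]/(nreg f X A) (zaslavsky XU fP) (ifr_wsum h) horner_prodXsubC.
rewrite -(adimE XU) -(ifr_size h) natr_prod; elim: ds {h} => [|d ds IH].
  by rewrite !big_nil mulr1.
rewrite !big_cons /= exprS -IH mulrACA -natr1; congr (_ * _); ring.
Qed.

Theorem ifr_bounded_regions X A U ds : ifr X A ds -> direction X U ->
  closed [set` U] ->
  (forall u, u \in U -> (forall K x, K \in A -> K x -> K (x + u)) -> u = 0) ->
  all (leq 1) ds ->
  (bounded_regions X A #= `I_(\prod_(d <- ds) d.-1))%card.
Proof.
move=> h XU cU eU ds1; have [f fP] := ifr_afun h.
have := bounded_regions_card XU fP cU; set N := #|` _|.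
suff -> : N = (\prod_(d <- ds) d.-1)%N by [].
(* A direction killed by all functionals translates every member into itself, which is the form in
   which [eU] expresses essentiality. *)
have ess : essential f U A.
  move=> u uU fu; apply: eU => // K x KA Kx; have hK := ifr_hyperplane h KA.
  have KX := hyperplane_sub hK; have KE : K = zset X (f K).
    by rewrite -fP // setIidr.
  have [_ /= e] : zset X (f K) x by rewrite -KE.
  rewrite KE; split; first exact/(direction_mem u XU (KX x Kx)).
  by rewrite /= -[u]scale1r ev_shift e fu // mulr0 addr0.
apply/eqP; rewrite -(eqr_nat int) /N -card_fset_sum; apply/eqP.
rewrite -[LHS]/(nbreg f U X A) (zaslavsky_bounded XU fP ess) (ifr_wsum h) horner_prodXsubC.
rewrite -(adimE XU) -(ifr_size h) natr_prod; elim: ds {h} ds1 => [|d ds IH].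
  by rewrite !big_nil mulr1.
move=> /= /andP[d1 ds1]; rewrite !big_cons exprS -IH // mulrACA; congr (_ * _).
by case: d d1 => // d _; rewrite -natr1 /=; ring.
Qed.

End RegionCount.

Section FreeCone.
Variables (F : fieldType) (E : vectType F).

Theorem ifr_cone_is_free (X : set E) (A : {fset set E}) ds :
  ifr X A ds -> is_free (homogenize X) (cone X A).
Proof.
move=> h; have [U XU] := ifr_affine h; have [[x xX] _] := (directionP X U).1 XU.
have := ifr_cone h; have [V -> _] := homogenize_direction XU xX => hV.
apply: (ifr_is_free hV) => K /coneP[->|[H _ ->]]; last exact: homogenize0.
by split=> //; exact: homogenize0.
Qed.

End FreeCone.

Section ShiRegions.
Variables (R : realType) (n : nat).
Local Notation vec := 'rV[R]_n.
Local Notation V := (Vsp R n).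

Lemma Vsp_closed : closed [set` lker (linfun (psum n : vec -> R^o))].
Proof.
rewrite (_ : [set` _] = (fun x : vec => linfun (psum n : vec -> R^o) x : R) @^-1` [set 0]).
  by apply: closed_comp; [move=> x _; exact: hom_continuous|exact: closed_eq].
by apply/seteqP; split=> x /=; rewrite memv_ker => /eqP.
Qed.

Lemma Cox_essential (u : vec) : V u ->
  (forall K x, K \in Cox R n -> K x -> K (x + u)) -> u = 0.
Proof.
move=> uV uC; have uij (i j : 'I_n) : u 0 i = u 0 j.
  case: (eqVneq i j) => [-> //|ij].
  have KC : eqset V (coordf i) (coordf j) \in Cox R n by apply/CoxP; exists i, j.
  have K0 : eqset V (coordf i) (coordf j) (0 : vec).
    by split; [rewrite /Vsp /= big1 // => k _; rewrite mxE|rewrite !coordfE !mxE].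
  by have := uC _ _ KC K0; rewrite add0r => -[_]; rewrite !coordfE.
apply/rowP => i; rewrite mxE; move: uV; rewrite /Vsp /=.
under eq_bigr do rewrite (uij _ i).
rewrite sumr_const card_ord -mulr_natr => /eqP; rewrite mulf_eq0 pnatr_eq0.
by case/orP=> /eqP // n0; exfalso; have := ltn_ord i; lia.
Qed.

End ShiRegions.

Lemma prod_shi_exps_succ n m : (0 < m < n)%N ->
  (\prod_(d <- nseq m m ++ index_iota m.+1 n) d.+1 = (m + 1) ^ (m - 1) * (n`! %/ m`!))%N.
Proof.
case: n => [|n] /andP[m0 mn] //; rewrite big_cat /= big_nseq iter_muln muln1.
rewrite (fact_split (ltnW mn)) mulKn ?fact_gt0 // addn1 subn1 [in RHS]big_ltn //.
rewrite -{2}(prednK m0) expnS -mulnA [RHS]mulnCA; congr (_ * (_ * _))%N.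
by rewrite [RHS]big_add1.
Qed.

(** The condition fails only for [m = 1], where the product contains a factor [m - 1 = 0]. *)
Lemma prod_shi_exps_pred n m : (0 < m < n)%N ->
  (\prod_(d <- nseq m m ++ index_iota m.+1 n) d.-1 =
    if n - m <= n - 2 then (m - 1) ^ (m - 1) * ((n - 2)`! %/ (m - 2)`!) else 0)%N.
Proof.
move=> /andP[m0 mn]; rewrite big_cat /= big_nseq iter_muln muln1.
case: ifP => h; last by rewrite (_ : m = 1%N) //; lia.
case: m {m0} mn h => [|[|m]] mn h; [by lia|by lia|].
case: n mn h => [|[|n]] mn _; [by lia|by lia|].
rewrite !subSS !subn0 /= (@fact_split n m); last by lia.
rewrite mulKn ?fact_gt0 // [in RHS]big_ltn; last by lia.
rewrite expnS -mulnA [RHS]mulnCA; congr (_ * (_ * _))%N.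
by rewrite !big_add1.
Qed.

Theorem theorem4p6 (R : realType) (n r : nat) (I : {fset 'rV[R]_n}) :
  (2 <= n)%N ->
  (I `<=` simple_roots)%fset ->
  #|` I| = r ->
  (1 <= r)%N ->
  (forall J : {fset 'rV[R]_n}, (J `<=` simple_roots)%fset -> #|` J| = r ->
     char_poly_arr (Vsp R n) (Shi J) = char_poly_arr (Vsp R n) (Shi I)) /\
  exps (Vsp R n) (Shi I) =
    seq_mset (nseq (n - r) (n - r)%:R
              ++ [seq k%:R | k <- index_iota (n - r + 1) n]) /\
  (regions (Vsp R n) (Shi I) #=
    `I_((n - r + 1) ^ (n - r - 1) * (n`! %/ (n - r)`!)))%card /\
  (bounded_regions (Vsp R n) (Shi I) #=
    `I_(if (r <= n - 2)%N
        then (n - r - 1) ^ (n - r - 1) * ((n - 2)`! %/ (n - r - 2)`!)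
        else 0))%card /\
  inductively_free (Vsp R n) (Shi I) /\
  inductively_free (homogenize (Vsp R n)) (cone (Vsp R n) (Shi I)) /\
  is_free (homogenize (Vsp R n)) (cone (Vsp R n) (Shi I)).
Proof.
move=> n2 sI rI r1; have I0 : (0 < #|` I|)%N by rewrite rI.
have h := shi_ifr sI n2 I0; rewrite rI in h.
(* The vertex 0 is first in its block, so fewer than [n] vertices are joined to their
   predecessor. *)
have rn : (r < n)%N.
  rewrite -rI -(count_joined sI).
  apply: (r_lt (nm := joined I)); [exact: joined0|exact: joinedn|by lia|].
  by rewrite count_joined.
have m_n : (0 < n - r < n)%N by lia.
split.
  move=> J sJ rJ; rewrite (ifr_char_poly h).
  have J0 : (0 < #|` J|)%N by rewrite rJ.
  by have := ifr_char_poly (shi_ifr sJ n2 J0); rewrite rJ.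
split; first by rewrite (ifr_exps h) map_cat map_nseq addn1.
split; first by rewrite -(prod_shi_exps_succ m_n); exact: ifr_regions h.
split.
  have -> : (r <= n - 2)%N = (n - (n - r) <= n - 2)%N by rewrite subKn // ltnW.
  rewrite -(prod_shi_exps_pred m_n).
  apply: (ifr_bounded_regions h (Vsp_direction _ _) (@Vsp_closed R n)) => [u uV uA|].
    apply: Cox_essential => [|K x KC Kx].
      have V0 : Vsp R n 0 by rewrite /Vsp /= big1 // => i _; rewrite mxE.
      by have := (direction_mem u (Vsp_direction R n) V0).2 uV; rewrite add0r.
    by apply: uA => //; rewrite /Shi in_fsetU KC.
  rewrite all_cat all_nseq; apply/andP; split; first by lia.
  by apply/allP => d; rewrite mem_index_iota; lia.
split; first exact: ifr_inductively_free h.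
split; first exact: ifr_inductively_free (ifr_cone h).
exact: ifr_cone_is_free h.
Qed.
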